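(* Let $X$ be a generalized Raynaud surface over a pre-Tango curve $C$, as constructed in the context, with polarization $\mathcal Z=\mathcal O_X(\tilde E)\otimes\phi^*\mathcal N_\ell$. Then $H^2(X,\mathcal Z^n)=0$ in each of the following cases: (i) $\ell\mid n$ and $n\ge(\ell-1)(p+1)$ (in particular, if $\ell\mid n$ and $n\ge p(p+1)$); (ii) $\ell\nmid n$ and $n\ge p(p+1)-1$. In particular, $H^2(X,\mathcal Z^n)=0$ for all $n\ge p(p+1)$.
   Context: Construction of the generalized Raynaud surface. Let $k$ be an algebraically closed field of characteristic $p>0$ and $C$ a smooth projective curve over $k$ of genus $g\ge 2$ with function field $K(C)$. A pre-Tango structure on $C$ is an invertible sheaf $\mathcal L=\mathcal O_C(D)$, with $D$ an ample divisor (i.e. $\deg D>0$), such that $(df)\ge pD$ for some $f\in K(C)\setminus K(C)^p$; $C$ is a pre-Tango curve if it has such a structure. Fix such $\mathcal L=\mathcal O_C(D)$ and $f_0\in K(C)\setminus K(C)^p$ with $(df_0)\ge pD$. Fix an integer $e\ge 2$ prime to $p$ with $e\mid\deg\mathcal L$, and an ample invertible sheaf $\mathcal N$ on $C$ with $\mathcal L=\mathcal N^{e}$. Fix an integer $\ell\ge 2$ with $\ell\mid p+1$ and $\ell\mid e$, and put $\mathcal N_\ell:=\mathcal N^{e/\ell}$ (so $\mathcal N_\ell^{\ell}=\mathcal L$). Let $F$ be the Frobenius morphism of $C$ and $\mathcal B^1$ the image of $F_*d:F_*\mathcal O_C\to F_*\Omega^1_C$, so $0\to\mathcal O_C\to F_*\mathcal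 O_C\to\mathcal B^1\to0$ is exact. Then $H^0(C,\mathcal B^1\otimes\mathcal L^{-1})=\{df: (df)\ge pD\}$, and the connecting map $\eta:H^0(C,\mathcal B^1\otimes\mathcal L^{-1})\to H^1(C,\mathcal L^{-1})$ is injective with image the kernel of $F^*:H^1(C,\mathcal L^{-1})\to H^1(C,\mathcal L^{-p})$. The class $\eta(df_0)\neq0$ defines a non-split extension $0\to\mathcal O_C\to\mathcal E\to\mathcal L\to0$ with $\mathcal E$ locally free of rank 2, while $0\to\mathcal O_C\to F^*\mathcal E\to\mathcal L^{p}\to0$ splits (uniquely). Let $\pi:P=\mathbb P(\mathcal E)=\mathrm{Proj}\,S(\mathcal E)\to C$ ($\pi_*\mathcal O_P(1)=\mathcal E$), and let $E\subset P$ be the section of $\pi$ which is the zero divisor of the section $s\in H^0(P,\mathcal O_P(1))=H^0(C,\mathcal E)$ that is the image of $1\in H^0(C,\mathcal O_C)$; so $\mathcal O_P(E)\cong\mathcal O_P(1)$. The splitting gives an exact sequence $0\to\mathcal O_C\to F^*\mathcal E\otimes\mathcal L^{-p}\to\mathcal L^{-p}\to 0$; the image of $1$ in $H^0(C,F^*\mathcal E\otimes\mathcal L^{-p})$ defines a section curve $\Gamma'$ of $P'=\mathbb P(F^*\mathcal E\otimes \mathcal L^{-p})\cong\mathbb P(F^*\mathcal E)\to C$. Let $C''\subset P$ be the preimage of $\Gamma'$ under the relative Frobenius $P\to P'$ over $C$ ($p$-th power on the fibre coordinates). Then $\mathcal O_P(C'')\cong\mathcal O_P(p)\otimes\pi^*\mathcal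 L^{-p}$ and $E\cap C''=\emptyset$. Put $\mathcal M:=\mathcal O_P\big(-\tfrac{p+1}{\ell}\big)\otimes\pi^*\mathcal N_\ell^{\,p}$, so $\mathcal M^{-\ell}=\mathcal O_P(E+C'')$. Let $\psi:X:=\mathcal{S}pec\big(\bigoplus_{i=0}^{\ell-1}\mathcal M^i\big)\to P$ be the cyclic cover of degree $\ell$ ramified at $E+C''$, the algebra structure being tensor product followed, when $i+j\ge\ell$, by multiplication with the section of $\mathcal M^{-\ell}$ defining $E+C''$. Put $\phi=\pi\circ\psi:X\to C$ and $\tilde E=\psi^{-1}(E)$ (the reduced preimage), so $\ell\tilde E=\psi^*E$. *)

(* Defs.v *)
(* MathComp / MathComp-Analysis.

   Sheaves are handled as étalé spaces: a sheaf on X is a family of stalks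
   together with a predicate [cont x s], "the family of germs s is a section of
   the sheaf on some open neighbourhood of x".  Values of s away from x are
   irrelevant.  A section over U is a family s with [cont x s] for all x in U,
   two sections being equal over U when they agree pointwise on U.  Monos, epis
   and exactness of sheaf maps are tested on stalks. *)
From HB Require Import structures.
From mathcomp Require Import all_boot all_algebra.
From mathcomp Require Import boolp classical_sets functions cardinality fsbigop.
From mathcomp Require Import topology.

Set Implicit Arguments.
Unset Strict Implicit.
Unset Printing Implicit Defensive.
Import GRing.Theory.

Local Open Scope classical_set_scope.
Local Open Scope ring_scope.

(** * Étalé spaces and sheaf cohomology *)

Definition etale (X : topologicalType) (T : X -> Type)
    (cont : X -> set (forall x, T x)) : Prop :=
  [/\ forall x s, cont x s -> \forall y \near x, cont y s,
      forall x s t, (\forall y \near x, s y = t y) -> cont x s -> cont x t,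
      forall x (a : T x), exists2 s, cont x s & s x = a &
      forall x s t, cont x s -> cont x t -> s x = t x ->
        \forall y \near x, s y = t y].

Record absheaf (X : topologicalType) := AbSheaf {
  ast :> X -> zmodType;
  acont : X -> set (forall x, ast x);
  acont_etale : etale acont;
  acontB : forall x s t, acont x s -> acont x t ->
    acont x (fun y => s y - t y) }.

Definition ab_hom (X : topologicalType) (F G : absheaf X)
    (f : forall x, F x -> G x) : Prop :=
  (forall x a b, f x (a + b) = f x a + f x b) /\
  (forall x s, acont x s -> acont x (fun y => f y (s y))).

Definition injective_sheaf (X : topologicalType) (I : absheaf X) : Prop :=
  forall (A B : absheaf X) (m : forall x, A x -> B x) (f : forall x, A x -> I x),
    ab_hom m -> (forall x, injective (m x)) -> ab_hom f ->
    exists2 g : forall x, B x -> I x, ab_hom g & forall x a, g x (m x a) = f x a.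

Definition injective_resolution (X : topologicalType) (F : absheaf X)
    (I : nat -> absheaf X) (eps : forall x, F x -> I 0%N x)
    (d : forall n x, I n x -> I n.+1 x) : Prop :=
  [/\ forall n, injective_sheaf (I n),
      ab_hom eps /\ (forall n, ab_hom (d n)),
      forall x, injective (eps x),
      forall x a, d 0%N x a = 0 <-> exists b, a = eps x b &
      forall n x a, d n.+1 x a = 0 <-> exists b, a = d n x b].

(* [H_zero F n]: the n-th right derived functor of global sections, computed
   from an injective resolution, vanishes at F. *)
Definition H_zero (X : topologicalType) (F : absheaf X) (n : nat) : Prop :=
  forall (I : nat -> absheaf X) (eps : forall x, F x -> I 0%N x)
         (d : forall n x, I n x -> I n.+1 x),
    injective_resolution eps d ->
    forall s : (forall x, I n x), (forall x, acont x s) ->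
      (forall x, d n x (s x) = 0) ->
    match n return (forall x, I n x) -> Prop with
    | 0 => fun s => forall x, s x = 0
    | m.+1 => fun s => exists2 t : (forall x, I m x),
                 (forall x, acont x t) & forall x, s x = d m x (t x)
    end s.

(** * Locally ringed spaces *)

Definition isunit (R : comNzRingType) (a : R) : Prop := exists b, b * a = 1.

Record lrs := LRS {
  lrs_top :> topologicalType;
  st : lrs_top -> comNzRingType;
  reg : lrs_top -> set (forall x, st x);
  reg_etale : etale reg;
  reg1 : forall x, reg x (fun y => 1);
  regB : forall x s t, reg x s -> reg x t -> reg x (fun y => s y - t y);
  regM : forall x s t, reg x s -> reg x t -> reg x (fun y => s y * t y);
  st_local : forall x (a b : st x), ~ isunit a -> ~ isunit b -> ~ isunit (a + b) }.

Record mor (X Y : lrs) := Mor {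
  fn :> X -> Y;
  fn_cont : continuous fn;
  sharp : forall x, {rmorphism st (fn x) -> st x};
  sharp_reg : forall x s, reg (fn x) s -> reg x (fun y => sharp y (s (fn y)));
  sharp_local : forall x a, isunit (sharp x a) -> isunit a }.

Lemma mor_comp_cont X Y Z (f : mor X Y) (g : mor Y Z) :
  continuous (fun x => g (f x)).
Proof. by move=> x; apply: (continuous_comp (@fn_cont _ _ f x) (@fn_cont _ _ g (f x))). Qed.

Lemma mor_comp_reg X Y Z (f : mor X Y) (g : mor Y Z) x s :
  reg (g (f x)) s ->
  reg x (fun y => (sharp f y \o sharp g (f y)) (s (g (f y)))).
Proof. by move=> /sharp_reg/sharp_reg. Qed.

Lemma mor_comp_local X Y Z (f : mor X Y) (g : mor Y Z) x a :
  isunit ((sharp f x \o sharp g (f x)) a) -> isunit a.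
Proof. by move=> /sharp_local/sharp_local. Qed.

Definition mor_comp X Y Z (f : mor X Y) (g : mor Y Z) : mor X Z :=
  @Mor X Z (fun x => g (f x)) (@mor_comp_cont X Y Z f g)
    (fun x => (sharp f x \o sharp g (f x)) : {rmorphism _ -> _})
    (@mor_comp_reg X Y Z f g) (@mor_comp_local X Y Z f g).

Definition prime_ideal (R : comNzRingType) (I : set R) : Prop :=
  [/\ I 0, forall a b, I a -> I b -> I (a + b), forall a b, I b -> I (a * b),
      ~ I 1 & forall a b, I (a * b) -> I a \/ I b].

(* [isSpec V th]: V is open and the morphism V -> Spec R defined by the ring map
   th : R -> O(V) is an isomorphism of locally ringed spaces (bijective on
   points, a homeomorphism, and an isomorphism R_p -> O_x on stalks). *)
Definition isSpec (X : lrs) (V : set X) (R : comNzRingType)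
    (th : R -> forall x : X, st x) : Prop :=
  [/\ open V /\ (forall r x, V x -> reg x (th r)),
      forall x, V x -> [/\ th 1 x = 1,
        forall r s, th (r - s) x = th r x - th s x &
        forall r s, th (r * s) x = th r x * th s x],
      forall I : set R, prime_ideal I ->
        exists! x, V x /\ (forall r, I r <-> ~ isunit (th r x)),
      forall x W, V x -> nbhs x W -> exists2 r, isunit (th r x) &
        forall y, V y -> isunit (th r y) -> W y &
      forall x, V x ->
        (forall a : st x, exists r s, isunit (th s x) /\ a * th s x = th r x) /\
        (forall r, th r x = 0 -> exists2 s, isunit (th s x) & s * r = 0)].

(* Nonempty affine opens: the coordinate ring is nonzero. *)
Definition affine (X : lrs) (V : set X) : Prop :=
  exists (R : comNzRingType) (th : R -> forall x : X, st x), isSpec V th.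

Definition is_scheme (X : lrs) : Prop := forall x : X, exists2 V, V x & affine V.

(** * Modules *)

Record modsheaf (X : lrs) := ModSheaf {
  mst :> forall x : X, lmodType (st x);
  mcont : X -> set (forall x, mst x);
  mcont_etale : etale mcont;
  mcontB : forall x s t, mcont x s -> mcont x t -> mcont x (fun y => s y - t y);
  mcontZ : forall x (a : forall x : X, st x) s, reg x a -> mcont x s ->
    mcont x (fun y => a y *: s y) }.

Definition ab_of (X : lrs) (M : modsheaf X) : absheaf X :=
  @AbSheaf X (fun x => M x : zmodType) (@mcont X M) (mcont_etale M) (@mcontB X M).

Definition OO (X : lrs) : modsheaf X :=
  @ModSheaf X (fun x => (st x)^o) (@reg X) (reg_etale X) (@regB X) (@regM X).

Definition mod_hom (X : lrs) (A B : modsheaf X) (f : forall x, A x -> B x) : Prop :=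
  (forall x a u v, f x (a *: u + v) = a *: f x u + f x v) /\
  (forall x s, mcont x s -> mcont x (fun y => f y (s y))).

Definition mod_iso (X : lrs) (A B : modsheaf X) : Prop :=
  exists2 f : forall x, A x -> B x, mod_hom f & forall x, bijective (f x).

Definition isgen (R : comNzRingType) (M : lmodType R) (m : M) : Prop :=
  forall v : M, exists! a : R, v = a *: m.

Definition isbasis2 (R : comNzRingType) (M : lmodType R) (m0 m1 : M) : Prop :=
  forall v : M, exists! a : R * R, v = a.1 *: m0 + a.2 *: m1.

Definition invertible (X : lrs) (L : modsheaf X) : Prop :=
  forall x, exists2 s : (forall x, L x), mcont x s & \forall y \near x, isgen (s y).

Definition bilin (R : comNzRingType) (A B T : lmodType R) (b : A -> B -> T) : Prop :=
  (forall a u v w, b (a *: u + v) w = a *: b u w + b v w) /\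
  (forall a u v w, b w (a *: u + v) = a *: b w u + b w v).

(* (T, b) is the tensor product of A and B: the stalk of A ⊗ B at x is the tensor
   product of the stalks. *)
Definition tensor_by (X : lrs) (A B T : modsheaf X)
    (b : forall x, A x -> B x -> T x) : Prop :=
  [/\ forall x s t, mcont x s -> mcont x t -> mcont x (fun y => b y (s y) (t y)),
      forall x, bilin (b x),
      forall x (M : lmodType (st x)) (f : A x -> B x -> M), bilin f ->
        exists2 g : {linear T x -> M}, True & forall u v, g (b x u v) = f u v &
      forall x (M : lmodType (st x)) (g h : {linear T x -> M}),
        (forall u v, g (b x u v) = h (b x u v)) -> g =1 h].

Definition is_tensor (X : lrs) (A B T : modsheaf X) : Prop :=
  exists b : forall x, A x -> B x -> T x, tensor_by b.

Fixpoint is_tpow (X : lrs) (n : nat) (A T : modsheaf X) : Prop :=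
  match n with
  | 0 => mod_iso (OO X) T
  | m.+1 => exists2 S, is_tpow m A S & is_tensor A S T
  end.

Definition semilin (R S : comNzRingType) (f : R -> S) (A : lmodType R)
    (B : lmodType S) (u : A -> B) : Prop :=
  forall a v w, u (a *: v + w) = f a *: u v + u w.

(* (B, u) is the pullback f^*A: its stalk at x is O_{X,x} ⊗ A_{f x}. *)
Definition pullback_by (X Y : lrs) (f : mor X Y) (A : modsheaf Y) (B : modsheaf X)
    (u : forall x, A (f x) -> B x) : Prop :=
  [/\ forall x s, mcont (f x) s -> mcont x (fun y => u y (s (f y))),
      forall x, semilin (sharp f x) (u x),
      forall x (M : lmodType (st x)) (v : A (f x) -> M), semilin (sharp f x) v ->
        exists2 g : {linear B x -> M}, True & forall a, g (u x a) = v a &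
      forall x (M : lmodType (st x)) (g h : {linear B x -> M}),
        (forall a, g (u x a) = h (u x a)) -> g =1 h].

Definition is_pullback (X Y : lrs) (f : mor X Y) (A : modsheaf Y)
    (B : modsheaf X) : Prop :=
  exists u : forall x, A (f x) -> B x, pullback_by u.

(* Germs at x, of functions vanishing on Z; at x outside Z the unit ideal. *)
Definition reduced_ideal (X : lrs) (Z : set X) (x : X) (a : st x) : Prop :=
  exists f : forall x : X, st x,
    [/\ reg x f, f x = a & \forall y \near x, Z y -> ~ isunit (f y)].

(* L = O_X(Z), for the reduced closed subscheme with support Z (an effective
   Cartier divisor): L is invertible with a section u whose zero scheme is Z. *)
Definition is_O_of_reduced (X : lrs) (Z : set X) (L : modsheaf X) : Prop :=
  invertible L /\
  exists2 u : (forall x, L x), (forall x, mcont x u) &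
  forall x, exists g a, [/\ isgen g, u x = a *: g, (forall b, b * a = 0 -> b = 0) &
    forall b, reduced_ideal Z b <-> exists c, b = c * a].

(** * Smooth projective curves *)

(* A closed immersion into P^n over k, given by sections s_0, ..., s_n of an
   invertible sheaf: each locus where s_i generates is affine (or empty), with
   coordinate ring generated over k by the s_j / s_i. *)
Definition projective (k : fieldType) (X : lrs)
    (kst : forall x : X, {rmorphism k -> st x}) : Prop :=
  exists n (A : modsheaf X) (s : 'I_n.+1 -> forall x, A x),
  [/\ invertible A, forall i x, mcont x (s i), forall x, exists i, isgen (s i x) &
      forall i, let V := [set x | isgen (s i x)] in V !=set0 ->
      exists (R : comNzRingType) (th : R -> forall x : X, st x), isSpec V th /\
      forall S : set R,
        (forall c r, (forall x, V x -> th r x = kst x c) -> S r) ->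
        (forall j r, (forall x, V x -> th r x *: s i x = s j x) -> S r) ->
        (forall a b, S a -> S b -> S (a + b)) ->
        (forall a b, S a -> S b -> S (a * b)) ->
        forall r, S r].

(* For an integral domain R: R is a discrete valuation ring with uniformizer t. *)
Definition uniformizer (R : comNzRingType) (t : R) : Prop :=
  [/\ t <> 0, ~ isunit t &
      forall a, a <> 0 -> exists n u, isunit u /\ a = u * t ^+ n].

(* [gpt] is the generic point, so that [st gpt] is the function field; the
   other points are the closed points. *)
Record curve (k : fieldType) := Curve {
  crv :> lrs;
  kst : forall x : crv, {rmorphism k -> st x};
  kst_reg : forall c x, reg x (fun y => kst y c);
  gpt : crv;
  crv_scheme : is_scheme crv;
  crv_projective : projective kst;
  crv_domain : forall (x : crv) (a b : st x), a * b = 0 -> a = 0 \/ b = 0;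
  crv_generic : forall (x : crv) U, nbhs x U -> U gpt;
  crv_dim1 : exists x : crv, x <> gpt;
  crv_regular : forall x : crv, x <> gpt -> exists t : st x, uniformizer t }.

Definition Kfun (k : fieldType) (C : curve k) : comNzRingType := st (gpt C).

(* m' is the image at the generic point of the germ m. *)
Definition spz (k : fieldType) (C : curve k) (M : modsheaf C) (x : C)
    (m : M x) (m' : M (gpt C)) : Prop :=
  exists s, [/\ mcont x s, s x = m & s (gpt C) = m'].

(* The rational section w of M lies in t^n M_x, i.e. v_x(w) >= n. *)
Definition vge (k : fieldType) (C : curve k) (M : modsheaf C) (x : C)
    (n : int) (w : M (gpt C)) : Prop :=
  exists (t : st x) (t' : Kfun C) (a : M x) (a' : M (gpt C)),
  [/\ uniformizer t, @spz k C (OO C) x t t', spz a a' &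
      match n with
      | Posz m => w = t' ^+ m *: a'
      | Negz m => t' ^+ m.+1 *: w = a'
      end].

Record divisor (k : fieldType) (C : curve k) := Divisor {
  dv :> C -> int;
  dv_finite : finite_set [set x | dv x != 0];
  dv_gpt : dv (gpt C) = 0 }.

Definition deg (k : fieldType) (C : curve k) (D : divisor C) : int :=
  \sum_(x \in [set: C]) D x.

(* iota identifies L with the subsheaf O_C(D) = {h : (h) >= - D} of the constant
   sheaf K(C). *)
Definition is_OD (k : fieldType) (C : curve k) (D : divisor C) (L : modsheaf C)
    (iota : L (gpt C) -> Kfun C) : Prop :=
  [/\ invertible L, bijective iota,
      forall a u v, iota (a *: u + v) = a * iota u + iota v &
      forall x, x <> gpt C -> forall w : L (gpt C),
        (exists m : L x, spz m w) <-> @vge k C (OO C) x (- D x) (iota w)].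

Definition ample (k : fieldType) (C : curve k) (N : modsheaf C) : Prop :=
  exists (A : divisor C) (iota : N (gpt C) -> Kfun C), is_OD A iota /\ 0 < deg A :> int.

Definition derivation (k : fieldType) (C : curve k) (x : C) (M : lmodType (st x))
    (d : st x -> M) : Prop :=
  [/\ forall a b, d (a + b) = d a + d b, forall a b, d (a * b) = a *: d b + b *: d a
    & forall c, d (kst x c) = 0].

(* The sheaf of differentials of C over k. *)
Record kahler (k : fieldType) (C : curve k) := Kahler {
  Om :> modsheaf C;
  dd : forall x, st x -> Om x;
  dd_cont : forall x s, reg x s -> mcont x (fun y => dd (s y));
  dd_der : forall x, derivation (@dd x);
  dd_univ : forall x (M : lmodType (st x)) (D : st x -> M), derivation D ->
    exists2 g : {linear Om x -> M}, True & forall a, g (dd a) = D a;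
  dd_uniq : forall x (M : lmodType (st x)) (g h : {linear Om x -> M}),
    (forall a, g (dd a) = h (dd a)) -> g =1 h }.

(* g = dim_k H^0(C, Omega). *)
Definition genus (k : fieldType) (C : curve k) (W : kahler C) (g : nat) : Prop :=
  exists2 w : 'I_g -> forall x, W x, (forall i x, mcont x (w i)) &
  forall om : (forall x, W x), (forall x, mcont x om) ->
    exists! c : {ffun 'I_g -> k},
      forall x, om x = \sum_(i < g) kst x (c i) *: w i x.

(** * The absolute Frobenius of a curve in characteristic p *)

Section Frobenius.
Variables (k : fieldType) (p : nat) (hp : p \in [pchar k]) (C : curve k).

Lemma st_pchar (x : C) : p \in [pchar (st x)].
Proof. exact: (rmorph_pchar (kst x)). Qed.

Lemma frob_cont : continuous (fun x : C => x).
Proof. by move=> x. Qed.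

Lemma frob_reg (x : C) s :
  reg x s -> reg x (fun y => pFrobenius_aut (st_pchar y) (s y)).
Proof.
move=> hs; have E : forall n, reg x (fun y => s y ^+ n).
  elim=> [|n IH]; first exact: reg1.
  have -> : (fun y : C => s y ^+ n.+1) = (fun y => s y * s y ^+ n).
    by apply: functional_extensionality_dep => y; rewrite exprS.
  exact: regM.
exact: (E p).
Qed.

Lemma frob_local (x : C) (a : st x) :
  isunit (pFrobenius_aut (st_pchar x) a) -> isunit a.
Proof.
case=> b; rewrite pFrobenius_autE => E.
exists (b * a ^+ p.-1); rewrite -mulrA -exprSr prednK //.
by apply: prime_gt0; exact: (pcharf_prime hp).
Qed.

Definition frob : mor C C :=
  @Mor C C (fun x => x) frob_cont
    (fun x => pFrobenius_aut (st_pchar x) : {rmorphism _ -> _})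
    frob_reg frob_local.
End Frobenius.

(** * Pre-Tango structures and the generalized Raynaud surface *)

Record pre_tango (k : fieldType) (p : nat) (C : curve k) (W : kahler C) := PreTango {
  ptD : divisor C;
  ptD_ample : 0 < deg ptD :> int;
  ptL : modsheaf C;
  ptiota : ptL (gpt C) -> Kfun C;
  ptL_OD : is_OD ptD ptiota;
  ptf0 : Kfun C;
  ptf0_notpow : ~ exists g, g ^+ p = ptf0;
  ptf0_div : forall x, x <> gpt C -> vge x (p%:Z * ptD x) (dd W ptf0) }.

(* 0 -> O -i-> E -j-> L -> 0 is an extension with class eta(df0) in H^1(C, L^-1).
   Both classes are connecting images, so they agree iff on a common open cover
   (indexed here by the points of C) there are local splittings rho of j, and
   local lifts h of df0, with equal difference cocycles.  Here F_*O ⊗ L^-1 is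
   the subsheaf {h : (h) >= pD} of K(C), into which L^-1 = O(-D) is mapped by
   alpha |-> alpha^p, with quotient map d onto B^1 ⊗ L^-1.  Since all sheaves
   involved are torsion-free, cocycles are compared at the generic point, on the
   rational section 1 of L = O(D). *)
Definition eta_extension (k : fieldType) (p : nat) (C : curve k) (W : kahler C)
    (T : pre_tango p W) (E : modsheaf C)
    (i : forall x, st x -> E x) (j : forall x, E x -> ptL T x) : Prop :=
  [/\ @mod_hom C (OO C) E i, mod_hom j,
      forall x, injective (i x) /\ (forall l, exists e, j x e = l),
      forall x e, j x e = 0 <-> exists a, e = i x a &
      exists (rho : C -> forall y, ptL T y -> E y) (h : C -> Kfun C),
      [/\ forall x, \forall y \near x,
            [/\ forall a u v, rho x y (a *: u + v) = a *: rho x y u + rho x y v,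
                forall s, mcont y s -> mcont y (fun z => rho x z (s z)) &
                forall l, j y (rho x y l) = l],
          forall x, \forall y \near x, y <> gpt C ->
            @vge k C (OO C) y (p%:Z * ptD T y) (h x),
          forall x, dd W (h x) = dd W (ptf0 T) &
          forall x x' l, ptiota l = 1 -> exists2 al : Kfun C, al ^+ p = h x - h x' &
            rho x (gpt C) l - rho x' (gpt C) l = i (gpt C) al]].

(* (P, pi, O1, q) is Proj S(E) -> C with O(1) and E -> pi_* O(1), for E of rank 2:
   over U = Spec A on which E has basis e0, e1, the locus D_+(e0) where e0 generates
   O(1) is Spec A[e1 / e0]. *)
Definition is_projbundle (C P : lrs) (pi : mor P C) (E : modsheaf C)
    (O1 : modsheaf P) (q : forall y, E (pi y) -> O1 y) : Prop :=
  [/\ invertible O1,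
      forall y s, mcont (pi y) s -> mcont y (fun z => q z (s (pi z))),
      forall y, semilin (sharp pi y) (q y),
      forall y, exists e, isgen (q y e) &
      forall (U : set C) (A : comNzRingType) (th : A -> forall x : C, st x)
          (e0 e1 : forall x, E x), isSpec U th ->
        (forall x, U x -> [/\ mcont x e0, mcont x e1 & isbasis2 (e0 x) (e1 x)]) ->
        let V := [set y | U (pi y) /\ isgen (q y (e0 (pi y)))] in
        exists Th : {poly A} -> forall y : P, st y,
        isSpec V Th /\ forall y, V y ->
          (forall a, Th a%:P y = sharp pi y (th a (pi y))) /\
          Th 'X y *: q y (e0 (pi y)) = q y (e1 (pi y))].

(* The relative Frobenius P = P(E) -> P' = P(F^*E ⊗ N) over C, the p-th power on the
   fibre coordinates: the coordinate (F^*e1 ⊗ v) / (F^*e0 ⊗ v) of P' pulls back to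
   (e1 / e0)^p.  [tw x e v] stands for F^*e ⊗ v. *)
Definition is_relfrob (p : nat) (C P P' : lrs) (pi : mor P C) (pi' : mor P' C)
    (E E'' N : modsheaf C) (tw : forall x, E x -> N x -> E'' x)
    (O1 : modsheaf P) (q : forall y, E (pi y) -> O1 y)
    (O1' : modsheaf P') (q' : forall y, E'' (pi' y) -> O1' y) (fr : mor P P') : Prop :=
  [/\ forall y, pi' (fr y) = pi y,
      forall y (a : forall x : C, st x), reg (pi y) a ->
        sharp fr y (sharp pi' (fr y) (a (pi' (fr y)))) = sharp pi y (a (pi y)) &
      forall y (e0 e1 : forall x, E x) (v : forall x, N x),
        mcont (pi y) e0 -> mcont (pi y) e1 -> mcont (pi y) v ->
        isgen (v (pi y)) -> isgen (q y (e0 (pi y))) ->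
        let x' := pi' (fr y) in
        isgen (q' (fr y) (tw x' (e0 x') (v x'))) /\
        forall a a', q y (e1 (pi y)) = a *: q y (e0 (pi y)) ->
          q' (fr y) (tw x' (e1 x') (v x')) = a' *: q' (fr y) (tw x' (e0 x') (v x')) ->
          sharp fr y a' = a ^+ p].

(* X = Spec(M^0 + ... + M^(l-1)) over P, with product the tensor product followed,
   in degrees >= l, by a section sigma of M^-l.  As M has rank one, sigma is
   given as an l-homogeneous function m |-> sigma(m^l) on M; c is the inclusion of
   M in psi_* O_X.  Over V = Spec A on which m generates M, the degree i summand is
   A c(m)^i, and c(m)^l = sigma(m^l). *)
Definition is_cyclic_cover (l : nat) (P X : lrs) (psi : mor X P) (M : modsheaf P)
    (sigma : forall y, M y -> st y) (c : forall x, M (psi x) -> st x) : Prop :=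
  [/\ forall x s, mcont (psi x) s -> reg x (fun z => c z (s (psi z))),
      forall x a u v, c x (a *: u + v) = sharp psi x a * c x u + c x v,
      forall x m, c x m ^+ l = sharp psi x (sigma (psi x) m) &
      forall (V : set P) (A : comNzRingType) (th : A -> forall y : P, st y)
          (m : forall y, M y), isSpec V th ->
        (forall y, V y -> mcont y m /\ isgen (m y)) ->
        let V' := [set x | V (psi x)] in
        exists (B : comNzRingType) (Th : B -> forall x : X, st x)
               (f : {rmorphism A -> B}) (t : B),
        [/\ isSpec V' Th,
            forall a x, V' x -> Th (f a) x = sharp psi x (th a (psi x)),
            forall x, V' x -> Th t x = c x (m (psi x)) &
            forall b, exists! a : {ffun 'I_l -> A}, b = \sum_(i < l) f (a i) * t ^+ i]].

(* sigma is a section of M^-l with zero divisor E + C'', where E is the zero divisor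
   of s, and C'' the pullback under fr of the zero divisor of s'. *)
Definition defines_sum (l : nat) (P P' : lrs) (fr : mor P P')
    (O1 : modsheaf P) (s : forall y, O1 y) (O1' : modsheaf P') (s' : forall y, O1' y)
    (M : modsheaf P) (sigma : forall y, M y -> st y) : Prop :=
  [/\ forall y m, mcont y m -> reg y (fun z => sigma z (m z)),
      forall y a m, sigma y (a *: m) = a ^+ l * sigma y m &
      forall y (m : M y) (g : O1 y) (g' : O1' (fr y)) a a',
        isgen m -> isgen g -> isgen g' -> s y = a *: g -> s' (fr y) = a' *: g' ->
        exists2 v, isunit v & sigma y m = v * (a * sharp fr y a')].

Record raynaud (k : fieldType) (p : nat) (hp : p \in [pchar k]) (C : curve k)
    (W : kahler C) (T : pre_tango p W) (e l : nat) := Raynaud {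
  (* N with N^e = L, and N_l = N^(e/l) *)
  rN : modsheaf C;
  rN_ample : ample rN;
  rN_pow : is_tpow e rN (ptL T);
  rNl : modsheaf C;
  rNl_pow : is_tpow (e %/ l) rN rNl;
  (* E and P = P(E) *)
  rE : modsheaf C;
  ri : forall x, st x -> rE x;
  rj : forall x, rE x -> ptL T x;
  rE_ext : eta_extension ri rj;
  rP : lrs;
  rpi : mor rP C;
  rO1 : modsheaf rP;
  rq : forall y, rE (rpi y) -> rO1 y;
  rP_bundle : is_projbundle rq;
  (* F^*E, L^p = F^*L, and the splitting of F^*E -> L^p *)
  rFE : modsheaf C;
  ruE : forall x, rE x -> rFE x;
  rFE_pullback : @pullback_by _ _ (frob hp C) rE rFE ruE;
  rLp : modsheaf C;
  ruL : forall x, ptL T x -> rLp x;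
  rLp_pullback : @pullback_by _ _ (frob hp C) (ptL T) rLp ruL;
  rFj : forall x, rFE x -> rLp x;
  rFj_hom : mod_hom rFj;
  rFj_pullback : forall x v, rFj (ruE v) = ruL (rj v) :> rLp x;
  rtau : forall x, rLp x -> rFE x;
  rtau_hom : mod_hom rtau;
  rtau_split : forall x v, rFj (rtau v) = v :> rLp x;
  (* L^-p, E'' = F^*E ⊗ L^-p, and the global section w of E'' corresponding to tau *)
  rLmp : modsheaf C;
  rdual : forall x, rLp x -> rLmp x -> st x;
  rdual_tensor : @tensor_by C rLp rLmp (OO C) rdual;
  rE'' : modsheaf C;
  rtw : forall x, rFE x -> rLmp x -> rE'' x;
  rtw_tensor : tensor_by rtw;
  rw : forall x, rE'' x;
  rw_tau : forall x (v : rLp x) (v' : rLmp x), rdual v v' = 1 ->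
    rw x = rtw (rtau v) v';
  (* P' = P(F^*E ⊗ L^-p) and the relative Frobenius *)
  rP' : lrs;
  rpi' : mor rP' C;
  rO1' : modsheaf rP';
  rq' : forall y, rE'' (rpi' y) -> rO1' y;
  rP'_bundle : is_projbundle rq';
  rfr : mor rP rP';
  rfr_relfrob : is_relfrob p (fun x (a : rE x) v => rtw (ruE a) v) rq rq' rfr;
  (* M = O_P(-(p+1)/l) ⊗ pi^* N_l^p *)
  rNlp : modsheaf C;
  rNlp_pow : is_tpow p rNl rNlp;
  rpiNlp : modsheaf rP;
  rpiNlp_pullback : is_pullback rpi rNlp rpiNlp;
  rO1r : modsheaf rP;
  rO1r_pow : is_tpow (p.+1 %/ l) rO1 rO1r;
  rM : modsheaf rP;
  rM_tensor : is_tensor rM rO1r rpiNlp;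
  (* the section of M^-l defining E + C'', and the cyclic cover X *)
  rsigma : forall y, rM y -> st y;
  rsigma_div : defines_sum l rfr (fun y => rq (@ri (rpi y) 1))
                 (fun y => rq' (rw (rpi' y))) rsigma;
  rX : lrs;
  rpsi : mor rX rP;
  rc : forall x, rM (rpsi x) -> st x;
  rX_cover : is_cyclic_cover l rsigma rc }.

Arguments ri {k p hp C W T e l} _ [x].
Arguments rX {k p hp C W T e l}.
Arguments rpsi {k p hp C W T e l}.
Arguments rpi {k p hp C W T e l}.
Arguments rNl {k p hp C W T e l}.

Definition rphi k p hp C W T e l (S : @raynaud k p hp C W T e l) : mor (rX S) C :=
  mor_comp (rpsi S) (rpi S).

(* The support of the zero divisor E of the section of O_P(1) that is the image of
   1, and its preimage in X. *)
Definition Esupp k p hp C W T e l (S : @raynaud k p hp C W T e l) : set (rP S) :=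
  [set y | ~ isgen (rq (ri S (1 : st (rpi S y))))].

Arguments Esupp {k p hp C W T e l}.

Definition Etilde k p hp C W T e l (S : @raynaud k p hp C W T e l) : set (rX S) :=
  [set x | Esupp S (rpsi S x)].

Arguments Etilde {k p hp C W T e l}.

(* Z = O_X(Etilde) ⊗ phi^* N_l. *)
Definition is_polarization k p hp C W T e l (S : @raynaud k p hp C W T e l)
    (Z : modsheaf (rX S)) : Prop :=
  exists OE phiN, [/\ is_O_of_reduced (Etilde S) OE,
    is_pullback (rphi S) (rNl S) phiN & is_tensor OE phiN Z].

(* Main.v *)
Require Import Defs.
From HB Require Import structures.
From mathcomp Require Import all_boot all_algebra.
From mathcomp Require Import boolp classical_sets functions cardinality fsbigop.
From mathcomp Require Import topology.
From mathcomp Require Import ring zify.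

(* All cases follow from the single bound n + l >= (l - 1) p. Over a small affine U in C,
   P is covered by V0 = D_+(e0) and V1 = D_+(e1), where e1 is the image of 1 in E and e0
   lifts a generator of L; put x = e1 / e0. The preimages W0, W1 in X are affine, V1 is
   the complement of E, and with r = (p + 1) / l the generators t0, t1 of M on the two
   charts satisfy t0 = x^r t1 and t0^l = unit * x (1 + c x^p). Near the reduced preimage
   of E, cut out by t0, one thus has x = unit * t0^l. If z denotes the canonical section
   of O_X(Etilde) times a generator of N_l, sections of Z^n over the intersection are sums
   of terms a x^j t0^i z^n with i < l. Such a term extends to W1 if j + i r <= 0, and to
   W0 if l j + i + n >= 0; the bound says that one of the two holds. Hence
   H^1(phi^-1 U, Z^n) = H^2(phi^-1 U, Z^n) = 0 by Mayer-Vietoris, and as C has dimension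
   one, a Leray argument gives H^2(X, Z^n) = 0.

   On an affine open the cohomology vanishes since the functions f for which a given
   class dies on D(f) form an ideal: D(f + g) is covered by the two affine opens
   D(f (f + g)) and D(g (f + g)), to which Mayer-Vietoris applies. *)

Set Implicit Arguments.
Unset Strict Implicit.
Unset Printing Implicit Defensive.
Import GRing.Theory.

(** Origin of the bound: a term x^j t0^i z^n that does not extend to W1 has j >= 1 - i r, and since
    l r = p + 1 this gives l j + i + n >= l + n - i p, with worst case i = l - 1. The quantity l j +
    i + n is an exponent of t0: near Etilde, x counts as t0^l and z is a multiple of t0. The last
    point is the main obstacle. O_X(Etilde) is given only through the functions vanishing on a
    support, so each of them has to be shown to be a multiple of t0. This is derived from the
    freeness of the coordinate ring of W0 over A[x], with A a domain, and not from regularity of X.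
    That x is a unit times t0^l where x is not invertible is the disjointness of E and C'': there 1
    + c x^p is a unit. Cohomology on open sets is expressed by primitives in the given resolution.
    Classes in degree 2 are glued by extending sections of the first injective sheaf, so neither
    restricted resolutions nor spectral sequences occur. *)

Section EtaleSheaves.
Local Open Scope classical_set_scope.
Local Open Scope ring_scope.

(** Sections are families of germs, so many of them are built by stalkwise choice through this
    lemma, with continuity checked afterwards. *)
Lemma dep_choice (X : Type) (T : X -> Type) (P : forall x, T x -> Prop) :
  (forall x, exists b, P x b) -> exists f : forall x, T x, forall x, P x (f x).
Proof. by move=> H; exists (fun x => sval (cid (H x))) => x; case: cid. Qed.

Lemma openP (X : topologicalType) (U : set X) x : open U -> U x -> nbhs x U.
Proof. by move=> oU Ux; exact: open_nbhs_nbhs. Qed.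

Lemma nbhs_open (X : topologicalType) (x : X) (P : set X) :
  nbhs x P -> exists U, [/\ open U, U x & U `<=` P].
Proof.
rewrite nbhsE => -[U [oU Ux] UP]; by exists U.
Qed.

(** * Sections of abelian sheaves *)

Section AbSheaf.
Variables (X : topologicalType) (F : absheaf X).

Lemma acont_near x (s : forall x, F x) : acont x s -> \forall y \near x, acont y s.
Proof. by case: (acont_etale F) => H _ _ _; exact: H. Qed.

Lemma acont_cong x (s t : forall x, F x) :
  (\forall y \near x, s y = t y) -> acont x s -> acont x t.
Proof. by case: (acont_etale F) => _ H _ _; exact: H. Qed.

Lemma acont_germ x (a : F x) : exists2 s : forall x, F x, acont x s & s x = a.
Proof. by case: (acont_etale F) => _ _ H _; exact: H. Qed.

Lemma acont_eq x (s t : forall x, F x) : acont x s -> acont x t -> s x = t x ->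
  \forall y \near x, s y = t y.
Proof. by case: (acont_etale F) => _ _ _ H; exact: H. Qed.

Lemma acont0 x : acont x (fun y => 0 : F y).
Proof.
have [s hs _] := acont_germ (0 : F x).
by apply: acont_cong (acontB hs hs); apply: nearW => y; rewrite subrr.
Qed.

Lemma acontN x (s : forall x, F x) : acont x s -> acont x (fun y => - s y).
Proof.
move=> hs; apply: acont_cong (acontB (acont0 x) hs).
by apply: nearW => y; rewrite sub0r.
Qed.

Lemma acontD x (s t : forall x, F x) : acont x s -> acont x t ->
  acont x (fun y => s y + t y).
Proof.
move=> hs ht; apply: acont_cong (acontB hs (acontN ht)).
by apply: nearW => y; rewrite opprK.
Qed.

Definition csec (U : set X) (s : forall x, F x) := forall x, U x -> acont x s.

Lemma csecS (U V : set X) s : U `<=` V -> csec V s -> csec U s.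
Proof. by move=> UV h x /UV; exact: h. Qed.

Lemma csec_eq (U : set X) (s t : forall x, F x) : open U -> csec U s ->
  (forall x, U x -> s x = t x) -> csec U t.
Proof.
move=> oU hs e x Ux; apply: acont_cong (hs x Ux).
by apply: filterS (openP oU Ux) => y /e.
Qed.

Lemma csec_glue (U V : set X) (s t : forall x, F x) : open U -> open V ->
  csec U s -> csec V t -> (forall x, U x -> V x -> s x = t x) ->
  exists r, [/\ csec (U `|` V) r, forall x, U x -> r x = s x &
    forall x, V x -> r x = t x].
Proof.
move=> oU oV hs ht e.
have [r rU rV] : exists2 r, forall x, U x -> r x = s x & forall x, V x -> r x = t x.
  exists (fun x => if pselect (U x) then s x else t x) => x.
    by case: pselect.
  by case: pselect => // Ux Vx; exact: e.
exists r; split=> // x [Ux|Vx].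
  by apply: (csec_eq oU hs) => // y /rU.
by apply: (csec_eq oV ht) => // y /rV.
Qed.

End AbSheaf.

Lemma ab_homB (X : topologicalType) (F G : absheaf X) (f : forall x, F x -> G x) :
  ab_hom f -> forall x a b, f x (a - b) = f x a - f x b.
Proof.
move=> hf x a b; apply: (@addIr _ (f x b)).
by rewrite subrK -(proj1 hf) subrK.
Qed.

(** * Sections of injective sheaves extend from open sets *)

Section Flasque.
Variables (X : topologicalType) (U : set X).
Hypothesis oU : open U.

(** The length of the row is the truth value of [U x], so that one type family is free of rank 1 on
    [U] and zero elsewhere; [sm] embeds it in the integers. *)
Let A (x : X) : zmodType := 'rV[int]_(`[<U x>]).
Let sm (x : X) (a : A x) : int := \sum_j a ord0 j.

Let smB x (a b : A x) : sm (a - b) = sm a - sm b.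
Proof. by rewrite /sm -sumrB; apply: eq_bigr => j _; rewrite !mxE. Qed.

Let sm_inj x : injective (@sm x).
Proof.
rewrite /sm /A; case: `[<U x>] => a b /=.
  by rewrite !big_ord1 => e; apply/rowP => j; rewrite !ord1.
by move=> _; apply/rowP => -[].
Qed.

Let sm_const x n : U x -> sm (const_mx n : A x) = n.
Proof.
move=> /asboolT Ux; rewrite /sm; under eq_bigr do rewrite mxE.
by rewrite sumr_const card_ord Ux.
Qed.

Let sm_out x (a : A x) : sm a != 0 -> U x.
Proof.
rewrite /sm; have [//|/asboolF nU] := pselect (U x).
suff -> : \sum_j a ord0 j = 0 by rewrite eqxx.
by apply: big1 => -[j hj]; exfalso; move: hj; rewrite nU.
Qed.

(** At a point off [U] the constant has to be 0, so a section vanishes on a whole neighbourhood of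
    it: this is the extension by zero. *)
Let acA (x : X) (s : forall x, A x) : Prop :=
  exists n, (n != 0 -> U x) /\ \forall y \near x, sm (s y) = n.

Let etA : etale acA.
Proof.
split.
- move=> x s [n [nU hn]].
  have [n0|n0] := eqVneq n 0.
    have := nbhs_interior hn; apply: filterS => y hy; exists n; split=> //.
    by rewrite n0 eqxx.
  have := nbhs_interior hn; apply: filterS2 (openP oU (nU n0)) => y Uy hy.
  by exists n; split.
- move=> x s t e [n [nU hn]]; exists n; split=> //.
  by apply: filterS2 e hn => y ->.
- move=> x a; have [e|n0] := eqVneq (sm a) 0.
    exists (fun y => 0); last by apply: sm_inj; rewrite e /sm big1// => j _; rewrite mxE.
    exists 0; split; first by rewrite eqxx.
    by apply: nearW => y; rewrite /sm big1// => j _; rewrite mxE.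
  have Ux := sm_out n0; exists (fun y => const_mx (sm a)).
    exists (sm a); split=> //; apply: filterS (openP oU Ux) => y Uy.
    by rewrite sm_const.
  by apply: sm_inj; rewrite sm_const.
- move=> x s t [n [_ hn]] [m [_ hm]] e.
  have := nbhs_singleton hm; rewrite -e (nbhs_singleton hn) => enm.
  by apply: filterS2 hn hm => y e1 e2; apply: sm_inj; rewrite e1 e2.
Qed.

Let acAB x (s t : forall x, A x) : acA x s -> acA x t -> acA x (fun y => s y - t y).
Proof.
move=> [n [nU hn]] [m [mU hm]]; exists (n - m); split.
  have [n0|/nU//] := eqVneq n 0; have [m0|/mU//] := eqVneq m 0.
  by rewrite n0 m0 subr0 eqxx.
by apply: filterS2 hn hm => y; rewrite smB => -> ->.
Qed.

Let acB (x : X) (s : X -> int) : Prop := exists n, \forall y \near x, s y = n.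

Let etB : @etale X (fun=> int) acB.
Proof.
split.
- move=> x s [n hn]; have := nbhs_interior hn.
  by apply: filterS => y hy; exists n.
- by move=> x s t e [n hn]; exists n; apply: filterS2 e hn => y ->.
- by move=> x a; exists (fun=> a) => //; exists a; exact: nearW.
- move=> x s t [n hn] [m hm] e.
  have := nbhs_singleton hm; rewrite -e (nbhs_singleton hn) => enm.
  by apply: filterS2 hn hm => y e1 e2; rewrite e1 e2.
Qed.

Let acBB (x : X) (s t : X -> int) : acB x s -> acB x t -> acB x (fun y => s y - t y).
Proof.
by move=> [n hn] [m hm]; exists (n - m); apply: filterS2 hn hm => y -> ->.
Qed.

(* The inclusion of the extension by zero of the constant sheaf Z on U into the
   constant sheaf Z: a section over U is a map from the former. *)
Lemma injective_flasque (I : absheaf X) (r : forall x, I x) :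
  injective_sheaf I -> csec U r ->
  exists r', (forall x, acont x r') /\ forall x, U x -> r' x = r x.
Proof.
move=> hI hr.
pose SA := AbSheaf etA acAB; pose SB := @AbSheaf X (fun=> int) acB etB acBB.
have h1 : @ab_hom X SA SB sm.
  split.
    move=> x a b; rewrite /sm -big_split.
    by apply: eq_bigr => j _; rewrite mxE.
  by move=> x s [n [_ hn]]; exists n.
have h2 : @ab_hom X SA I (fun x a => r x *~ sm a).
  split; first by move=> x a b; rewrite (proj1 h1) mulrzDr.
  move=> x s [n [nU hn]].
  have cz (z : int) : U x -> acont x (fun y => r y *~ z).
    move=> Ux; have cn (m : nat) : acont x (fun y => r y *+ m).
      elim: m => [|m IH]; first by apply: acont_cong (acont0 I x); exact: nearW.
      by apply: acont_cong (acontD (hr x Ux) IH); apply: nearW => y; rewrite mulrS.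
    case: z => m; first exact: cn.
    by apply: acont_cong (acontN (cn m.+1)); apply: nearW => y; rewrite NegzE mulrNz.
  have [n0|n0] := eqVneq n 0.
    by apply: acont_cong (acont0 I x); apply: filterS hn => y ->; rewrite n0.
  by apply: acont_cong (cz n (nU n0)); apply: filterS hn => y ->.
have [g hg gE] := hI SA SB sm _ h1 sm_inj h2.
(* The extended section is the image of the global section 1 of the constant sheaf. *)
exists (fun x => g x 1); split=> [x|x Ux].
  by apply: (proj2 hg x (fun=> 1)); exists 1; exact: nearW.
by have := gE x (const_mx 1); rewrite sm_const.
Qed.

End Flasque.

(** * Exactness on opens and Mayer-Vietoris gluing *)

Section Exactness.
Variables (X : topologicalType) (A B : absheaf X) (d : forall x, A x -> B x).
Hypothesis hd : ab_hom d.

Definition exact_on (s : forall x, B x) (U : set X) :=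
  exists2 t : forall x, A x, csec U t & forall x, U x -> s x = d (t x).

Lemma exact_onS s U V : V `<=` U -> exact_on s U -> exact_on s V.
Proof.
by move=> VU [t ht e]; exists t => [|x /VU]; [exact: csecS ht | exact: e].
Qed.

Lemma exact_on_glue s U V t t' : open U -> open V ->
  csec U t -> (forall x, U x -> s x = d (t x)) ->
  csec V t' -> (forall x, V x -> s x = d (t' x)) ->
  (forall x, U x -> V x -> t x = t' x) -> exact_on s (U `|` V).
Proof.
move=> oU oV ht e ht' e' ett.
have [r [hr rU rV]] := csec_glue oU oV ht ht' ett.
by exists r => // x [Ux|Vx]; [rewrite rU// e | rewrite rV// e'].
Qed.

Lemma exact_on_local (s : forall x, B x) x : acont x s -> (exists a, s x = d a) ->
  exists U, [/\ open U, U x & exact_on s U].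
Proof.
move=> hs [a ea].
have [t ht ta] := acont_germ a.
have e : \forall y \near x, s y = d (t y).
  by apply: acont_eq; rewrite ?ta//; exact: (proj2 hd).
have [U [oU Ux UP]] := nbhs_open (filterI e (acont_near ht)).
by exists U; split=> //; exists t => y /UP[].
Qed.

End Exactness.

Section Resolution.
Variables (X : topologicalType) (F : absheaf X).
Variables (I : nat -> absheaf X) (eps : forall x, F x -> I 0%N x).
Variable d : forall n x, I n x -> I n.+1 x.
Hypothesis res : injective_resolution eps d.

Let hI n : injective_sheaf (I n). Proof. by case: res. Qed.
Let heps : ab_hom eps. Proof. by case: res => _ []. Qed.
Let hd n : ab_hom (@d n). Proof. by case: res => _ []. Qed.
Let eps_inj x : injective (@eps x). Proof. by case: res. Qed.
Let ex0 x (a : I 0%N x) : d a = 0 <-> exists b, a = eps b.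
Proof. by case: res. Qed.
Let ex n x (a : I n.+1 x) : d a = 0 <-> exists b, a = d b.
Proof. by case: res. Qed.

(** Vanishing of H^1 over [U], tested on sections over [U] of the resolution fixed on the whole
    space. *)
Definition H1_zero_on (U : set X) := forall s : forall x, I 1%N x, csec U s ->
  (forall x, U x -> d (s x) = 0) -> exact_on (@d 0%N) s U.

Lemma csec_closed0 U (s : forall x, I 0%N x) : open U -> csec U s ->
  (forall x, U x -> d (s x) = 0) ->
  exists2 f : forall x, F x, csec U f & forall x, U x -> s x = eps (f x).
Proof.
move=> oU hs ds.
have /dep_choice[f hf] : forall x, exists b, U x -> s x = eps b.
  move=> x; have [Ux|nU] := pselect (U x); last by exists 0.
  by have [b eb] := (ex0 _).1 (ds x Ux); exists b.
exists f => // x Ux.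
have [f' hf' e] := acont_germ (f x).
apply: (acont_cong _ hf').
have : \forall y \near x, s y = eps (f' y).
  apply: acont_eq; [exact: hs | exact: ((proj2 heps) _ _ hf')|].
  by rewrite e; exact: hf.
by apply: filterS2 (openP oU Ux) => y Uy; rewrite hf// => /eps_inj.
Qed.

Lemma exact_on_near n (s : forall x, I n.+1 x) x : acont x s -> d (s x) = 0 ->
  exists U, [/\ open U, U x & exact_on (@d n) s U].
Proof. move=> hs /ex h; have := exact_on_local (@hd n) hs h; exact. Qed.

(** Two primitives differ on the overlap by a section of [F]; the two parts of its splitting correct
    one primitive each. *)
Lemma mayer_vietoris1 (s : forall x, I 1%N x) U V : open U -> open V ->
  exact_on (@d 0%N) s U -> exact_on (@d 0%N) s V ->
  (forall f : forall x, F x, csec (U `&` V) f ->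
    exists g h : forall x, F x, [/\ csec U g, csec V h &
      forall x, U x -> V x -> f x = g x + h x]) ->
  exact_on (@d 0%N) s (U `|` V).
Proof.
move=> oU oV [t ht e] [t' ht' e'] H.
have oUV := openI oU oV.
have [|x [Ux Vx]|f hf fE] := @csec_closed0 _ (fun x => t x - t' x) oUV.
- by move=> x [Ux Vx]; apply: acontB; [exact: ht | exact: ht'].
- by rewrite (ab_homB (hd 0%N)) -e// -e'// subrr.
have [g [h [hg hh E]]] := H f hf.
have de x (b : F x) : d (eps b) = 0 by apply/ex0; exists b.
apply: (@exact_on_glue _ _ _ (@d 0%N) s U V (fun x => t x - eps (g x))
  (fun x => t' x + eps (h x))) => //.
- by move=> x Ux; apply: acontB; [exact: ht | apply: (proj2 heps); exact: hg].
- by move=> x Ux; rewrite (ab_homB (hd 0%N)) de subr0 e.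
- by move=> x Vx; apply: acontD; [exact: ht' | apply: (proj2 heps); exact: hh].
- by move=> x Vx; rewrite (proj1 (hd 0%N)) de addr0 e'.
move=> x Ux Vx; have := fE x (conj Ux Vx); rewrite E// (proj1 heps) => /eqP.
rewrite subr_eq => /eqP ->.
by rewrite [eps (g x) + _]addrC addrAC addrK addrC.
Qed.

(** The primitive [r] of the difference lives only on the overlap, but sections of [I 0] extend to
    the whole space: the differential of the extension corrects [t'] without changing [d t']. *)
Lemma exact_on_glue2 (s : forall x, I 2%N x) U V t t' : open U -> open V ->
  csec U t -> (forall x, U x -> s x = d (t x)) ->
  csec V t' -> (forall x, V x -> s x = d (t' x)) ->
  exact_on (@d 0%N) (fun x => t x - t' x) (U `&` V) -> exact_on (@d 1%N) s (U `|` V).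
Proof.
move=> oU oV ht e ht' e' [r hr rE].
have [r' [hr' rr']] := injective_flasque (openI oU oV) (hI (n:=0)) hr.
have dd x (b : I 0%N x) : d (d b) = 0 by apply/ex; exists b.
apply: (@exact_on_glue _ _ _ (@d 1%N) s U V t (fun x => t' x + d (r' x))) => //.
- by move=> x Vx; apply: acontD; [exact: ht' | exact: (proj2 (hd 0%N))].
- by move=> x Vx; rewrite (proj1 (hd 1%N)) dd addr0 e'.
move=> x Ux Vx.
by have /eqP := rE x (conj Ux Vx); rewrite subr_eq rr'// => /eqP ->; rewrite addrC.
Qed.

Lemma mayer_vietoris2 (s : forall x, I 2%N x) U V : open U -> open V ->
  exact_on (@d 1%N) s U -> exact_on (@d 1%N) s V -> H1_zero_on (U `&` V) ->
  exact_on (@d 1%N) s (U `|` V).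
Proof.
move=> oU oV [t ht e] [t' ht' e'] H.
apply: (exact_on_glue2 oU oV ht e ht' e'); apply: H => [x [Ux Vx]|x [Ux Vx]].
- by apply: acontB; [exact: ht | exact: ht'].
- by rewrite (ab_homB (hd 1%N)) -e// -e'// subrr.
Qed.

End Resolution.
End EtaleSheaves.

(** * Ideals, units and germs *)

Section CommutativeAlgebra.
Local Open Scope classical_set_scope.
Local Open Scope ring_scope.

Lemma eq_addrr (M : zmodType) (v : M) : v = v + v -> v = 0.
Proof. by move=> /eqP; rewrite -subr_eq0 opprD addrA subrr sub0r oppr_eq0 => /eqP. Qed.

Definition is_ideal (R : comNzRingType) (J : set R) : Prop :=
  [/\ J 0, forall a b, J a -> J b -> J (a + b) & forall a b, J b -> J (a * b)].

(** An ideal that contains [J] and is maximal among those without powers of [f] is prime. *)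
Lemma ideal_power (R : comNzRingType) (J : set R) (f : R) : is_ideal J ->
  (forall I, prime_ideal I -> J `<=` I -> I f) -> exists n, J (f ^+ n).
Proof.
move=> [J0 JD JM] H; apply: contrapT => nJ.
(* The candidates are the unions of [J] with a set [A]. In this form the union of the empty chain is
   admissible: it gives [J] itself. *)
pose P (A : set R) := is_ideal (J `|` A) /\ forall n, ~ (J `|` A) (f ^+ n).
have [|A [[[A0 AD AM] nA] maxA]] := @Zorn_bigcup R P.
  move=> F FP tF; split; last first.
    move=> n [Jn|[A /FP[_ h] An]]; first by apply: nJ; exists n.
    by apply: (h n); right.
  have FA a : (J `|` \bigcup_(A in F) A) a -> J a \/ exists2 A, F A & (J `|` A) a.
    by move=> [|[A FA Aa]]; [left | right; exists A => //; right].
  have AF A a : F A -> (J `|` A) a -> (J `|` \bigcup_(A in F) A) a.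
    by move=> FA' [|Aa]; [left | right; exists A].
  split; first by left.
    move=> a b /FA[Ja|[A FA1 Aa]] /FA[Jb|[B FB Bb]].
    - by left; exact: JD.
    - apply: (AF B) => //; have [[_ BD _] _] := FP _ FB.
      by apply: BD => //; left.
    - apply: (AF A) => //; have [[_ BD _] _] := FP _ FA1.
      by apply: BD => //; left.
    - have [AB|BA] := tF _ _ FA1 FB.
        apply: (AF B) => //; have [[_ BD _] _] := FP _ FB.
        by apply: BD => //; case: Aa => [|/AB]; [left|right].
      apply: (AF A) => //; have [[_ BD _] _] := FP _ FA1.
      by apply: BD => //; case: Bb => [|/BA]; [left|right].
  move=> a b /FA[Jb|[A FA1 Aa]]; first by left; exact: JM.
  by apply: (AF A) => //; have [[_ _ BM] _] := FP _ FA1; exact: BM.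
set M := J `|` A in A0 AD AM nA.
(* By maximality, adjoining [a] to [M] brings in a power of [f]. *)
have key a : ~ M a -> exists n m r, M m /\ f ^+ n = m + r * a.
  move=> nMa; pose B : set R := fun x => exists m r, M m /\ x = m + r * a.
  have MB : M `<=` B by move=> m Mm; exists m, 0; split=> //; ring.
  have Ba : B a by exists 0, 1; split=> //; ring.
  have AB : A `<` B.
    split; first by move=> x Ax; apply: MB; right.
    by move=> BA; apply: nMa; right; exact: BA.
  have JB : J `|` B = B.
    by apply/seteqP; split=> x; [case=> // Jx; apply: MB; left | right].
  apply: contrapT => nB; apply: (maxA B AB); split; rewrite JB.
    split; first exact: MB.
      move=> _ _ [m [r [Mm ->]]] [m' [r' [Mm' ->]]].
      by exists (m + m'), (r + r'); split; [exact: AD | ring].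
    move=> x _ [m [r [Mm ->]]].
    by exists (x * m), (x * r); split; [exact: AM | ring].
  by move=> n [m [r [Mm e]]]; apply: nB; exists n, m, r.
have PM : prime_ideal M.
  split=> //; first by have := nA 0%N; rewrite expr0.
  move=> a b Mab; apply: contrapT => /not_orP[/key[n [m [r [Mm e]]]]].
  move=> /key[n' [m' [r' [Mm' e']]]]; apply: (nA (n + n')%N).
  rewrite exprD e e'.
  have -> : (m + r * a) * (m' + r' * b)
    = (m' + r' * b) * m + (r * a * m' + r * r' * (a * b)) by ring.
  by apply: (AD); [exact: AM | apply: (AD); exact: AM].
have := H M PM; rewrite /M => h; apply: (nA 1%N).
by rewrite expr1; apply: h => x; left.
Qed.

(** Makes the ideals of the quasi-compactness arguments, where membership asks that some power
    works, closed under sums. *)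
Lemma exprD_ideal (R : comNzRingType) (a b : R) m n :
  exists c c', (a + b) ^+ (m + n) = c * a ^+ m + c' * b ^+ n.
Proof.
elim: m n => [n|m IHm].
  by exists ((a + b) ^+ n), 0; rewrite expr0 add0n; ring.
elim=> [|n IHn].
  by exists 0, ((a + b) ^+ m.+1); rewrite expr0 addn0; ring.
have [c [c' e]] := IHm n.+1; have [c1 [c1' e1]] := IHn.
exists (c + b * c1), (a * c' + c1').
rewrite addSn exprS mulrDl {1}e addnS -addSn e1 !exprS; ring.
Qed.

Section Units.
Variable R : comNzRingType.
Implicit Types a b : R.

Lemma isunit1 : isunit (1 : R).
Proof. by exists 1; rewrite mulr1. Qed.

Lemma isunit0 : ~ isunit (0 : R).
Proof. by move=> [b]; rewrite mulr0 => /eqP; rewrite eq_sym oner_eq0. Qed.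

Lemma isunitM a b : isunit (a * b) <-> isunit a /\ isunit b.
Proof.
split=> [[c e]|[[c e] [c' e']]].
  by split; [exists (c * b) | exists (c * a)]; rewrite -e; ring.
by exists (c * c'); rewrite mulrACA e e' mulr1.
Qed.

Lemma isunitX a n : isunit a -> isunit (a ^+ n).
Proof.
move=> ha; elim: n => [|n IH]; first by rewrite expr0; exact: isunit1.
by rewrite exprS; apply/isunitM.
Qed.

Lemma isunit_expn a n : (0 < n)%N -> isunit (a ^+ n) -> isunit a.
Proof. by case: n => // n _; rewrite exprS => /isunitM[]. Qed.

Lemma isunit_regl a b : isunit a -> a * b = 0 -> b = 0.
Proof. by case=> c e ab; rewrite -[b]mul1r -e -mulrA ab mulr0. Qed.

(** Total, with default value 0, so that it can be applied pointwise to a family of germs. *)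
Definition uinv a : R := xget 0 [set b | b * a = 1].

Lemma uinvP a : isunit a -> uinv a * a = 1.
Proof. by case=> b e; exact: (@xgetPex _ 0 [set b | b * a = 1] (ex_intro _ b e)). Qed.

Lemma uinvE a b : b * a = 1 -> uinv a = b.
Proof.
move=> e; have := uinvP (ex_intro _ b e : isunit a) => e'.
by rewrite -[LHS]mulr1 -e mulrCA e' mulr1.
Qed.

End Units.

Lemma isunit_rmorph (R S : comNzRingType) (f : {rmorphism R -> S}) a :
  isunit a -> isunit (f a).
Proof. by case=> b e; exists (f b); rewrite -rmorphM e rmorph1. Qed.

Lemma isunitD (X : lrs) (x : X) (a b : st x) :
  isunit (a + b) -> isunit a \/ isunit b.
Proof. by move=> h; apply: contrapT => /not_orP[/(@st_local X x a b) H /H]. Qed.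

Section ModSheaf.
Variables (X : lrs) (M : modsheaf X).
Implicit Types s t : forall x, M x.

Lemma mcont_near x s : mcont x s -> \forall y \near x, mcont y s.
Proof. exact: (@acont_near X (ab_of M)). Qed.

Lemma mcont_cong x s t : (\forall y \near x, s y = t y) -> mcont x s -> mcont x t.
Proof. exact: (@acont_cong X (ab_of M)). Qed.

Lemma mcont_germ x (a : M x) : exists2 s, mcont x s & s x = a.
Proof. exact: (@acont_germ X (ab_of M)). Qed.

Lemma mcont_eq x s t : mcont x s -> mcont x t -> s x = t x ->
  \forall y \near x, s y = t y.
Proof. exact: (@acont_eq X (ab_of M)). Qed.

Lemma mcontD x s t : mcont x s -> mcont x t -> mcont x (fun y => s y + t y).
Proof. exact: (@acontD X (ab_of M)). Qed.

Lemma mcont0 x : mcont x (fun y => 0 : M y).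
Proof. exact: (@acont0 X (ab_of M)). Qed.

Definition msec (U : set X) s := forall x, U x -> mcont x s.

End ModSheaf.

Section Reg.
Variable X : lrs.
Implicit Types a b : forall x : X, st x.

Lemma reg_cong x a b : (\forall y \near x, a y = b y) -> @reg X x a -> @reg X x b.
Proof. exact: (@mcont_cong X (OO X)). Qed.

Lemma reg_germ x (c : st x) : exists2 a, @reg X x a & a x = c.
Proof. exact: (@mcont_germ X (OO X)). Qed.

Lemma reg_eq x a b : @reg X x a -> @reg X x b -> a x = b x -> \forall y \near x, a y = b y.
Proof. exact: (@mcont_eq X (OO X)). Qed.

Lemma reg0 x : @reg X x (fun y => 0 : st y).
Proof. exact: (@mcont0 X (OO X)). Qed.

Lemma regX x a n : @reg X x a -> @reg X x (fun y => a y ^+ n).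
Proof.
move=> ha; elim: n => [|n IH].
  by apply: reg_cong (reg1 x); apply: nearW => y; rewrite expr0.
by apply: reg_cong (regM ha IH); apply: nearW => y; rewrite exprS.
Qed.

Lemma reg_uinv x a : @reg X x a -> isunit (a x) ->
  @reg X x (fun y => uinv (a y)) /\ \forall y \near x, isunit (a y).
Proof.
move=> ha [c e]; have [b hb bx] := reg_germ c.
have e' : \forall y \near x, b y * a y = 1.
  by apply: reg_eq; [exact: regM | exact: reg1 | rewrite bx e].
split; last by apply: filterS e' => y ey; exists (b y).
by apply: reg_cong hb; apply: filterS e' => y /uinvE ->.
Qed.

Lemma isgen_coef (M : modsheaf X) x (s m : forall x, M x) : mcont x s -> mcont x m ->
  (\forall y \near x, isgen (m y)) ->
  exists2 a, @reg X x a & \forall y \near x, s y = a y *: m y.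
Proof.
move=> hs hm hg; have [c [ec _]] := nbhs_singleton hg (s x).
have [a ha ax] := reg_germ c; exists a => //.
by apply: mcont_eq; [| exact: mcontZ | rewrite ax].
Qed.

End Reg.

Lemma isgen_eq0 (R : comNzRingType) (M : lmodType R) (m : M) a :
  isgen m -> a *: m = 0 -> a = 0.
Proof.
move=> /(_ 0)[b [_ ub]] e; rewrite -(ub a)//.
by apply: ub; rewrite scale0r.
Qed.

Lemma isgen_inj (R : comNzRingType) (M : lmodType R) (m : M) a b :
  isgen m -> a *: m = b *: m -> a = b.
Proof.
move=> hm /eqP; rewrite -subr_eq0 -scalerBl => /eqP /(isgen_eq0 hm) /eqP.
by rewrite subr_eq0 => /eqP.
Qed.

Lemma isgenP (R : comNzRingType) (M : lmodType R) (m : M) :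
  (forall v, exists a, v = a *: m) -> (forall a, a *: m = 0 -> a = 0) -> isgen m.
Proof.
move=> h1 h2 v; have [a e] := h1 v; exists a; split=> // b e'.
apply/eqP; rewrite -subr_eq0; apply/eqP/h2.
by rewrite scalerBl -e -e' subrr.
Qed.

Lemma isgen_unit (R : comNzRingType) (M : lmodType R) (m : M) a :
  isgen m -> isunit a -> isgen (a *: m).
Proof.
move=> hm [c e]; apply: isgenP => [v|b].
  have [r [-> _]] := hm v; exists (r * c).
  by rewrite scalerA -mulrA e mulr1.
rewrite scalerA => /(isgen_eq0 hm) h.
by rewrite -[b]mulr1 -e mulrCA h mulr0.
Qed.

Lemma isgen_scale (R : comNzRingType) (M : lmodType R) (m : M) a :
  isgen m -> isgen (a *: m) -> isunit a.
Proof.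
move=> hm /(_ m)[c [e _]]; exists c; apply: (isgen_inj hm).
by rewrite -scalerA -e scale1r.
Qed.

Lemma invertible_OO (X : lrs) : invertible (OO X).
Proof.
move=> x; exists (fun y => 1 : st y); first exact: reg1.
apply: nearW => y; apply: isgenP => [v|a]; last by rewrite [_ *: _]mulr1.
by exists v; rewrite [_ *: _]mulr1.
Qed.

End CommutativeAlgebra.

(** * Cohomology of affine opens *)

Section AffineOpens.
Local Open Scope classical_set_scope.
Local Open Scope ring_scope.

Section Spec.
Variables (X : lrs) (V : set X) (R : comNzRingType) (th : R -> forall x : X, st x).
Hypothesis hV : isSpec V th.
Implicit Types r f g h : R.

Lemma spec_open : open V. Proof. by case: hV => -[]. Qed.

Lemma spec_reg r x : V x -> reg x (th r).
Proof. by case: hV => -[_ H] _ _ _ _; exact: H. Qed.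

Lemma spec1 x : V x -> th 1 x = 1.
Proof. by case: hV => _ H _ _ _ /H[]. Qed.

Lemma specB r s x : V x -> th (r - s) x = th r x - th s x.
Proof. by case: hV => _ H _ _ _ /H[]. Qed.

Lemma specM r s x : V x -> th (r * s) x = th r x * th s x.
Proof. by case: hV => _ H _ _ _ /H[]. Qed.

Lemma spec0 x : V x -> th 0 x = 0.
Proof. by move=> Vx; rewrite -[0 in LHS](subrr 0) specB// subrr. Qed.

Lemma specN r x : V x -> th (- r) x = - th r x.
Proof. by move=> Vx; rewrite -sub0r specB// spec0// sub0r. Qed.

Lemma specD r s x : V x -> th (r + s) x = th r x + th s x.
Proof. by move=> Vx; rewrite -[s in LHS]opprK specB// specN// opprK. Qed.

Lemma specX r n x : V x -> th (r ^+ n) x = th r x ^+ n.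
Proof.
by move=> Vx; elim: n => [|n IH]; rewrite ?expr0 ?spec1// !exprS specM// IH.
Qed.

Definition spec_prime x : set R := [set r | ~ isunit (th r x)].

Lemma spec_prime_prime x : V x -> prime_ideal (spec_prime x).
Proof.
move=> Vx; rewrite /spec_prime; split=> /=.
- by rewrite spec0//; exact: isunit0.
- by move=> a b na nb; rewrite specD// => /isunitD[].
- by move=> a b nb; rewrite specM// => /isunitM[].
- by apply; rewrite spec1//; exact: isunit1.
- by move=> a b; rewrite specM// => /isunitM/not_andP.
Qed.

Lemma spec_point I : prime_ideal I ->
  exists2 x, V x & forall r, I r <-> ~ isunit (th r x).
Proof. by case: hV => _ _ H _ _ /H[x [[Vx e] _]]; exists x. Qed.

Lemma spec_point_uniq x y : V x -> V y ->
  (forall r, isunit (th r x) <-> isunit (th r y)) -> x = y.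
Proof.
move=> Vx Vy e; case: hV => _ _ H _ _.
have [z [_ uz]] := H _ (spec_prime_prime Vx).
transitivity z; [symmetry; apply: uz; split=> // | apply: uz; split=> // r].
by rewrite /spec_prime/= e.
Qed.

Lemma spec_basis x (W : set X) : V x -> nbhs x W -> exists2 r, isunit (th r x) &
  forall y, V y -> isunit (th r y) -> W y.
Proof. by case: hV => _ _ _ H _; exact: H. Qed.

Lemma spec_frac x (a : st x) : V x -> exists r s, isunit (th s x) /\ a * th s x = th r x.
Proof. by case: hV => _ _ _ _ H /H[h _]; exact: h. Qed.

Lemma spec_tors x r : V x -> th r x = 0 -> exists2 s, isunit (th s x) & s * r = 0.
Proof. by case: hV => _ _ _ _ H /H[_ h]; exact: h. Qed.

Definition Dset f : set X := [set x | V x /\ isunit (th f x)].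

Lemma open_Dset f : open (Dset f).
Proof.
rewrite openE => x [Vx fx].
have [_ h] := reg_uinv (spec_reg f Vx) fx.
by apply: filterS2 (openP spec_open Vx) h => y Vy uy.
Qed.

Lemma Dset1 : Dset 1 = V.
Proof.
apply/seteqP; split=> x; first by case.
by move=> Vx; split=> //; rewrite spec1//; exact: isunit1.
Qed.

Lemma DsetM f g : Dset (f * g) = Dset f `&` Dset g.
Proof.
apply/seteqP; split=> x; rewrite /Dset/=.
  by case=> Vx; rewrite specM// => /isunitM[].
by case=> -[Vx uf] [_ ug]; split=> //; rewrite specM//; apply/isunitM.
Qed.

Lemma DsetD f g : Dset (f + g) `<=` Dset f `|` Dset g.
Proof.
by move=> x [Vx]; rewrite specD// => /isunitD[]; [left|right].
Qed.

(* Quasi-compactness of D(f), phrased through the ideal J. *)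
Lemma spec_cover (J : set R) f : is_ideal J ->
  (forall x, Dset f x -> exists2 r, J r & isunit (th r x)) -> exists n, J (f ^+ n).
Proof.
move=> hJ H; apply: ideal_power => // I hI JI.
have [x Vx e] := spec_point hI; apply/e => uf.
by have [r /JI /e nr /nr] := H x (conj Vx uf).
Qed.

(** At each point of D(f) the annihilator of [r] contains a function invertible there;
    quasi-compactness puts a power of [f] into it. *)
Lemma spec_vanish r f : (forall x, Dset f x -> th r x = 0) -> exists n, f ^+ n * r = 0.
Proof.
move=> H; apply: (@spec_cover (fun s => s * r = 0)).
  split; first by rewrite mul0r.
    by move=> a b ea eb; rewrite mulrDl ea eb addr0.
  by move=> a b eb; rewrite -mulrA eb mulr0.
by move=> x fx; have [s us e] := spec_tors (proj1 fx) (H x fx); exists s.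
Qed.

Lemma spec_inj r s : (forall x, V x -> th r x = th s x) -> r = s.
Proof.
move=> e; have [|n] := @spec_vanish (r - s) 1.
  by move=> x [Vx _]; rewrite specB// e// subrr.
by rewrite expr1n mul1r => /eqP; rewrite subr_eq0 => /eqP.
Qed.

Section Module.
Variable M : modsheaf X.
Hypothesis invM : invertible M.

(** Locally [b] is a fraction times a generator, and [spec_vanish] supplies an exponent;
    quasi-compactness makes the exponent uniform. *)
Lemma vanish_power (b : forall x, M x) h g : msec (Dset g) b ->
  (forall x, Dset g x -> isunit (th h x) -> b x = 0) ->
  exists N, forall x, Dset g x -> th h x ^+ N *: b x = 0.
Proof.
move=> hb b0.
pose J : set R := fun r => exists N, forall x, Dset g x -> isunit (th r x) ->
  th h x ^+ N *: b x = 0.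
have mono x N N' : th h x ^+ N *: b x = 0 -> th h x ^+ (N + N') *: b x = 0.
  by move=> e; rewrite addnC exprD -scalerA e scaler0.
have [| |n [N HN]] := @spec_cover J g.
- split.
  + by exists 0%N => x [Vx _]; rewrite spec0// => /isunit0.
  + move=> r s [N HN] [N' HN']; exists (N + N')%N => x gx.
    rewrite specD; last by case: gx.
    move=> /isunitD[ur|us]; first exact/mono/HN.
    by rewrite addnC; exact/mono/HN'.
  + move=> r s [N HN]; exists N => x gx.
    by rewrite specM; [case/isunitM => _; exact: HN | case: gx].
- move=> x gx; have [Vx ug] := gx.
  have [m hm gm] := invM x.
  have [a ha ea] := isgen_coef (hb x gx) hm gm.
  have [r [s [us es]]] := spec_frac (a x) Vx.
  have es' : \forall y \near x, a y * th s y = th r y.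
    by apply: reg_eq => //; [apply: regM => //|]; exact: spec_reg.
  have gs : nbhs x (Dset (g * s)).
    by apply: openP; [exact: open_Dset | rewrite DsetM].
  have [s1 us1 H1] := spec_basis Vx (filterI (filterI gm ea) (filterI es' gs)).
  have H2 y : V y -> isunit (th s1 y) -> [/\ isgen (m y), b y = a y *: m y,
      a y * th s y = th r y, Dset g y & isunit (th s y)].
    move=> Vy /(H1 y Vy)[[? ?] [?]]; rewrite DsetM => -[? [_ ?]]; split=> //.
  have [|n e] := @spec_vanish r (h * s1).
    move=> y [Vy]; rewrite specM// => /isunitM[uh /(H2 y Vy)[gy e1 e2 gy' _]].
    by rewrite -e2 (@isgen_eq0 _ _ (m y) (a y))// ?mul0r// -e1 b0.
  exists s1 => //; exists n => y gy us1y; have Vy := proj1 gy.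
  have [_ e1 e2 _ us'] := H2 y Vy us1y.
  rewrite e1 scalerA; suff -> : th h y ^+ n * a y = 0 by rewrite scale0r.
  apply: (isunit_regl us'); apply: (isunit_regl (isunitX n us1y)).
  rewrite mulrA [th s1 y ^+ n * _ * _]mulrC -mulrA.
  have -> : th h y ^+ n * (a y * (th s1 y ^+ n * th s y))
     = (th h y * th s1 y) ^+ n * (a y * th s y) by rewrite exprMn; ring.
  by rewrite e2 -specM// -specX// -specM// e spec0.
exists N => x gx; apply: HN => //.
by rewrite specX; [apply: isunitX; case: gx | case: gx].
Qed.
End Module.

(** [J] collects the denominators some power of which turns [a] into a global function; local
    fractions put enough elements into it. *)
Lemma spec_section (a : forall x : X, st x) f : (forall x, Dset f x -> reg x a) ->
  exists N r, forall x, Dset f x -> th f x ^+ N * a x = th r x.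
Proof.
move=> ha.
pose J : set R := fun g => exists N r, forall x, Dset f x ->
  th g x ^+ N * a x = th r x.
have [| |n [N [r H]]] := @spec_cover J f.
- split.
  + by exists 1%N, 0 => x [Vx _]; rewrite spec0// expr1 mul0r.
  + move=> g g' [N [r H]] [N' [r' H']]; exists (N + N')%N.
    have [c [c' e]] := exprD_ideal g g' N N'.
    exists (c * r + c' * r') => x fx; have Vx := proj1 fx.
    rewrite -specX// e !specD// !specM// -(H x fx) -(H' x fx) !specX//; ring.
  + move=> c g [N [r H]]; exists N, (c ^+ N * r) => x fx; have Vx := proj1 fx.
    by rewrite !specM// specX// exprMn -(H x fx); ring.
- move=> x fx; have [Vx uf] := fx.
  have [r [s [us es]]] := spec_frac (a x) Vx.
  have es' : \forall y \near x, a y * th s y = th r y.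
    by apply: reg_eq => //; [apply: regM; [exact: ha|]|]; exact: spec_reg.
  have fs : nbhs x (Dset (f * s)).
    by apply: openP; [exact: open_Dset | rewrite DsetM].
  have [s1 us1 H1] := spec_basis Vx (filterI es' fs).
  (* The identity a s = r is known only where [s1] is invertible; multiplied by a power of [s1] it
     holds on all of D(f). *)
  have [||M HM] := @vanish_power (OO X) (@invertible_OO X)
    (fun y => th (s * s1) y * a y - th (r * s1) y : st y) s1 f.
  + move=> y fy; have Vy := proj1 fy.
    by apply: regB; [apply: regM; [|exact: ha]|]; exact: spec_reg.
  + move=> y fy us1y; have Vy := proj1 fy; rewrite !specM//.
    have [e _] := H1 y Vy us1y; rewrite -e; ring.
  exists (s1 * s); last by rewrite specM//; exact/isunitM.
  exists M.+1, ((s1 * s) ^+ M * (s1 * r)) => y fy; have Vy := proj1 fy.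
  have e : th s1 y ^+ M * (th (s * s1) y * a y) = th s1 y ^+ M * th (r * s1) y.
    by apply/eqP; rewrite -subr_eq0 -mulrBr; apply/eqP; exact: HM.
  rewrite !specM// in e; rewrite !specM// specX// !specM//.
  have -> : (th s1 y * th s y) ^+ M.+1 * a y
     = th s y ^+ M * (th s1 y ^+ M * (th s y * th s1 y * a y)).
    by rewrite exprS exprMn; ring.
  by rewrite e exprMn; ring.
exists (n * N)%N, r => x fx; have Vx := proj1 fx.
by rewrite -(H x fx) specX// exprM.
Qed.

Section Extension.
Variable M : modsheaf X.
Hypothesis invM : invertible M.

(** In a local trivialisation the coefficient is a fraction, whose pole along [h] a power of [h]
    clears. Extensions over D(r g) and D(s g) agree after multiplication by a further power, by
    [vanish_power]. *)
Lemma extend_section (a : forall x, M x) h g : msec (Dset (h * g)) a ->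
  exists N (b : forall x, M x), msec (Dset g) b /\
    forall x, Dset (h * g) x -> b x = th h x ^+ N *: a x.
Proof.
move=> ha.
pose J : set R := fun r => exists N (b : forall x, M x), msec (Dset (r * g)) b /\
    forall x, Dset (r * g) x -> isunit (th h x) -> b x = th h x ^+ N *: a x.
have [| |n [N [b [hb e]]]] := @spec_cover J g.
- split.
  + exists 0%N, (fun=> 0); split=> x; rewrite mul0r => -[Vx]; rewrite spec0//;
    by move=> /isunit0.
  + move=> r s [N [b [hb eb]]] [N' [b' [hb' eb']]].
    pose c x : M x := th h x ^+ N' *: b x; pose c' x : M x := th h x ^+ N *: b' x.
    have hc : msec (Dset (r * g)) c.
      move=> x rx; apply: mcontZ; last exact: hb.
      by apply: regX; apply: spec_reg; case: rx.
    have hc' : msec (Dset (s * g)) c'.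
      move=> x rx; apply: mcontZ; last exact: hb'.
      by apply: regX; apply: spec_reg; case: rx.
    have [||K HK] := @vanish_power M invM (fun x => c x - c' x) h (r * g * s).
    * move=> x; rewrite DsetM => -[rx sx]; apply: mcontB; first exact: hc.
      by apply: hc'; rewrite DsetM; split=> //; move: rx; rewrite DsetM => -[].
    * move=> x; rewrite DsetM => -[rgx sx] uh.
      have sgx : Dset (s * g) x by rewrite DsetM; split=> //; move: rgx; rewrite DsetM => -[].
      by rewrite /c/c' eb// eb'// !scalerA -!exprD addnC subrr.
    have [||x rgx sgx|t [ht t1 t2]] := @csec_glue X (ab_of M) (Dset (r * g)) (Dset (s * g))
       (fun x => th h x ^+ K *: c x) (fun x => th h x ^+ K *: c' x)
       (open_Dset _) (open_Dset _).
    * move=> x rx; apply: mcontZ; last exact: hc.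
      by apply: regX; apply: spec_reg; case: rx.
    * move=> x rx; apply: mcontZ; last exact: hc'.
      by apply: regX; apply: spec_reg; case: rx.
    * apply/eqP; rewrite -subr_eq0 -scalerBr; apply/eqP/HK.
      by rewrite DsetM; split=> //; move: sgx; rewrite DsetM => -[].
    exists (K + (N + N'))%N, t; rewrite mulrDl; split.
      by move=> x /DsetD; exact: ht.
    move=> x /DsetD[rx|sx] uh.
      by rewrite t1// /c eb// !scalerA -!exprD addnA addnAC.
    by rewrite t2// /c' eb'// !scalerA -!exprD addnA.
  + move=> r s [N [b [hb e]]]; exists N, b; rewrite -mulrA; split.
      by move=> x; rewrite DsetM => -[_]; exact: hb.
    by move=> x; rewrite DsetM => -[_]; exact: e.
- move=> x gx; have [Vx ug] := gx.
  have [m hm gm] := invM x.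
  have gg : nbhs x (Dset g) by apply: openP => //; exact: open_Dset.
  have [s us H] := spec_basis Vx (filterI (filterI gm gg) (mcont_near hm)).
  have sg y : Dset s y -> Dset g y by move=> [Vy /(H y Vy)[[_]]].
  have ms y : Dset s y -> mcont y m by move=> [Vy /(H y Vy)[_]].
  have gs y : Dset s y -> isgen (m y) by move=> [Vy /(H y Vy)[[]]].
  have /dep_choice[al alE] : forall y, exists c : st y, Dset s y -> a y = c *: m y.
    move=> y; have [sy|ns] := pselect (Dset s y); last by exists 0.
    by have [c [e _]] := gs y sy (a y); exists c.
  have nDs y : Dset s y -> nbhs y (Dset s) by apply: openP; exact: open_Dset.
  have hal y : Dset (h * s) y -> reg y al.
    move=> hsy; have [hy sy] : Dset h y /\ Dset s y by move: hsy; rewrite DsetM.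
    have hay : mcont y a by apply: ha; rewrite DsetM; split=> //; exact: sg.
    have gny : \forall z \near y, isgen (m z) by apply: filterS (nDs y sy) => z /gs.
    have [c hc ec] := isgen_coef hay (ms y sy) gny.
    apply: reg_cong hc; apply: filterS2 ec (nDs y sy) => z e sz.
    by apply: (isgen_inj (gs z sz)); rewrite -e alE.
  have [N [r er]] := spec_section hal.
  exists s => //.
  (* The denominator is a power of h s, and [s] is invertible here, so only h^N has to be
     supplied. *)
  exists N, (fun y => (uinv (th s y) ^+ N * th r y) *: m y); split.
    move=> y; rewrite DsetM => -[sy _]; have Vy := proj1 sy; apply: mcontZ; last exact: ms.
    apply: regM; last exact: spec_reg.
    by apply: regX; apply: (proj1 (reg_uinv _ _)); [exact: spec_reg | case: sy].
  move=> y; rewrite DsetM => -[sy gy] uh; have Vy := proj1 sy.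
  rewrite -er; last by rewrite DsetM.
  rewrite alE// scalerA; congr (_ *: _); rewrite specM// exprMn mulrA.
  congr (_ * _); rewrite mulrCA -exprMn uinvP ?expr1n ?mulr1//; by case: sy.
exists N, b; split.
  move=> x gx; apply: hb; rewrite DsetM; split=> //; split; first by case: gx.
  by rewrite specX; [apply: isunitX; case: gx | case: gx].
move=> x; rewrite DsetM => -[hx gx]; apply: e; last by case: hx.
rewrite DsetM; split=> //; split; first by case: gx.
by rewrite specX; [apply: isunitX; case: gx | case: gx].
Qed.

(* After localising at f + g the functions f and g generate the unit ideal, so that a
   fraction with denominator (f g)^N splits into fractions with denominators f^N, g^N. *)
Lemma split_section (a : forall x, M x) f g k :
  msec (Dset (f * g * (k * (f + g)))) a ->
  exists b c : forall x, M x, [/\ msec (Dset (f * (k * (f + g)))) b,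
    msec (Dset (g * (k * (f + g)))) c &
    forall x, Dset (f * g * (k * (f + g))) x -> a x = b x + c x].
Proof.
move=> /extend_section[N [b [hb e]]].
have [c [c' ec]] := exprD_ideal f g N N.
have Dsp r s x : Dset (r * s) x -> [/\ V x, isunit (th r x), isunit (th s x) & Dset s x].
  by rewrite DsetM => -[[? ?] [? ?]].
have hu r n x : V x -> isunit (th r x) -> reg x (fun y => uinv (th r y) ^+ n).
  by move=> Vx ux; apply: regX; apply: (proj1 (reg_uinv _ ux)); exact: spec_reg.
exists (fun x => (th c' x * uinv (th f x) ^+ N * uinv (th (f + g) x) ^+ (N + N)) *: b x).
exists (fun x => (th c x * uinv (th g x) ^+ N * uinv (th (f + g) x) ^+ (N + N)) *: b x).
split.
- move=> x /Dsp[Vx uf uk kx]; apply: mcontZ; last exact: hb.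
  apply: regM; first by apply: regM; [exact: spec_reg | exact: hu].
  by apply: hu => //; move: uk; rewrite specM// => /isunitM[].
- move=> x /Dsp[Vx uf uk kx]; apply: mcontZ; last exact: hb.
  apply: regM; first by apply: regM; [exact: spec_reg | exact: hu].
  by apply: hu => //; move: uk; rewrite specM// => /isunitM[].
move=> x hx; have [Vx ufg uk kx] := Dsp _ _ _ hx.
have [uf ug] : isunit (th f x) /\ isunit (th g x).
  by move: ufg; rewrite specM// => /isunitM.
have us : isunit (th (f + g) x) by move: uk; rewrite specM// => /isunitM[].
rewrite e// -scalerDl scalerA -[LHS]scale1r; congr (_ *: _).
have : th (f + g) x ^+ (N + N) = th c x * th f x ^+ N + th c' x * th g x ^+ N.
  by rewrite -specX// ec specD// !specM// !specX//.
move: (uinvP uf) (uinvP ug) (uinvP us).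
move: (uinv (th f x)) (uinv (th g x)) (uinv (th (f + g) x)) => u v w eu ev ew E.
have {}eu : u ^+ N * th f x ^+ N = 1 by rewrite -exprMn eu expr1n.
have {}ev : v ^+ N * th g x ^+ N = 1 by rewrite -exprMn ev expr1n.
have : w ^+ (N + N) * th (f + g) x ^+ (N + N) = 1 by rewrite -exprMn ew expr1n.
rewrite E => <-; rewrite specM// exprMn.
transitivity (w ^+ (N + N) * (th c x * th f x ^+ N * (v ^+ N * th g x ^+ N) +
  th c' x * th g x ^+ N * (u ^+ N * th f x ^+ N))).
  by rewrite eu ev !mulr1.
ring.
Qed.

Section Cohomology.
Variables (I : nat -> absheaf X) (eps : forall x, M x -> I 0%N x).
Variable d : forall n x, I n x -> I n.+1 x.
Hypothesis res : @injective_resolution X (ab_of M) I eps d.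

(** Stated for every D(f), because the overlaps in the degree 2 argument are of this form. *)
Lemma spec_H1_zero f : H1_zero_on d (Dset f).
Proof.
move=> s hs ds.
pose J : set R := fun r => exact_on (@d 0%N) s (Dset (r * f)).
have [| |n] := @spec_cover J f.
- split.
  + exists (fun=> 0) => x; rewrite mul0r => -[Vx]; rewrite spec0//;
    by move=> /isunit0.
  + move=> r r' hr hr'; rewrite /J mulrC.
    apply: (@exact_onS _ _ _ _ _ (Dset (r * (f * (r + r'))) `|` Dset (r' * (f * (r + r'))))).
      by move=> x; rewrite !DsetM => -[fx rx]; have [] := DsetD rx; [left|right].
    apply: (mayer_vietoris1 res); try exact: open_Dset.
    * by apply: exact_onS hr => x; rewrite !DsetM => -[? []].
    * by apply: exact_onS hr' => x; rewrite !DsetM => -[? []].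
    move=> a ha; have [|b [c [hb hc e]]] := @split_section a r r' f.
      by move=> x; rewrite !DsetM => -[[rx rx'] k]; apply: ha; rewrite !DsetM.
    by exists b, c; split=> // x rx rx'; apply: e; move: rx rx'; rewrite !DsetM => -[? ?] [].
  + move=> r r' h; apply: exact_onS h => x.
    by rewrite !DsetM => -[[]].
- move=> x fx; have [U [oU Ux hU]] := exact_on_near res (hs x fx) (ds x fx).
  have [r ur H] := spec_basis (proj1 fx) (openP oU Ux).
  exists r => //; apply: exact_onS hU => y; rewrite DsetM => -[[Vy uy] _].
  exact: H.
apply: exact_onS => x fx; rewrite DsetM; split=> //; split; first by case: fx.
by rewrite specX; [apply: isunitX; case: fx | case: fx].
Qed.

Lemma spec_H2_zero (s : forall x, I 2%N x) : csec V s ->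
  (forall x, V x -> d (s x) = 0) -> exact_on (@d 1%N) s V.
Proof.
move=> hs ds.
pose J : set R := fun r => exact_on (@d 1%N) s (Dset r).
have [| |n] := @spec_cover J 1.
- split.
  + exists (fun=> 0) => x [Vx]; rewrite spec0//; by move=> /isunit0.
  + move=> r r' hr hr'.
    apply: (@exact_onS _ _ _ _ _ (Dset (r * (r + r')) `|` Dset (r' * (r + r')))).
      by move=> x rx; rewrite !DsetM; have [] := DsetD rx; [left|right].
    apply: (mayer_vietoris2 res); try exact: open_Dset.
    * by apply: exact_onS hr => x; rewrite !DsetM => -[].
    * by apply: exact_onS hr' => x; rewrite !DsetM => -[].
    by rewrite -DsetM; exact: spec_H1_zero.
  + by move=> r r' h; apply: exact_onS h => x; rewrite !DsetM => -[].
- move=> x; rewrite Dset1 => Vx.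
  have [U [oU Ux hU]] := exact_on_near res (hs x Vx) (ds x Vx).
  have [r ur H] := spec_basis Vx (openP oU Ux).
  exists r => //; apply: exact_onS hU => y [Vy uy]; exact: H.
by rewrite expr1n /J Dset1.
Qed.

End Cohomology.
End Extension.
End Spec.
End AffineOpens.

(** * Tensor products and pullbacks *)

Section Modules.
Local Open Scope classical_set_scope.
Local Open Scope ring_scope.

Section Bilinear.
Variables (R : comNzRingType) (A B T : lmodType R) (b : A -> B -> T).
Hypothesis hb : bilin b.

Lemma bilin0l w : b 0 w = 0.
Proof.
by have := (proj1 hb) 1 0 0 w; rewrite scale1r scale1r addr0 => /eq_addrr.
Qed.

Lemma bilin0r w : b w 0 = 0.
Proof.
by have := (proj2 hb) 1 0 0 w; rewrite scale1r scale1r addr0 => /eq_addrr.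
Qed.

Lemma bilinZl a u w : b (a *: u) w = a *: b u w.
Proof. by rewrite -[a *: u]addr0 (proj1 hb) bilin0l addr0. Qed.

Lemma bilinZr a u w : b w (a *: u) = a *: b w u.
Proof. by rewrite -[a *: u]addr0 (proj2 hb) bilin0r addr0. Qed.

End Bilinear.

Lemma bilin_flip (R : comNzRingType) (A B T : lmodType R) (b : A -> B -> T) :
  bilin b -> bilin (fun v u => b u v).
Proof. by case. Qed.

Section Tensor.
Variables (X : lrs) (A B T : modsheaf X) (b : forall x, A x -> B x -> T x).
Hypothesis hT : tensor_by b.

Lemma tensor_bilin x : bilin (@b x). Proof. by case: hT. Qed.

Lemma tensor_cont x (s : forall x, A x) (t : forall x, B x) :
  mcont x s -> mcont x t -> mcont x (fun y => b (s y) (t y)).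
Proof. by case: hT => H _ _ _; exact: H. Qed.

Section Gen.
Variables (x : X) (g : B x).
Hypothesis hg : isgen g.

(** Coordinates along [g] define, by the universal property, a map back to [A x]; the uniqueness
    part shows that it is inverse to tensoring with [g]. *)
Let retract : exists h : T x -> A x,
  (forall a, h (b a g) = a) /\ (forall t, b (h t) g = t).
Proof.
have /choice[co coE] : forall v : B x, exists c, v = c *: g.
  by move=> v; have [c [e _]] := hg v; exists c.
have coP a v w : co (a *: v + w) = a * co v + co w.
  by apply: (isgen_inj hg); rewrite scalerDl -scalerA -!coE.
have cog : co g = 1 by apply: (isgen_inj hg); rewrite -coE scale1r.
case: hT => _ _ hex huniq.
have [|h _ hE] := hex x (A x) (fun a v => co v *: a).
  split=> a u v w; last by rewrite coP scalerDl scalerA.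
  by rewrite scalerDr !scalerA mulrC.
have hbg a : h (b a g) = a by rewrite hE cog scale1r.
exists h; split=> // t.
have lin : linear (fun t : T x => b (h t) g).
  by move=> a u v; rewrite linearP (proj1 (tensor_bilin x)).
pose k := GRing.isLinear.Build _ _ _ _ (fun t : T x => b (h t) g) lin.
pose K : {linear T x -> T x} := HB.pack (fun t : T x => b (h t) g) k.
rewrite -[RHS]/((idfun : {linear T x -> T x}) t).
apply: (huniq x (T x) K) => u v /=.
by rewrite hE (bilinZl (tensor_bilin x)) -(bilinZr (tensor_bilin x)) -coE.
Qed.

Lemma tensor_surj t : exists a, t = b a g.
Proof. by have [h [_ h2]] := retract; exists (h t). Qed.

Lemma tensor_inj a a' : b a g = b a' g -> a = a'.
Proof. by have [h [h1 _]] := retract => e; rewrite -(h1 a) e. Qed.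

Lemma tensor_gen a : isgen a <-> isgen (b a g).
Proof.
have zl := bilinZl (tensor_bilin x).
split=> ha; apply: isgenP.
- move=> v; have [a' ->] := tensor_surj v; have [c [-> _]] := ha a'.
  by exists c; rewrite zl.
- move=> c; rewrite -zl -(bilin0l (tensor_bilin x) g) => /tensor_inj.
  exact: isgen_eq0.
- move=> v; have [c [e _]] := ha (b v g).
  by exists c; apply: tensor_inj; rewrite zl.
move=> c e; apply: (isgen_eq0 ha).
by rewrite -zl e (bilin0l (tensor_bilin x)).
Qed.

End Gen.

(** A section through the germ of [a] at [x] has the same product with [g] nearby, and tensoring
    with a generator is injective. This is how quotients chosen stalk by stalk become sections. *)
Lemma tensor_div_cont x (a : forall x, A x) (g : forall x, B x) :
  mcont x g -> (\forall y \near x, isgen (g y)) ->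
  mcont x (fun y => b (a y) (g y)) -> mcont x a.
Proof.
move=> hg gg hab; have [a' ha' e] := mcont_germ (a x).
apply: (mcont_cong _ ha').
have : \forall y \near x, b (a' y) (g y) = b (a y) (g y).
  by apply: mcont_eq => //; [exact: tensor_cont | rewrite e].
by apply: filterS2 gg => y gy /(tensor_inj gy).
Qed.

End Tensor.

Lemma tensor_flip (X : lrs) (A B T : modsheaf X) (b : forall x, A x -> B x -> T x) :
  tensor_by b -> tensor_by (fun x v u => b x u v).
Proof.
move=> [h1 h2 h3 h4]; split.
- by move=> x s t hs ht; exact: h1.
- by move=> x; exact/bilin_flip/h2.
- by move=> x M f /bilin_flip/h3[g _ H]; exists g.
- by move=> x M g h H; apply: h4.
Qed.

Section Pullback.
Variables (X Y : lrs) (f : mor X Y) (A : modsheaf Y) (B : modsheaf X).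
Variable u : forall x, A (f x) -> B x.
Hypothesis hu : pullback_by u.

Lemma pullback_cont x (s : forall y, A y) :
  mcont (f x) s -> mcont x (fun y => u (s (f y))).
Proof. by case: hu => H _ _ _; exact: H. Qed.

Lemma pullbackP x a v w : @u x (a *: v + w) = sharp f x a *: u v + u w.
Proof. by case: hu => _ H _ _; exact: H. Qed.

Lemma pullback0 x : @u x 0 = 0.
Proof.
by have := @pullbackP x 1 0 0; rewrite rmorph1 !scale1r addr0 => /eq_addrr.
Qed.

Lemma pullbackZ x a v : @u x (a *: v) = sharp f x a *: u v.
Proof. by rewrite -[a *: v]addr0 pullbackP pullback0 addr0. Qed.

Lemma pullbackD x v w : @u x (v + w) = u v + u w.
Proof. by rewrite -[v]scale1r pullbackP rmorph1 !scale1r. Qed.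

(** The coordinate along [m] is semilinear, hence induces a linear form [h] on the pullback with h
    (u m) = 1; uniqueness gives v = h(v) u m. *)
Lemma pullback_gen x (m : A (f x)) : isgen m -> isgen (u m).
Proof.
move=> hm.
have /choice[co coE] : forall v : A (f x), exists c, v = c *: m.
  by move=> v; have [c [e _]] := hm v; exists c.
have coP a v w : co (a *: v + w) = a * co v + co w.
  by apply: (isgen_inj hm); rewrite scalerDl -scalerA -!coE.
have com : co m = 1 by apply: (isgen_inj hm); rewrite -coE scale1r.
case: hu => _ _ hex huniq.
have [|h _ hE] := hex x (st x)^o (fun v => sharp f x (co v)).
  by move=> a v w; rewrite coP rmorphD rmorphM.
have hm1 : h (u m) = 1 by rewrite hE com rmorph1.
apply: isgenP => [v|a e]; last first.
  have : h (a *: u m) = a *: h (u m) by exact: linearZ.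
  by rewrite e linear0 hm1 [_ *: _]mulr1.
exists (h v).
have lin : linear (fun t : B x => (h t : st x) *: u m).
  by move=> a w t; rewrite linearP scalerDl scalerA.
pose k := GRing.isLinear.Build _ _ _ _ (fun t : B x => (h t : st x) *: u m) lin.
pose K : {linear B x -> B x} := HB.pack (fun t : B x => (h t : st x) *: u m) k.
rewrite -[LHS]/((idfun : {linear B x -> B x}) v); symmetry.
by apply: (huniq x (B x) K) => w /=; rewrite hE -pullbackZ -coE.
Qed.

(** The device of [pullback_gen] with two coordinates; it serves to expand the splitting of the
    Frobenius pullback of the rank 2 bundle. *)
Lemma pullback_span2 x (e0 e1 : A (f x)) : isbasis2 e0 e1 ->
  forall v : B x, exists a b, v = a *: u e0 + b *: u e1.
Proof.
move=> he.
have /choice[co coE] : forall v : A (f x), exists c : _ * _, v = c.1 *: e0 + c.2 *: e1.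
  by move=> v; have [c [e _]] := he v; exists c.
have coP a v w : co (a *: v + w) = (a * (co v).1 + (co w).1, a * (co v).2 + (co w).2).
  have [c [e uc]] := he (a *: v + w).
  rewrite -(uc _ (coE _)); apply: uc; rewrite [in LHS](coE v) [in LHS](coE w) /=.
  by rewrite scalerDr !scalerDl !scalerA addrACA.
case: hu => _ _ hex huniq.
have [|h0 _ hE0] := hex x (st x)^o (fun v => sharp f x (co v).1).
  by move=> a v w; rewrite coP rmorphD rmorphM.
have [|h1 _ hE1] := hex x (st x)^o (fun v => sharp f x (co v).2).
  by move=> a v w; rewrite coP rmorphD rmorphM.
move=> v; exists (h0 v), (h1 v).
pose F (t : B x) := (h0 t : st x) *: u e0 + (h1 t : st x) *: u e1.
have lin : linear F.
  move=> a w t; have l0 : h0 (a *: w + t) = a * h0 w + h0 t := linearP h0 a w t.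
  have l1 : h1 (a *: w + t) = a * h1 w + h1 t := linearP h1 a w t.
  by rewrite /F l0 l1 scalerDr !scalerDl !scalerA addrACA.
pose K : {linear B x -> B x} := HB.pack F (GRing.isLinear.Build _ _ _ _ F lin).
rewrite -[LHS]/((idfun : {linear B x -> B x}) v); symmetry.
apply: (huniq x (B x) K) => w /=.
by rewrite /F hE0 hE1 -!pullbackZ -pullbackD -coE.
Qed.

Lemma pullback_invertible : invertible A -> invertible B.
Proof.
move=> hA x; have [s hs gs] := hA (f x).
exists (fun y => u (s (f y))); first exact: pullback_cont.
have := @fn_cont _ _ f x _ gs; rewrite /nbhs/=.
by apply: filterS => y; exact: pullback_gen.
Qed.

End Pullback.

Lemma tensor_invertible (X : lrs) (A B T : modsheaf X) :
  is_tensor A B T -> invertible A -> invertible B -> invertible T.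
Proof.
move=> [b hb] hA hB x; have [s hs gs] := hA x; have [t ht gt] := hB x.
exists (fun y => b y (s y) (t y)); first exact: (tensor_cont hb).
by apply: filterS2 gs gt => y sy ty; apply/(tensor_gen hb ty).
Qed.

(* [pw] is the n-th tensor power m |-> m^n. *)
Lemma tpow_map (X : lrs) n (A T : modsheaf X) : is_tpow n A T ->
  exists pw : forall x, A x -> T x,
  [/\ forall x s, mcont x s -> mcont x (fun y => pw y (s y)),
      forall x a m, pw x (a *: m) = a ^+ n *: pw x m &
      forall x m, isgen m -> isgen (pw x m)].
Proof.
elim: n T => [|n IH] T /=.
  move=> [f [fP fc] fb].
  have f0 x : f x 0 = 0.
    by have := fP x 1 0 0; rewrite !scale1r addr0 => /eq_addrr.
  have fZ x (a : st x) : f x a = a *: f x (1 : st x).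
    have := fP x a (1 : st x) 0; rewrite f0 !addr0 => <-.
    by rewrite [_ *: _]mulr1.
  exists (fun x _ => f x (1 : st x)); split.
  - by move=> x s _; apply: (fc x (fun y => 1 : st y)); exact: reg1.
  - by move=> x a m; rewrite expr0 scale1r.
  move=> x m _; apply: isgenP => [v|a].
    have [h h1 h2] := fb x; exists (h v); by rewrite -fZ h2.
  by rewrite -fZ -(f0 x) => /(bij_inj (fb x)).
move=> [S /IH[pw [pc pZ pg]] [b hb]].
exists (fun x m => b x m (pw x m)); split.
- by move=> x s hs; apply: (tensor_cont hb) => //; exact: pc.
- move=> x a m; rewrite pZ (bilinZl (tensor_bilin hb x)).
  by rewrite (bilinZr (tensor_bilin hb x)) scalerA exprS.
by move=> x m hm; apply/(tensor_gen hb (pg x m hm)).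
Qed.

Lemma tpow_invertible (X : lrs) n (A T : modsheaf X) : is_tpow n A T ->
  invertible A -> invertible T.
Proof.
move=> /tpow_map[pw [pc _ pg]] hA x; have [s hs gs] := hA x.
exists (fun y => pw y (s y)); first exact: pc.
by apply: filterS gs => y; exact: pg.
Qed.

End Modules.

(** * The topology of a curve *)

Section Noetherian.
Local Open Scope classical_set_scope.
Local Open Scope ring_scope.

Definition acc (R : comNzRingType) : Prop := forall I : nat -> set R,
  (forall n, is_ideal (I n)) -> (forall n, I n `<=` I n.+1) ->
  exists N, forall n, (N <= n)%N -> I n `<=` I N.

Lemma chain_le (T : Type) (I : nat -> set T) :
  (forall n, I n `<=` I n.+1) -> forall m n, (m <= n)%N -> I m `<=` I n.
Proof.
move=> hI m n /subnKC <-; elim: (n - m)%N => [|j IH]; first by rewrite addn0.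
by rewrite addnS; apply: subset_trans IH _; exact: hI.
Qed.

Lemma acc_field (k : fieldType) : acc k.
Proof.
move=> I hI _.
have [[N [a Ia a0]]|H] := pselect (exists N, exists2 a, I N a & a != 0).
  exists N => n _ b _; have [_ _ IM] := hI N.
  by rewrite -[b](mulfVK a0); exact: IM.
exists 0%N => n _ b Ib; have [I0 _ _] := hI 0%N.
have [->//|b0] := eqVneq b 0; exfalso.
by apply: H; exists n, b.
Qed.

(** Hilbert's basis theorem. [L n d] is the ideal of coefficients of X^d in members of [I n] of
    degree at most d; it grows with both indices. *)
Lemma acc_poly (R : comNzRingType) : acc R -> acc {poly R}.
Proof.
move=> hR I hI Imono.
pose L n d : set R := fun c => exists p, [/\ I n p, (size p <= d.+1)%N & p`_d = c].
have Lid n d : is_ideal (L n d).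
  have [I0 ID IM] := hI n; split.
  - by exists 0; rewrite size_poly0 coef0.
  - move=> a b [p [Ip sp <-]] [q [Iq sq <-]]; exists (p + q); split.
    + exact: ID.
    + by apply: leq_trans (size_polyD _ _) _; rewrite geq_max sp.
    + by rewrite coefD.
  - move=> a b [p [Ip sp <-]]; exists (a%:P * p); split; first exact: IM.
    + by rewrite mul_polyC; apply: leq_trans (size_scale_leq _ _) sp.
    + by rewrite coefCM.
have Ln d n : L n d `<=` L n.+1 d.
  by move=> c [p [Ip sp e]]; exists p; split=> //; exact: Imono.
have Ld n d : L n d `<=` L n d.+1.
  move=> c [p [Ip sp e]]; exists ('X * p); split.
  - by have [_ _ IM] := hI n; exact: IM.
  - have [->|p0] := eqVneq p 0; first by rewrite mulr0 size_poly0.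
    by rewrite mulrC size_mulX.
  - by rewrite coefXM.
have Lnd n n' d d' : (n <= n')%N -> (d <= d')%N -> L n d `<=` L n' d'.
  move=> nn dd; apply: (@subset_trans _ (L n' d)).
    exact: (chain_le (Ln d) nn).
  exact: (chain_le (Ld n') dd).
have [N0 HN0] := hR (fun n => L n n) (fun n => Lid n n)
  (fun n => Lnd _ _ _ _ (leqnSn n) (leqnSn n)).
(* The diagonal is stable from [N0] on, which settles all degrees at least [N0]; the finitely many
   lower degrees are stabilised one by one. *)
have [M [NM HM]] : exists M, (N0 <= M)%N /\
    forall d n, (d < N0)%N -> (M <= n)%N -> L n d `<=` L M d.
  suff [M HM] : exists M, forall d n, (d < N0)%N -> (M <= n)%N -> L n d `<=` L M d.
    exists (maxn N0 M); split=> [|d n dN Mn]; first exact: leq_maxl.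
    apply: (subset_trans (HM d n dN _)).
      by apply: leq_trans Mn; exact: leq_maxr.
    by apply: Lnd => //; exact: leq_maxr.
  elim: {HN0} N0 => [|N [M HM]]; first by exists 0%N.
  have [M' HM'] := hR (L^~ N) (Lid^~ N) (fun n => Ln N n).
  exists (maxn M M') => d n; rewrite ltnS leq_eqVlt => /orP[/eqP->|dN] Mn.
    apply: (subset_trans (HM' n _)); last by apply: Lnd => //; exact: leq_maxr.
    by apply: leq_trans Mn; exact: leq_maxr.
  apply: (subset_trans (HM d n dN _)); last by apply: Lnd => //; exact: leq_maxl.
  by apply: leq_trans Mn; exact: leq_maxl.
exists M => n Mn p Ip.
(* Induction on the size: subtracting an element of [I M] with the same top coefficient lowers
   it. *)
have [m] := ubnP (size p); elim: m p Ip => // -[|m] IH p Ip sp.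
  move: sp; rewrite ltnS leqn0 size_poly_eq0 => /eqP ->.
  by have [] := hI M.
have [q [Iq sq eq]] : L M m p`_m.
  have Lp : L n m p`_m by exists p.
  have [mN|Nm] := ltnP m N0; first exact: (HM m n mN Mn).
  apply: (Lnd N0 M N0 m NM Nm); apply: (HN0 (maxn n m)).
    by apply: leq_trans Nm _; exact: leq_maxr.
  by apply: (Lnd n _ m _ _ _ _ Lp); [exact: leq_maxl | exact: leq_maxr].
have [_ ID IM] := hI M; have [_ ID' IM'] := hI n.
rewrite -[p](subrK q); apply: ID => //; apply: IH.
  apply: ID' => //; rewrite -mulN1r; apply: IM'.
  exact: (chain_le Imono Mn).
rewrite ltnS; apply/leq_sizeP => j; rewrite leq_eqVlt => /orP[/eqP <-|mj].
  by rewrite coefB eq subrr.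
rewrite coefB !nth_default ?subrr//; exact: leq_trans mj.
Qed.

Lemma acc_surj (A R : comNzRingType) (f : {rmorphism A -> R}) :
  acc A -> (forall r, exists a, f a = r) -> acc R.
Proof.
move=> hA fs I hI Imono.
have [|n a|N HN] := hA (fun n => f @^-1` (I n)).
- move=> n; have [I0 ID IM] := hI n; split; rewrite /preimage/=.
  + by rewrite rmorph0.
  + by move=> a b; rewrite rmorphD; exact: ID.
  + by move=> a b; rewrite rmorphM; exact: IM.
- exact: Imono.
by exists N => n Nn r; have [a <-] := fs r => /(HN n Nn a).
Qed.

(** [A] is an iterated polynomial ring over [k], with one variable for each member of [rs]; it is
    meant as the source of a surjection onto a finitely generated algebra. *)
Lemma acc_adjoin (k : fieldType) (R : comNzRingType) (ka : {rmorphism k -> R})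
    (rs : seq R) : exists (A : comNzRingType) (f : {rmorphism A -> R}),
  [/\ acc A, forall c, exists a, f a = ka c & forall r, r \in rs -> exists a, f a = r].
Proof.
elim: rs => [|r rs [A [f [hA fk fr]]]].
  exists k, ka; split=> //; first exact: acc_field.
  by move=> c; exists c.
have cf : commr_rmorph f r by move=> a; rewrite /GRing.comm mulrC.
exists {poly A}, (horner_morph cf : {rmorphism _ -> _}); split.
- exact: acc_poly.
- by move=> c; have [a <-] := fk c; exists a%:P; rewrite /= horner_morphC.
move=> r'; rewrite inE => /orP[/eqP ->|/fr[a <-]].
  by exists 'X; rewrite /= horner_morphX.
by exists a%:P; rewrite /= horner_morphC.
Qed.

(** Noetherian induction: iterating a chosen enlargement of a bad ideal would give a strictly
    increasing chain. *)
Lemma acc_ind (R : comNzRingType) (bad : set R -> Prop) : acc R ->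
  (forall I, bad I -> is_ideal I) ->
  (forall I, bad I -> exists J a, [/\ bad J, I `<=` J, J a & ~ I a]) ->
  forall I, ~ bad I.
Proof.
move=> hR bid step I0 b0.
pose T := {I : set R | bad I}.
have /choice[nx nxE] : forall I : T, exists J : T,
    sval I `<=` sval J /\ exists2 a, sval J a & ~ sval I a.
  move=> [I bI]; have [J [a [bJ IJ Ja nIa]]] := step I bI.
  by exists (exist _ J bJ); split=> //; exists a.
pose I n := sval (iter n nx (exist _ I0 b0)).
have [n|n|N HN] := hR I.
- by apply: bid; rewrite /I; case: (iter _ _ _).
- by rewrite /I iterS; have [] := nxE (iter n nx (exist _ I0 b0)).
have [_ [a Ja nI]] := nxE (iter N nx (exist _ I0 b0)).
by apply: nI; apply: (HN N.+1 (leqnSn N)); rewrite /I iterS.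
Qed.

End Noetherian.

(** * Closed points and finite complements on a curve *)

Section Curves.
Local Open Scope classical_set_scope.
Local Open Scope ring_scope.
Variables (k : fieldType) (C : curve k).

Section Chart.
Variables (V : set C) (R : comNzRingType) (th : R -> forall x : C, st x).
Hypothesis hV : isSpec V th.

Lemma chart_gpt x : V x -> V (gpt C).
Proof. by move=> Vx; apply: (@crv_generic _ C x); exact: openP (spec_open hV) Vx. Qed.

Lemma crv_germ0 (x : C) (a : forall y : C, st y) : reg x a -> a x = 0 -> a (gpt C) = 0.
Proof.
move=> ha a0; apply: (@crv_generic _ C x (fun y => a y = 0)).
by apply: reg_eq => //; exact: reg0.
Qed.

Lemma crv_unit_gpt (x : C) (a : forall y : C, st y) :
  reg x a -> isunit (a x) -> isunit (a (gpt C)).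
Proof.
move=> ha ua; apply: (@crv_generic _ C x (fun y => isunit (a y))).
by have [] := reg_uinv ha ua.
Qed.

Lemma chart_gpt_inj r : V (gpt C) -> th r (gpt C) = 0 -> r = 0.
Proof.
move=> Vg r0; apply: (spec_inj hV) => x Vx; rewrite (spec0 hV)//.
have [s us e] := spec_tors hV Vg r0.
have : th s x * th r x = 0 by rewrite -(specM hV)// e (spec0 hV).
move=> /crv_domain[s0|//]; exfalso.
have := crv_germ0 (spec_reg hV s Vx) s0 => e0.
by move: us; rewrite e0 => /isunit0.
Qed.

Lemma chart_inj r x : V x -> th r x = 0 -> r = 0.
Proof.
move=> Vx r0; apply: chart_gpt_inj; first exact: chart_gpt Vx.
exact: crv_germ0 (spec_reg hV r Vx) r0.
Qed.

(** Units spread to the generic point, so otherwise [r] would be a unit nowhere on the chart, hence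
    nilpotent, hence 0. *)
Lemma chart_unit_gpt r : V (gpt C) -> r <> 0 -> isunit (th r (gpt C)).
Proof.
move=> Vg r0; apply: contrapT => nu.
have [x [Vx ux]|n] := @spec_vanish _ _ _ _ hV 1 r.
  by exfalso; apply: nu; exact: crv_unit_gpt (spec_reg hV r Vx) ux.
rewrite mulr1 => rn; apply: r0; apply: chart_gpt_inj => //.
have : th r (gpt C) ^+ n = 0 by rewrite -(specX hV)// rn (spec0 hV).
elim: n {rn} => [|n IH]; first by rewrite expr0 => /eqP; rewrite oner_eq0.
by rewrite exprS => /crv_domain[|].
Qed.

Lemma chart_gptP x : V x -> x <> gpt C -> exists2 r, r <> 0 & ~ isunit (th r x).
Proof.
move=> Vx; apply: contra_notP => H.
have Vg := chart_gpt Vx.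
apply: (spec_point_uniq hV) => // r.
have [->|/eqP r0] := eqVneq r 0; first by rewrite !(spec0 hV)//; split=> /isunit0.
split=> _; first exact: chart_unit_gpt.
by apply: contrapT => nu; apply: H; exists r.
Qed.

(* The primes of the discrete valuation ring O_y are 0 and the maximal ideal. *)
Lemma chart_dim1 x y : V x -> V y -> x <> gpt C ->
  (forall r, isunit (th r y) -> isunit (th r x)) -> x = y.
Proof.
move=> Vx Vy xg H.
have [r r0 rx] := chart_gptP Vx xg.
have yg : y <> gpt C.
  move=> e; apply: rx; apply: H; rewrite e; apply: chart_unit_gpt => //.
  by rewrite -e.
have [t [t0 tn ht]] := crv_regular yg.
have [a [s [us es]]] := spec_frac hV t Vy.
(* In the local ring at [y], [q] is a unit times a power of the uniformizer a / s. Clearing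
   denominators gives an identity in [R], which can then be evaluated at [x]. *)
have key q : q <> 0 -> exists n b c,
      [/\ isunit (th b y), isunit (th c y), q * s ^+ n * c = b * a ^+ n &
    (~ isunit (th q y) -> n <> 0%N)].
  move=> q0.
  have [|n [u [[u' eu] e]]] := ht (th q y).
    by move=> /(chart_inj Vy).
  have [b [c [uc ec]]] := spec_frac hV u Vy.
  exists n, b, c; split.
  - by rewrite -ec; apply/isunitM; split=> //; exists u'.
  - by [].
  - apply/eqP; rewrite -subr_eq0; apply/eqP/(chart_inj Vy).
    rewrite (specB hV)// !(specM hV)// !(specX hV)// e -es -ec exprMn; ring.
  - by move=> nu n0; apply: nu; rewrite e n0 expr0 mulr1; exists u'.
have nax : ~ isunit (th a x).
  move=> ua; apply: rx.
  have [n [b [c [ub _ e _]]]] := key r r0.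
  have : isunit (th (r * s ^+ n * c) x).
    rewrite e (specM hV)// (specX hV)//; apply/isunitM; split; first exact: H.
    exact: isunitX.
  by rewrite !(specM hV)// => /isunitM[/isunitM[]].
apply: (spec_point_uniq hV) => // q; split; last exact: H.
move=> uq; apply: contrapT => nq.
have q0 : q <> 0 by move=> q0; move: uq; rewrite q0 (spec0 hV)// => /isunit0.
have [n [b [c [ub uc e /(_ nq) n0]]]] := key q q0.
have : isunit (th (q * s ^+ n * c) x).
  rewrite !(specM hV)// (specX hV)//.
  by apply/isunitM; split; [apply/isunitM; split=> //; apply: isunitX|]; exact: H.
rewrite e (specM hV)// (specX hV)// => /isunitM[_].
case: n n0 {e} => // n _; rewrite exprS => /isunitM[/nax[]].
Qed.

(** Noetherian induction on the ideals containing [r] with infinite zero set: a prime one has a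
    single zero, and otherwise the zero set is covered by those of two larger ideals. *)
Lemma chart_finite r : acc R -> r <> 0 ->
  finite_set [set x | V x /\ ~ isunit (th r x)].
Proof.
move=> hR r0.
pose Z (I : set R) := [set x | V x /\ forall a, I a -> ~ isunit (th a x)].
pose bad (I : set R) := [/\ is_ideal I, I r & ~ finite_set (Z I)].
have nbad : forall I, ~ bad I.
  apply: (acc_ind hR); first by move=> I [].
  move=> I [[I0 ID IM] Ir nf].
  have I1 : ~ I 1.
    move=> I1; apply: nf; rewrite (_ : Z I = set0)//; apply/seteqP; split=> // x [Vx].
    by move=> /(_ 1 I1); rewrite (spec1 hV)//; case; exact: isunit1.
  have [a [b [nIa nIb Iab]]] : exists a b, [/\ ~ I a, ~ I b & I (a * b)].
    apply: contrapT => H; apply: nf.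
    have pI : prime_ideal I.
      split=> // a b Iab; apply: contrapT => /not_orP[na nb].
      by apply: H; exists a, b.
    have [x Vx e] := spec_point hV pI.
    apply: (@sub_finite_set _ _ [set x]); last exact: finite_set1.
    move=> y [Vy hy] /=; symmetry; apply: chart_dim1 => //.
      by move=> xg; apply: ((e r).1 Ir); rewrite xg; apply: chart_unit_gpt => //; rewrite -xg.
    by move=> q uq; apply: contrapT => /e /hy.
  pose J c : set R := fun z => exists m q, I m /\ z = m + q * c.
  have IJ c : I `<=` J c by move=> m Im; exists m, 0; split=> //; ring.
  have Jc c : J c c by exists 0, 1; split=> //; ring.
  have Jid c : is_ideal (J c).
    split; first exact: IJ.
      move=> _ _ [m [q [Im ->]]] [m' [q' [Im' ->]]].
      by exists (m + m'), (q + q'); split; [exact: ID | ring].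
    move=> z _ [m [q [Im ->]]].
    by exists (z * m), (z * q); split; [exact: IM | ring].
  have [fa|nfa] := pselect (finite_set (Z (J a))); last first.
    by exists (J a), a; split=> //; split=> //; exact: IJ.
  have [fb|nfb] := pselect (finite_set (Z (J b))); last first.
    by exists (J b), b; split=> //; split=> //; exact: IJ.
  exfalso; apply: nf.
  apply: (@sub_finite_set _ _ (Z (J a) `|` Z (J b))); last by rewrite finite_setU.
  move=> x [Vx hx]; have := hx _ Iab; rewrite (specM hV)// => /isunitM/not_andP[h|h].
    left; split=> // _ [m [q [Im ->]]]; rewrite (specD hV)// (specM hV)//.
    by move=> /isunitD[/(hx _ Im)//|/isunitM[_ /h]].
  right; split=> // _ [m [q [Im ->]]]; rewrite (specD hV)// (specM hV)//.
  by move=> /isunitD[/(hx _ Im)//|/isunitM[_ /h]].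
pose I : set R := fun z => exists q, z = q * r.
apply: contrapT => nf; apply: (nbad I); split.
- split; first by exists 0; ring.
    by move=> _ _ [q ->] [q' ->]; exists (q + q'); ring.
  by move=> z _ [q ->]; exists (z * q); ring.
- by exists 1; ring.
apply: contra_not nf; apply: sub_finite_set => x [Vx nx]; split=> // _ [q ->].
by rewrite (specM hV)// => /isunitM[_ /nx].
Qed.

End Chart.

(** If every function invertible at [y] were invertible at [x], [chart_dim1] would identify the two
    points; so some D(r) contains [y] and misses [x]. *)
Lemma curve_separated (x y : C) : x <> gpt C -> x <> y -> \forall z \near y, z <> x.
Proof.
move=> xg xy; have [V Vy [R [th hV]]] := crv_scheme y.
have [Vx|nVx] := pselect (V x); last first.
  by apply: filterS (openP (spec_open hV) Vy) => z Vz e; apply: nVx; rewrite -e.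
have [r [uy nx]] : exists r, isunit (th r y) /\ ~ isunit (th r x).
  apply: contrapT => H; apply: xy; apply: (chart_dim1 hV) => // r uy.
  by apply: contrapT => nx; apply: H; exists r.
have : nbhs y (Dset V th r) by apply: openP; [exact: (open_Dset hV) | split].
by apply: filterS => z [_ uz] e; apply: nx; rewrite -e.
Qed.

(** Projectivity gives finitely many charts with coordinate rings finitely generated over [k], hence
    Noetherian. On each of them the complement of [U] lies in the zero set of a nonzero function. *)
Lemma curve_cofinite (U : set C) : open U -> U (gpt C) -> finite_set (~` U).
Proof.
move=> oU Ug.
have [n [A [s [_ _ cov ch]]]] := @crv_projective _ C.
apply: (@sub_finite_set _ _ (\bigcup_(i in [set: 'I_n.+1]) ([set x | isgen (s i x)] `\` U))).
  by move=> x nUx; have [i gi] := cov x; exists i.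
apply: bigcup_finite => // i _.
have [V0|/nonemptyPn V0] := pselect ([set x | isgen (s i x)] !=set0); last first.
  by rewrite V0 set0D.
have [R [th [hV gen]]] := ch i V0; set V := [set x | _] in hV gen V0 *.
have Vg : V (gpt C) by case: V0 => x; exact: (chart_gpt hV).
have [r ur H] := spec_basis hV Vg (openP oU Ug).
have r0 : r <> 0 by move=> r0; move: ur; rewrite r0 (spec0 hV)// => /isunit0.
apply: (@sub_finite_set _ _ [set x | V x /\ ~ isunit (th r x)]).
  by move=> x [Vx nU]; split=> // /(H x Vx).
apply: (chart_finite hV) => //.
(* Constants are sections over an affine open, so they come from [R]; this makes [R] a
   [k]-algebra. *)
have /choice[ka kaE] : forall c, exists r, forall x, V x -> th r x = kst x c.
  move=> c; have [|N [q e]] := @spec_section _ _ _ _ hV (fun x => kst x c) 1.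
    by move=> x _; exact: kst_reg.
  exists q => x Vx; rewrite -e; last by rewrite (Dset1 hV).
  by rewrite (spec1 hV)// expr1n mul1r.
have kaB : zmod_morphism ka.
  move=> a b; apply: (spec_inj hV) => x Vx.
  by rewrite (specB hV)// !kaE// rmorphB.
have kaM : monoid_morphism ka.
  split; first by apply: (spec_inj hV) => x Vx; rewrite (spec1 hV)// kaE// rmorph1.
  by move=> a b; apply: (spec_inj hV) => x Vx; rewrite (specM hV)// !kaE// rmorphM.
pose kz := GRing.isZmodMorphism.Build _ _ ka kaB.
pose km := GRing.isMonoidMorphism.Build _ _ ka kaM.
pose K : {rmorphism k -> R} := HB.pack ka kz km.
have /choice[rs rsE] : forall j, exists r, forall r',
    (forall x, V x -> th r' x *: s i x = s j x) -> r' = r.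
  move=> j; have [[r1 e1]|H1] :=
    pselect (exists r', forall x, V x -> th r' x *: s i x = s j x).
    exists r1 => r2 e2; apply: (spec_inj hV) => x Vx; apply: (isgen_inj Vx).
    by rewrite e1// e2.
  by exists 0 => r' e; exfalso; apply: H1; exists r'.
have [B [f [hB fk fr]]] := acc_adjoin K (codom rs).
apply: (acc_surj hB (f := f)).
apply: (gen (fun r => exists a, f a = r)).
- move=> c q e; have [a fa] := fk c; exists a; rewrite fa.
  by apply: (spec_inj hV) => x Vx; rewrite e//= kaE.
- by move=> j q /rsE ->; apply: fr; exact: codom_f.
- by move=> _ _ [a <-] [b <-]; exists (a + b); rewrite rmorphD.
- by move=> _ _ [a <-] [b <-]; exists (a * b); rewrite rmorphM.
Qed.

Lemma curve_isolate (U : set C) (x : C) : open U -> U (gpt C) ->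
  \forall y \near x, U y \/ y = x.
Proof.
move=> oU Ug.
have /finite_seqP[s es] := curve_cofinite oU Ug.
have H : \forall y \near x, forall z, z \in s -> z <> x -> z <> gpt C -> y <> z.
  elim: s {es} => [|z s IH]; first exact: nearW.
  have [zx|nzx] := pselect (z = x).
    apply: filterS IH => y H z'; rewrite inE => /orP[/eqP ->//|]; exact: H.
  have [zg|nzg] := pselect (z = gpt C).
    apply: filterS IH => y H z'; rewrite inE => /orP[/eqP -> //|]; exact: H.
  apply: filterS2 IH (curve_separated nzg nzx) => y H yz z'.
  by rewrite inE => /orP[/eqP -> //|]; exact: H.
apply: filterS H => y H; apply: contrapT => /not_orP[nU yx].
apply: (H y) => //; last by move=> e; apply: nU; rewrite e.
by have : [set` s] y by rewrite -es.
Qed.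

End Curves.

(** * Basic opens of affine charts are affine *)

Section AffineNeighbourhoods.
Local Open Scope classical_set_scope.
Local Open Scope ring_scope.

Section Localisation.
Variables (k : fieldType) (C : curve k).
Variables (V : set C) (R : comNzRingType) (th : R -> forall x : C, st x).
Variable r : R.
Local Notation K := (st (gpt C)).
Local Notation ev := (fun b : R => th b (gpt C)).

(** The localisation of the coordinate ring at [r], realised as the fractions b / r^n inside the
    function field. The hypotheses on the chart sit inside the predicate, so that it is a subring
    unconditionally and can carry a ring structure. *)
Definition loc_pred : {pred K} := fun a => `[< isSpec V th -> V (gpt C) ->
  exists b n, a * ev r ^+ n = ev b >].

Lemma loc_predP a : isSpec V th -> V (gpt C) ->
  reflect (exists b n, a * ev r ^+ n = ev b) (a \in loc_pred).
Proof.
move=> hV Vg; apply: (iffP (asboolP _)) => [H|H _ _ //]; exact: H.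
Qed.

Lemma loc_closed : subring_closed loc_pred.
Proof.
split; first by apply/asboolP => hV Vg; exists 1, 0%N; rewrite (spec1 hV)// mul1r.
- move=> a b /asboolP Ha /asboolP Hb; apply/asboolP => hV Vg.
  have [x [n e]] := Ha hV Vg; have [y [m e']] := Hb hV Vg.
  exists (x * r ^+ m - y * r ^+ n), (n + m)%N.
  rewrite (specB hV)// !(specM hV)// !(specX hV)// -e -e' exprD; ring.
move=> a b /asboolP Ha /asboolP Hb; apply/asboolP => hV Vg.
have [x [n e]] := Ha hV Vg; have [y [m e']] := Hb hV Vg.
exists (x * y), (n + m)%N.
rewrite !(specM hV)// -e -e' exprD; ring.
Qed.

HB.instance Definition _ := GRing.isSubringClosed.Build _ loc_pred loc_closed.

Definition loc := {a : K | a \in loc_pred}.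
HB.instance Definition _ := SubChoice.on loc.
HB.instance Definition _ := [SubChoice_isSubComNzRing of loc by <:].

(** The germ of b / r^n at [x], for some representation of [a]; [loc_thE] shows that the choice does
    not matter on D(r). *)
Definition loc_th (a : loc) (x : C) : st x :=
  xget 0 [set al | exists b n, val a * ev r ^+ n = ev b /\ al * th r x ^+ n = th b x].

Hypothesis hV : isSpec V th.
Hypothesis r0 : r <> 0.
Let D := Dset V th r.

(** Two representations b / r^n and b' / r^m agree in the function field, and [R] embeds there, so
    b' r^n = b r^m already in [R]. *)
Lemma loc_thE a x b n : D x -> val a * ev r ^+ n = ev b ->
  loc_th a x * th r x ^+ n = th b x.
Proof.
move=> [Vx ur] e; have Vg := chart_gpt hV Vx.
have [c ec] := isunitX n ur.
have ex : exists al, [set al | exists b n, val a * ev r ^+ n = ev b /\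
    al * th r x ^+ n = th b x] al.
  by exists (th b x * c), b, n; split=> //; rewrite -mulrA ec mulr1.
have [b' [m [e1 e2]]] := xgetPex 0 ex; rewrite -/(loc_th a x) in e2.
have eb : b' * r ^+ n = b * r ^+ m.
  apply/eqP; rewrite -subr_eq0; apply/eqP/(chart_gpt_inj hV Vg).
  rewrite (specB hV)// !(specM hV)// !(specX hV)// -e -e1; ring.
apply/eqP; rewrite -subr_eq0; apply/eqP/(isunit_regl (isunitX m ur)).
have := congr1 (fun z => th z x) eb; rewrite !(specM hV)// !(specX hV)// -e2 => eb'.
by rewrite mulrBr [_ * th b x]mulrC -eb'; ring.
Qed.

Lemma loc_fracP (a : loc) : V (gpt C) -> exists b n, val a * ev r ^+ n = ev b.
Proof. by move=> Vg; apply/(loc_predP _ hV Vg)/valP. Qed.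

Lemma loc_th_uniq (a : loc) x al b n : D x -> val a * ev r ^+ n = ev b ->
  al * th r x ^+ n = th b x -> loc_th a x = al.
Proof.
move=> Dx e ea; apply/eqP; rewrite -subr_eq0; apply/eqP.
apply: (isunit_regl (isunitX n (proj2 Dx))).
by rewrite mulrBr ![_ ^+ _ * _]mulrC ea (loc_thE Dx e) subrr.
Qed.

Definition loc_in (b : R) : loc := insubd 0 (ev b).

Lemma val_loc_in b : V (gpt C) -> val (loc_in b) = ev b.
Proof.
move=> Vg; rewrite val_insubd ifT//; apply/(loc_predP _ hV Vg).
by exists b, 0%N; rewrite mulr1.
Qed.

Lemma loc_th_in b x : D x -> loc_th (loc_in b) x = th b x.
Proof.
move=> Dx; have Vg := chart_gpt hV (proj1 Dx).
by apply: (@loc_th_uniq _ _ _ b 0) => //; rewrite ?val_loc_in// mulr1.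
Qed.

Lemma loc_isSpec : isSpec D loc_th.
Proof.
have eD x : D x -> V x /\ V (gpt C) by move=> [Vx _]; split=> //; exact: (chart_gpt hV Vx).
have fr (a : loc) x : D x -> exists b n, val a * ev r ^+ n = ev b.
  by move=> /eD[_]; exact: loc_fracP.
split.
- split; first exact: (open_Dset hV).
  move=> a x Dx; have [b [n e]] := fr a x Dx; have [Vx Vg] := eD x Dx.
  have h : reg x (fun y => th b y * uinv (th r y) ^+ n).
    apply: regM; first exact: (spec_reg hV).
    apply: regX; apply: (proj1 (reg_uinv _ _)); last by case: Dx.
    exact: (spec_reg hV).
  apply: (reg_cong _ h); apply: filterS (openP (open_Dset hV r) Dx) => y Dy.
  symmetry; apply: (loc_th_uniq Dy e).
  by rewrite -mulrA -exprMn uinvP ?expr1n ?mulr1//; case: Dy.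
- move=> x Dx; have [Vx Vg] := eD x Dx; split.
  + apply: (@loc_th_uniq 1 x 1 1 0) => //; first by rewrite /= (spec1 hV)// mulr1.
    by rewrite (spec1 hV)// mulr1.
  + move=> a a'; have [b [n e]] := fr a x Dx; have [b' [n' e']] := fr a' x Dx.
    apply: (@loc_th_uniq _ _ _ (b * r ^+ n' - b' * r ^+ n) (n + n')) => //.
      rewrite (specB hV)// !(specM hV)// !(specX hV)// -e -e' exprD.
      rewrite (_ : val (a - a') = val a - val a')//; ring.
    rewrite (specB hV)// !(specM hV)// !(specX hV)// exprD.
    rewrite -(loc_thE Dx e) -(loc_thE Dx e'); ring.
  + move=> a a'; have [b [n e]] := fr a x Dx; have [b' [n' e']] := fr a' x Dx.
    apply: (@loc_th_uniq _ _ _ (b * b') (n + n')) => //.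
      rewrite (specM hV)// -e -e' exprD (_ : val (a * a') = val a * val a')//; ring.
    by rewrite (specM hV)// -(loc_thE Dx e) -(loc_thE Dx e') exprD; ring.
- move=> I [I0 ID IM I1 IP].
  have Vg : V (gpt C).
    apply: contrapT => nVg; apply: r0; apply: (spec_inj hV) => x /(chart_gpt hV).
    by move=> /nVg.
  have ur := chart_unit_gpt hV Vg r0.
  have inM a b : loc_in (a * b) = loc_in a * loc_in b.
    by apply: val_inj; rewrite /= !val_loc_in// (specM hV).
  have inD a b : loc_in (a + b) = loc_in a + loc_in b.
    by apply: val_inj; rewrite /= !val_loc_in// (specD hV).
  have in0 : loc_in 0 = 0 by apply: val_inj; rewrite /= val_loc_in// (spec0 hV).
  have in1 : loc_in 1 = 1 by apply: val_inj; rewrite /= val_loc_in// (spec1 hV).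
  have inX a n : loc_in (a ^+ n) = loc_in a ^+ n.
    by elim: n => [|n IH]; rewrite ?expr0// !exprS inM IH.
  have Iu a b : isunit a -> I (a * b) -> I b.
    by move=> [c e] Iab; rewrite -[b]mul1r -e -mulrA; exact: IM.
  have uloc : isunit (loc_in r).
    have [c ec] := ur.
    have cin : c \in loc_pred.
      by apply/(loc_predP _ hV Vg); exists 1, 1%N; rewrite (spec1 hV).
    by exists (Sub c cin : loc); apply: val_inj; rewrite /= val_loc_in.
  (* Primes of the localisation are contracted to [R]; the contraction avoids [r], whose image is a
     unit, so its point lies in D(r). *)
  have pJ : prime_ideal [set b | I (loc_in b)].
    split=> /=; first by rewrite in0.
    - by move=> a b; rewrite inD; exact: ID.
    - by move=> a b; rewrite inM; exact: IM.
    - by rewrite in1.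
    - by move=> a b; rewrite inM; exact: IP.
  have [x Vx e] := spec_point hV pJ.
  have Dx : D x.
    split=> //; apply: contrapT => /e /= Ir; apply: I1.
    by apply: (Iu _ _ uloc); rewrite mulr1.
  exists x; split.
    split=> // a; have [b [n ea]] := fr a x Dx.
    have ab : loc_in b = loc_in r ^+ n * a.
      rewrite -inX; apply: val_inj.
      change (val (loc_in b) = val (loc_in (r ^+ n)) * val a).
      by rewrite !val_loc_in// (specX hV)// -ea mulrC.
    have -> : I a <-> I (loc_in b).
      by rewrite ab; split; [exact: IM | apply: Iu; exact: isunitX].
    have eb : I (loc_in b) <-> ~ isunit (th b x) := e b.
    rewrite eb -(loc_thE Dx ea); split; apply: contra_not => h.
      by apply/isunitM; split=> //; apply: isunitX; case: Dx.
    by case/isunitM: h.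
  move=> y [Dy ey]; apply: (spec_point_uniq hV) => //; first by case: Dy.
  move=> b; have : I (loc_in b) <-> ~ isunit (th b x) := e b.
  rewrite ey loc_th_in// => h.
  by split=> h'; apply: contrapT => /h.
- move=> x W Dx nW; have [Vx Vg] := eD x Dx.
  have [b ub H] := spec_basis hV Vx nW.
  exists (loc_in b); first by rewrite loc_th_in.
  by move=> y Dy; rewrite loc_th_in// => uy; apply: H => //; case: Dy.
move=> x Dx; have [Vx Vg] := eD x Dx; split.
  move=> a; have [b [s [us e]]] := spec_frac hV a Vx.
  by exists (loc_in b), (loc_in s); rewrite !loc_th_in.
move=> a a0; exists 1.
  rewrite (@loc_th_uniq 1 x 1 1 0) //=; first exact: isunit1.
    by rewrite (spec1 hV)// mulr1.
  by rewrite (spec1 hV)// mulr1.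
have [b [n e]] := fr a x Dx.
have := loc_thE Dx e; rewrite a0 mul0r => /esym/(chart_inj hV Vx) b0.
rewrite mul1r; apply: val_inj => /=.
apply: (isunit_regl (isunitX n (chart_unit_gpt hV Vg r0))).
by rewrite mulrC e b0 (spec0 hV).
Qed.

End Localisation.

Lemma curve_affine_nbhd (k : fieldType) (C : curve k) (c : C) (W : set C) :
  nbhs c W -> exists U (A : comNzRingType) (th : A -> forall x : C, st x),
    [/\ isSpec U th, U c & U `<=` W].
Proof.
move=> nW; have [V Vc [R [th hV]]] := crv_scheme c.
have [r ur H] := spec_basis hV Vc nW.
have r0 : r <> 0 by move=> r0; move: ur; rewrite r0 (spec0 hV)// => /isunit0.
exists (Dset V th r), (loc V th r : comNzRingType), (@loc_th k C V R th r).
by split; [exact: loc_isSpec | split | move=> x [/H]].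
Qed.

End AffineNeighbourhoods.

(** * Gluing degree 2 primitives over a curve *)

Section Leray.
Local Open Scope classical_set_scope.
Local Open Scope ring_scope.
Variables (k : fieldType) (C : curve k) (X : topologicalType) (phi : X -> C).
Hypothesis phi_cont : continuous phi.
Variables (F : absheaf X) (I : nat -> absheaf X) (eps : forall x, F x -> I 0%N x).
Variable d : forall n x, I n x -> I n.+1 x.
Hypothesis res : injective_resolution eps d.

(* The degree 2 part of the Leray argument over a curve: off the finitely many
   points not covered yet, two local primitives differ by a class in H^1 which dies
   over a neighbourhood of the generic point. *)
Lemma exact_on_curve (s : forall x, I 2%N x) : (forall x, acont x s) ->
  (forall x, d (s x) = 0) ->
  (forall c W, nbhs c W -> exists U, [/\ open U, U c, U `<=` W,
      H1_zero_on d (phi @^-1` U) & exact_on (@d 1%N) s (phi @^-1` U)]) ->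
  exact_on (@d 1%N) s setT.
Proof.
move=> hs ds H.
have op U : open U -> open (phi @^-1` U) by move/continuousP: phi_cont; exact.
(* Induction on a list [l] containing the points outside [U]; each step enlarges [U] by a
   neighbourhood of the head of the list. *)
suff K l : forall U, open U -> U (gpt C) -> ~` U `<=` [set` (l : seq C)] ->
    exact_on (@d 1%N) s (phi @^-1` U) -> exact_on (@d 1%N) s setT.
  have [U [oU Ug _ _ hU]] := H (gpt C) setT filterT.
  have /finite_seqP[l el] := curve_cofinite oU Ug.
  by apply: (K l U) => //; rewrite el.
elim: l => [|x l IH] U oU Ug sU hU.
  apply: exact_onS hU => x _; apply: contrapT => /sU.
  by rewrite /= in_nil.
have [Ux|nUx] := pselect (U x).
  apply: (IH U) => // y nUy; have := sU y nUy.
  by rewrite /= inE => /orP[/eqP yx|//]; exfalso; apply: nUy; rewrite yx.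
have [V [oV Vx _ _ [t' ht' e']]] := H x setT filterT.
have [t ht e] := hU.
have Vg : V (gpt C) by apply: (@crv_generic _ C x); exact: openP.
have [U' [oU' Ug' sU' H1 _]] := H (gpt C) (U `&` V) (openP (openI oU oV) (conj Ug Vg)).
have [||r hr re] := H1 (fun x => t x - t' x).
- by move=> y /sU'[Uy Vy]; apply: acontB; [exact: ht | exact: ht'].
- by move=> y /sU'[Uy Vy]; case: res => _ [_ hd] _ _ _;
    rewrite (ab_homB (hd 1%N)) -e// -e'// subrr.
(* Near [x] every other point lies in [U'], while [x] is not in [U]: so [V'] meets [U] only inside
   [U'], where the difference of the primitives is exact. *)
have [V' [oV' V'x sV']] := nbhs_open (filterI (curve_isolate x oU' Ug') (openP oV Vx)).
apply: (IH (U `|` V')).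
- exact: openU.
- by left.
- move=> y /= /not_orP[nUy nVy]; have := sU y nUy.
  by rewrite /= inE => /orP[/eqP yx|//]; exfalso; apply: nVy; rewrite yx.
have -> : phi @^-1` (U `|` V') = phi @^-1` U `|` phi @^-1` V' by [].
apply: (exact_on_glue2 res (op _ oU) (op _ oV') ht e (t' := t')).
- by move=> y /sV'[_ Vy]; exact: ht'.
- by move=> y /sV'[_ Vy]; exact: e'.
have sub : phi @^-1` U `&` phi @^-1` V' `<=` phi @^-1` U'.
  move=> y [Uy V'y]; have [[//|yx] _] := sV' _ V'y.
  by exfalso; apply: nUx; rewrite -yx.
by exists r => [y /sub|y /sub]; [exact: hr | exact: re].
Qed.

End Leray.

(** * Cyclic covers of two affine charts *)

Section CyclicCharts.
Local Open Scope classical_set_scope.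
Local Open Scope ring_scope.
Variables (X : lrs) (W0 W1 : set X) (A B0 B1 : comNzRingType).
Variables (Tb0 : B0 -> forall x : X, st x) (Tb1 : B1 -> forall x : X, st x).
Hypotheses (hW0 : isSpec W0 Tb0) (hW1 : isSpec W1 Tb1).
Variables (f0 : {rmorphism {poly A} -> B0}) (f1 : {rmorphism {poly A} -> B1}).
Variables (tt0 : B0) (tt1 : B1) (l' r : nat).
Let l := l'.+1.
Hypothesis domA : forall a b : A, a * b = 0 -> a = 0 \/ b = 0.
Hypothesis basis0 : forall b : B0, exists! a : {ffun 'I_l -> {poly A}},
  b = \sum_(i < l) f0 (a i) * tt0 ^+ i.
Variable s0 : {poly A}.
Hypotheses (tt0l : tt0 ^+ l = f0 s0) (s00 : s0`_0 = 0).

Let X0 (z : X) : st z := Tb0 (f0 'X) z.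
Let X1 (z : X) : st z := Tb1 (f1 'X) z.
Let t0 (z : X) : st z := Tb0 tt0 z.
Let t1 (z : X) : st z := Tb1 tt1 z.

Hypothesis W1P : forall z, W0 z -> (W1 z <-> isunit (X0 z)).
Hypothesis X01 : forall z, W0 z -> W1 z -> X0 z * X1 z = 1.
Hypothesis T01 : forall z c, W0 z -> W1 z -> Tb0 (f0 c%:P) z = Tb1 (f1 c%:P) z.
Hypothesis t01 : forall z, W0 z -> W1 z -> t0 z = X0 z ^+ r * t1 z.
Hypothesis t0X : forall z, W0 z -> ~ isunit (X0 z) ->
  exists2 u, isunit u & t0 z ^+ l = u * X0 z.

Let X0_reg z : W0 z -> reg z X0. Proof. exact: (spec_reg hW0). Qed.
Let t0_reg z : W0 z -> reg z t0. Proof. exact: (spec_reg hW0). Qed.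

Lemma cyc_coordE (a : 'I_l -> {poly A}) (b : B0) :
  b = \sum_(i < l) f0 (a i) * tt0 ^+ i ->
  forall a' : 'I_l -> {poly A}, b = \sum_(i < l) f0 (a' i) * tt0 ^+ i -> a =1 a'.
Proof.
move=> e a' e' i; have [c [_ uc]] := basis0 b.
have ec : c = [ffun i => a i] by apply: uc; rewrite e; apply: eq_bigr => j _; rewrite ffunE.
have ec' : c = [ffun i => a' i] by apply: uc; rewrite e'; apply: eq_bigr => j _; rewrite ffunE.
by have := congr1 (fun g : {ffun 'I_l -> {poly A}} => g i)
  (etrans (esym ec) ec'); rewrite !ffunE.
Qed.

(** In the basis of powers of [tt0], x multiplies each coordinate by the variable, which is
    injective on polynomials. *)
Lemma cyc_X_regular b : f0 'X * b = 0 -> b = 0.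
Proof.
move=> e; have [a [ea _]] := basis0 b.
have /cyc_coordE H : 0 = \sum_(i < l) f0 ('X * a i) * tt0 ^+ i.
  rewrite -[LHS]e [in LHS]ea mulr_sumr; apply: eq_bigr => i _.
  by rewrite rmorphM mulrA.
rewrite ea big1// => i _; have /H/(_ i) : 0 =
    \sum_(i < l) f0 ((fun=> 0) i : {poly A}) * tt0 ^+ i.
  by rewrite big1// => j _; rewrite rmorph0 mul0r.
move=> ai; suff -> : a i = 0 by rewrite rmorph0 mul0r.
apply/polyP => j; have := congr1 (fun q : {poly A} => q`_j.+1) ai.
by rewrite coefXM /= !coef0.
Qed.

Lemma cyc_X_regular_stalk z (a : st z) : W0 z -> X0 z * a = 0 -> a = 0.
Proof.
move=> Wz e; have [b [s [us es]]] := spec_frac hW0 a Wz.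
apply: (isunit_regl us); rewrite mulrC es.
have [s' us' e'] : exists2 s', isunit (Tb0 s' z) & s' * (f0 'X * b) = 0.
  by apply: (spec_tors hW0 Wz); rewrite (specM hW0)// -es mulrA -/(X0 z) e mul0r.
have sb : s' * b = 0 by apply: cyc_X_regular; rewrite mulrCA e'.
by apply: (isunit_regl us'); rewrite -(specM hW0)// sb (spec0 hW0).
Qed.

(** Multiples of x and of t0 have no constant term in their coordinate at t0^0: what wraps around
    through t0^l = s0 vanishes at x = 0. With [cyc_decomp], this identifies A with the quotient of
    [B0] by (x, t0). *)
Lemma cyc_const al b' b'' : f0 al%:P = f0 'X * b' + tt0 * b'' -> al = 0.
Proof.
move=> e; have [a' [ea' _]] := basis0 b'; have [a'' [ea'' _]] := basis0 b''.
have h1 : f0 al%:P =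
    \sum_(i < l) f0 ((fun i : 'I_l => if i == ord0 then al%:P else 0) i) * tt0 ^+ i.
  rewrite big_ord_recl eqxx expr0 mulr1 big1 ?addr0// => i _.
  by rewrite rmorph0 mul0r.
(* Multiplication by [tt0] shifts the coordinates by one; the last one returns to index 0 multiplied
   by [s0]. *)
have h2 : f0 al%:P = \sum_(i < l) f0 ((fun i : 'I_l => 'X * a' i +
    (if i == ord0 then a'' ord_max * s0 else a'' (inord i.-1))) i) * tt0 ^+ i.
  under eq_bigr do rewrite rmorphD mulrDl; rewrite big_split e; congr (_ + _).
    rewrite [in LHS]ea' mulr_sumr; apply: eq_bigr => i _.
    by rewrite rmorphM mulrA.
  rewrite [in LHS]ea'' mulr_sumr big_ord_recr big_ord_recl /= addrC; congr (_ + _).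
    by rewrite mulrCA -exprS tt0l expr0 mulr1 rmorphM.
  apply: eq_bigr => i _; rewrite mulrCA -exprS; congr (f0 (a'' _) * _).
  by apply: val_inj; rewrite /= add0n inordK// ltnS ltnW.
have := congr1 (fun q : {poly A} => q`_0) (cyc_coordE h1 h2 ord0).
by rewrite eqxx coefC eqxx coefD coefXM add0r coef0M s00 mulr0.
Qed.

Lemma cyc_decomp b : exists al b' b'', b = f0 al%:P + f0 'X * b' + tt0 * b''.
Proof.
have [a [ea _]] := basis0 b; rewrite big_ord_recl expr0 mulr1 in ea.
have [q [c eq]] : exists q c, a ord0 = q * 'X + c%:P.
  by elim/poly_ind: (a ord0) => [|q c _];
    [exists 0, 0; rewrite mul0r polyC0 addr0 | exists q, c].
exists c, (f0 q), (\sum_(i < l') f0 (a (lift ord0 i)) * tt0 ^+ i).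
rewrite ea eq rmorphD rmorphM mulr_sumr; congr (_ + _); first by ring.
by apply: eq_bigr => i _; rewrite /= /bump /= exprS; ring.
Qed.

Lemma cyc_t0_nonunit z : W0 z -> ~ isunit (X0 z) -> ~ isunit (t0 z).
Proof.
move=> Wz nX; have [u uu e] := t0X Wz nX => ut; apply: nX.
by have := isunitX l ut; rewrite e => /isunitM[].
Qed.

(* Write f = b / s with b = al + x b' + t0 b'' and al in A: every prime of B0 containing
   x contains s1 al for some s1 not vanishing at z, which forces al = 0. *)
Lemma cyc_reduced z (f : forall x : X, st x) : W0 z -> ~ isunit (X0 z) -> reg z f ->
  (\forall y \near z, W0 y -> ~ isunit (X0 y) -> ~ isunit (f y)) ->
  exists c, f z = c * t0 z.
Proof.
move=> Wz nX hf hn.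
have [b [s [us es]]] := spec_frac hW0 (f z) Wz.
have es' : \forall y \near z, f y * Tb0 s y = Tb0 b y.
  by apply: reg_eq => //; [apply: regM => //|]; exact: (spec_reg hW0).
have [s1 us1 H1] := spec_basis hW0 Wz (filterI es' hn).
have [al [b' [b'' eb]]] := cyc_decomp b.
have [ga [c' [c'' ec]]] := cyc_decomp s1.
have [||N [d ed]] := @ideal_power B0 (fun x => exists d, x = f0 'X * d) (s1 * f0 al%:P).
- split; first by exists 0; ring.
    by move=> _ _ [d ->] [d' ->]; exists (d + d'); ring.
  by move=> x _ [d ->]; exists (x * d); ring.
- move=> I pI XI; have [I0 ID IM I1 IP] := pI.
  have [y Wy ey] := spec_point hW0 pI.
  have nXy : ~ isunit (X0 y) by apply/ey/XI; exists 1; rewrite mulr1.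
  have [Is1|nIs1] := pselect (I s1); first by rewrite mulrC; exact: IM.
  have us1y : isunit (Tb0 s1 y) by apply: contrapT => /ey.
  have [e1 nf] := H1 y Wy us1y.
  have nb : ~ isunit (Tb0 b y) by rewrite -e1 => /isunitM[uf _]; exact: (nf Wy nXy uf).
  apply: (IM); apply/ey => ual; apply: nb; apply: contrapT => nb.
  have : Tb0 (f0 al%:P) y = Tb0 b y + - (X0 y * Tb0 b' y + t0 y * Tb0 b'' y).
    rewrite eb !(specD hW0)// !(specM hW0)//; rewrite /X0 /t0; ring.
  move=> e2; move: ual; rewrite e2 => /isunitD[//|[c ec']].
  have : isunit (X0 y * Tb0 b' y + t0 y * Tb0 b'' y) by exists (- c); rewrite -ec'; ring.
  move=> /isunitD[/isunitM[]//|/isunitM[ut _]].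
  exact: (cyc_t0_nonunit Wy nXy).
have [c1 [c2 ec1]] : exists c1 c2, s1 ^+ N = f0 (ga ^+ N)%:P + f0 'X * c1 + tt0 * c2.
  elim: (N) => [|M [c1 [c2 IH]]]; first by
    exists 0, 0; rewrite !expr0 polyC1 rmorph1 !mulr0 !addr0.
  exists (c1 * s1 + f0 (ga ^+ M)%:P * c'), (c2 * s1 + f0 (ga ^+ M)%:P * c'').
  by rewrite exprSr IH ec exprSr polyCM rmorphM; ring.
(* x divides (s1 al)^N, and s1^N is ga^N modulo (x, t0); hence (ga al)^N lies in (x, t0), and
   [cyc_const] applies. *)
have gaN : (ga * al) ^+ N = 0.
  apply: (@cyc_const _ (d - c1 * f0 (al ^+ N)%:P) (- (c2 * f0 (al ^+ N)%:P))).
  move: ed; rewrite exprMn -rmorphXn -polyC_exp ec1 => ed.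
  rewrite exprMn polyCM rmorphM; apply/eqP; rewrite -subr_eq0; apply/eqP.
  rewrite mulrBr -ed; ring.
have al0 : al = 0.
  have : (ga * al) ^+ N = 0 -> ga * al = 0.
    elim: (N) => [|M IH]; first by rewrite expr0 => /eqP; rewrite oner_eq0.
    by rewrite exprS => /domA[].
  move=> /(_ gaN) /domA[g0|//]; exfalso; move: us1; rewrite ec g0 polyC0 rmorph0 add0r.
  rewrite (specD hW0)// !(specM hW0)// => /isunitD[/isunitM[/nX//]|/isunitM[ut _]].
  exact: (cyc_t0_nonunit Wz nX ut).
(* With al = 0 the numerator of f is x b' + t0 b'', and x is a unit times t0^l. *)
have [u [u' eu] et] := t0X Wz nX.
have eX : X0 z = u' * t0 z ^+ l by rewrite et mulrA eu mul1r.
have [s' es1] := us.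
exists (s' * (u' * t0 z ^+ l' * Tb0 b' z + Tb0 b'' z)).
have -> : f z = s' * Tb0 b z by rewrite -es mulrCA es1 mulr1.
rewrite eb al0 polyC0 rmorph0 add0r (specD hW0)// !(specM hW0)//.
rewrite -/(X0 z) -/(t0 z) eX /l exprS; ring.
Qed.

(** * Splitting sections of the twist on the overlap of the charts *)

Section Twist.
Variables (Et : set X) (OE N Z Zn : modsheaf X) (n p : nat).
Hypothesis EtP : forall z, (W0 `|` W1) z -> (Et z <-> ~ W1 z).
Variable uO : forall x, OE x.
Hypothesis uO_cont : forall x, mcont x uO.
Hypothesis uO_div : forall x, exists g a, [/\ isgen g, uO x = a *: g,
    (forall b, b * a = 0 -> b = 0) &
    forall b, reduced_ideal Et b <-> exists c, b = c * a].
Variables (nuX : forall x, N x) (bZ : forall x, OE x -> N x -> Z x).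
Hypothesis hbZ : tensor_by bZ.
Hypothesis nuX_cont : forall x, (W0 `|` W1) x -> mcont x nuX.
Hypothesis nuX_gen : forall x, (W0 `|` W1) x -> isgen (nuX x).
Variable pw : forall x, Z x -> Zn x.
Hypothesis pw_cont : forall x s, mcont x s -> mcont x (fun y => pw (s y)).
Hypothesis pwZ : forall x a (m : Z x), pw (a *: m) = a ^+ n *: pw m.
Hypothesis pw_gen : forall x (m : Z x), isgen m -> isgen (pw m).
Hypothesis invZn : invertible Zn.
Hypothesis lr : (l * r = p.+1)%N.
Hypothesis bound : (l' * p <= n + l)%N.

Let zn z := pw (bZ (uO z) (nuX z)).

Let zn_cont z : (W0 `|` W1) z -> mcont z zn.
Proof.
by move=> Wz; apply: pw_cont; apply: (tensor_cont hbZ); [exact: uO_cont | exact: nuX_cont].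
Qed.

(** A local equation of the divisor vanishes on its support, hence is a multiple of t0 by
    [cyc_reduced]. *)
Let uO_near z : W0 z -> ~ isunit (X0 z) ->
  exists2 w, mcont z w & \forall y \near z, uO y = t0 y *: w y.
Proof.
move=> Wz nX; have [g [a [gg eu _ ra]]] := uO_div z.
have [f [hf ef hn]] : reduced_ideal Et a by apply/ra; exists 1; rewrite mul1r.
have [c ec] : exists c, f z = c * t0 z.
  apply: cyc_reduced => //; apply: filterS hn => y hE Wy nXy; apply: hE.
  by apply/EtP; [left | move/(W1P Wy)].
have [w hw wz] := mcont_germ (c *: g).
exists w => //; apply: mcont_eq; first exact: uO_cont.
  by apply: mcontZ => //; exact: t0_reg.
by rewrite wz scalerA [t0 z * c]mulrC -ec ef.
Qed.

Let zn_near z : W0 z -> ~ isunit (X0 z) ->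
  exists2 w, mcont z w & \forall y \near z, zn y = t0 y ^+ n *: w y.
Proof.
move=> Wz nX; have [w hw e] := uO_near Wz nX.
exists (fun y => pw (bZ (w y) (nuX y))).
  by apply: pw_cont; apply: (tensor_cont hbZ) => //; apply: nuX_cont; left.
apply: filterS e => y e.
by rewrite /zn e (bilinZl (tensor_bilin hbZ y)) pwZ.
Qed.

Let zn_gen z : W1 z -> isgen (zn z).
Proof.
move=> Wz; apply: pw_gen; apply/(tensor_gen hbZ (nuX_gen (or_intror Wz))).
have [g [a [gg -> _ ra]]] := uO_div z; apply: isgen_unit => //.
have [c e] : exists c, 1 = c * a.
  apply/ra; exists (fun=> 1); split=> //; first exact: reg1.
  apply: filterS (openP (spec_open hW1) Wz) => y Wy.
  by move/(EtP (or_intror Wy)).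
by exists c.
Qed.

Let scale_X_inj z m (v w : Zn z) : W0 z -> X0 z ^+ m *: v = X0 z ^+ m *: w -> v = w.
Proof.
move=> Wz; have [s _ gs] := invZn z.
have [a [-> _]] := nbhs_singleton gs v; have [b [-> _]] := nbhs_singleton gs w.
rewrite !scalerA => /(isgen_inj (nbhs_singleton gs)) e; congr (_ *: _).
elim: m e => [|m IH]; first by rewrite !expr0 !mul1r.
rewrite !exprS -!mulrA => /eqP; rewrite -subr_eq0 -mulrBr => /eqP.
by move=> /(cyc_X_regular_stalk Wz) /eqP; rewrite subr_eq0 => /eqP /IH.
Qed.

Let X0_inv z : W0 z -> isunit (X0 z) -> reg z (fun y => uinv (X0 y)) /\
  \forall y \near z, W0 y /\ isunit (X0 y).
Proof.
move=> Wz uz; have [h1 h2] := reg_uinv (X0_reg Wz) uz; split=> //.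
by apply: filterI h2; exact: openP (spec_open hW0) Wz.
Qed.

(** Where x is invertible one divides by x^M; elsewhere x is a unit times t0^l, and the factor t0^(i
    + n) absorbs the remaining pole. By [scale_X_inj] the local quotients are unique, so they
    glue. *)
Let extend0 c K i M : (M < K + i * r)%N -> (i < l)%N ->
  exists2 g : forall x, Zn x, msec W0 g & forall z, W0 z ->
    X0 z ^+ M *: g z = Tb0 (f0 c%:P * f0 'X ^+ K * tt0 ^+ i) z *: zn z.
Proof.
move=> MK il.
set C := fun z => Tb0 (f0 c%:P * f0 'X ^+ K * tt0 ^+ i) z.
have hC z : W0 z -> reg z C by exact: (spec_reg hW0).
have znc z : W0 z -> mcont z zn by move=> Wz; apply: zn_cont; left.
have loc z : W0 z -> exists2 g : forall x, Zn x, mcont z g &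
    \forall y \near z, X0 y ^+ M *: g y = C y *: zn y.
  move=> Wz; have [uX|nX] := pselect (isunit (X0 z)).
    have [h1 h2] := X0_inv Wz uX.
    exists (fun y => (uinv (X0 y) ^+ M * C y) *: zn y).
      by apply: mcontZ; [apply: regM; [exact: regX | exact: hC] | exact: znc].
    apply: filterS h2 => y [Wy uy].
    rewrite scalerA mulrA [X0 y ^+ M * _]mulrC -exprMn uinvP// expr1n mul1r.
    by [].
  have CE y : W0 y -> C y = Tb0 (f0 c%:P) y * X0 y ^+ K * t0 y ^+ i.
    by move=> Wy; rewrite /C !(specM hW0)// !(specX hW0).
  have [MleK|KltM] := leqP M K.
    exists (fun y => (Tb0 (f0 c%:P) y * X0 y ^+ (K - M) * t0 y ^+ i) *: zn y).
      apply: mcontZ; last exact: znc.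
      by do 2?[apply: regM]; [exact: (spec_reg hW0) |
        apply: regX; exact: X0_reg | apply: regX; exact: t0_reg].
    apply: filterS (openP (spec_open hW0) Wz) => y Wy.
    rewrite scalerA CE//; congr (_ *: _).
    by rewrite -[in RHS](subnKC MleK) exprD; ring.
  have [w hw ew] := zn_near Wz nX.
  have [u _ eu] := t0X Wz nX.
  have [u' hu' eu'] := reg_germ u.
  have eu2 : \forall y \near z, t0 y ^+ l = u' y * X0 y.
    apply: reg_eq; [by apply: regX; exact: t0_reg | | by rewrite eu'].
    by apply: regM => //; exact: X0_reg.
  pose dd := (M - K)%N.
  (* From dd + 1 <= i r, multiplying by l and using l r = p + 1 and i <= l - 1: l + l dd <= i p + i
     <= (l - 1) p + i, and [bound] concludes. *)
  have ldd : (l * dd <= i + n)%N.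
    have : (dd.+1 <= i * r)%N by rewrite /dd; lia.
    move=> /(leq_mul (leqnn l)); rewrite mulnCA lr => h1.
    have : (i * p <= l' * p)%N by rewrite leq_mul2r -ltnS il orbT.
    move=> h2; rewrite mulnS mulnS in h1; move: il bound; rewrite /l in h1 *; lia.
  exists (fun y => (Tb0 (f0 c%:P) y * u' y ^+ dd * t0 y ^+ (i + n - l * dd)) *: w y).
    apply: mcontZ => //.
    by do 2?[apply: regM]; [exact: (spec_reg hW0) | apply: regX | apply: regX; exact: t0_reg].
  apply: filterS2 (filterI ew eu2) (openP (spec_open hW0) Wz) => y [e1 e2] Wy.
  rewrite e1 !scalerA CE//; congr (_ *: _).
  transitivity (Tb0 (f0 c%:P) y * X0 y ^+ K * (u' y * X0 y) ^+ dd * t0 y ^+ (i + n - l * dd)).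
    by rewrite exprMn -[in LHS](subnKC (ltnW KltM)) exprD; ring.
  rewrite -e2 -exprM -!mulrA -[in RHS]exprD -exprD; congr (_ * (_ * _ ^+ _)).
  by rewrite subnKC.
have /dep_choice[g gE] : forall z, exists v : Zn z, W0 z -> X0 z ^+ M *: v = C z *: zn z.
  move=> z; have [Wz|nW] := pselect (W0 z); last by exists 0.
  by have [g _ /nbhs_singleton e] := loc z Wz; exists (g z).
exists g => // z Wz; have [g' hg' e] := loc z Wz.
apply: (mcont_cong _ hg'); apply: filterS2 e (openP (spec_open hW0) Wz) => y e Wy.
by apply: (scale_X_inj (m := M) Wy); rewrite e gE.
Qed.

(** The pole order [M] is kept fixed, so that the property is additive in [b] and monomials
    suffice. *)
Let splits M (b : B0) := exists g h : forall x, Zn x, [/\ msec W0 g, msec W1 h &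
  forall z, W0 z -> W1 z -> (Tb0 b z * uinv (X0 z) ^+ M) *: zn z = g z + h z].

Let splits0 M : splits M 0.
Proof.
exists (fun=> 0), (fun=> 0); split=> z Wz; [exact: mcont0 | exact: mcont0 |].
by move=> _; rewrite (spec0 hW0)// mul0r scale0r addr0.
Qed.

Let splitsD M b b' : splits M b -> splits M b' -> splits M (b + b').
Proof.
move=> [g [h [hg hh e]]] [g' [h' [hg' hh' e']]].
exists (fun z => g z + g' z), (fun z => h z + h' z); split=> z Wz.
- by apply: mcontD; [exact: hg | exact: hg'].
- by apply: mcontD; [exact: hh | exact: hh'].
by move=> Wz'; rewrite (specD hW0)// mulrDl scalerDl e// e'// addrACA.
Qed.

Let splits_monomial M c K i : (i < l)%N -> splits M (f0 c%:P * f0 'X ^+ K * tt0 ^+ i).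
Proof.
move=> il; have [KM|MK] := leqP (K + i * r) M; last first.
  have [g hg e] := extend0 c MK il.
  exists g, (fun=> 0); split=> // z Wz; first exact: mcont0.
  move=> W1z; rewrite addr0 [_ * uinv _ ^+ _]mulrC -scalerA -e// scalerA -exprMn.
  by rewrite uinvP ?expr1n ?scale1r//; exact/(W1P Wz).
(* On the overlap x = 1 / x1 and t0 = x^r t1, so the term becomes c x1^(M - K - i r) t1^i. *)
exists (fun=> 0), (fun z => Tb1 (f1 c%:P * f1 'X ^+ (M - (K + i * r)) * tt1 ^+ i) z *: zn z).
split=> z Wz; first exact: mcont0.
  by apply: mcontZ; [exact: (spec_reg hW1) | apply: zn_cont; right].
move=> W1z; rewrite add0r; congr (_ *: _).
have e01 := X01 Wz W1z.
have -> : uinv (X0 z) = X1 z by apply: uinvE; rewrite mulrC.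
rewrite !(specM hW0)// !(specX hW0)// !(specM hW1)// !(specX hW1)// T01//.
rewrite -/(X0 z) -/(t0 z) t01// -/(X1 z) -/(t1 z).
rewrite -[in LHS](subnKC KM) exprD exprMn -exprM [(r * i)%N]mulnC exprD.
transitivity (Tb1 (f1 c%:P) z * (X0 z * X1 z) ^+ K * (X0 z * X1 z) ^+ (i * r) *
  X1 z ^+ (M - (K + i * r)) * t1 z ^+ i).
  by rewrite !exprMn; ring.
by rewrite e01 !expr1n !mulr1.
Qed.

Let splits_sum M (I : finType) (F : I -> B0) :
  (forall i, splits M (F i)) -> splits M (\sum_i F i).
Proof.
by move=> H; apply: (big_ind (splits M)); [exact: splits0 | exact: splitsD |].
Qed.

Let splits_all M b : splits M b.
Proof.
have [a [-> _]] := basis0 b; apply: splits_sum => i.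
rewrite -[a i]coefK poly_def rmorph_sum mulr_suml; apply: splits_sum => j.
by rewrite -mul_polyC rmorphM rmorphXn; exact: splits_monomial.
Qed.

(** The canonical section generates on W1, and the overlap is D(x) in W0; the coefficient of [f] is
    therefore b / x^M for some b and M. *)
Lemma cyc_split (f : forall x, Zn x) : msec (W0 `&` W1) f ->
  exists g h : forall x, Zn x, [/\ msec W0 g, msec W1 h &
    forall x, W0 x -> W1 x -> f x = g x + h x].
Proof.
move=> hf; have oW : open (W0 `&` W1).
  by apply: openI; [exact: (spec_open hW0) | exact: (spec_open hW1)].
have /dep_choice[be beE] : forall y, exists c : st y, W1 y -> f y = c *: zn y.
  move=> y; have [Wy|nW] := pselect (W1 y); last by exists 0.
  by have [c [e _]] := zn_gen Wy (f y); exists c.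
have [x [Wx ux]|M [b e]] := @spec_section _ _ _ _ hW0 be (f0 'X).
  have Wx1 : W1 x by exact/(W1P Wx).
  have n1 := openP (spec_open hW1) Wx1.
  have [|c hc ec] := isgen_coef (hf x (conj Wx Wx1)) (zn_cont (or_introl Wx)).
    by apply: filterS n1 => y; exact: zn_gen.
  apply: (reg_cong _ hc); apply: filterS2 ec n1 => y ey Wy.
  by apply: (isgen_inj (zn_gen Wy)); rewrite -ey beE.
have [g [h [hg hh egh]]] := splits_all M b.
exists g, h; split=> // z Wz W1z; have uz : isunit (X0 z) by exact/(W1P Wz).
rewrite beE// -egh// -e//; congr (_ *: _).
rewrite mulrC mulrA -exprMn uinvP// expr1n mul1r; done.
Qed.

Section Cohomology.
Variables (I : nat -> absheaf X) (eps : forall x, Zn x -> I 0%N x).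
Variable d : forall n x, I n x -> I n.+1 x.
Hypothesis res : @injective_resolution X (ab_of Zn) I eps d.

Lemma cyc_H1_zero : H1_zero_on d (W0 `|` W1).
Proof.
move=> s hs ds.
have H0 : H1_zero_on d W0 by rewrite -(Dset1 hW0); exact: (spec_H1_zero hW0 invZn res).
have H1 : H1_zero_on d W1 by rewrite -(Dset1 hW1); exact: (spec_H1_zero hW1 invZn res).
apply: (mayer_vietoris1 res); [exact: (spec_open hW0) | exact: (spec_open hW1) | | |].
- by apply: H0 => x Wx; [apply: hs | apply: ds]; left.
- by apply: H1 => x Wx; [apply: hs | apply: ds]; right.
exact: cyc_split.
Qed.

Lemma cyc_H2_zero (s : forall x, I 2%N x) : csec (W0 `|` W1) s ->
  (forall x, (W0 `|` W1) x -> d (s x) = 0) -> exact_on (@d 1%N) s (W0 `|` W1).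
Proof.
move=> hs ds.
apply: (mayer_vietoris2 res); [exact: (spec_open hW0) | exact: (spec_open hW1) | | |].
- by apply: (spec_H2_zero hW0 invZn res) => x Wx; [apply: hs | apply: ds]; left.
- by apply: (spec_H2_zero hW1 invZn res) => x Wx; [apply: hs | apply: ds]; right.
have -> : W0 `&` W1 = Dset W0 Tb0 (f0 'X).
  by apply/seteqP; split=> x [Wx h]; split=> //; exact/(W1P Wx).
exact: (spec_H1_zero hW0 invZn res).
Qed.

End Cohomology.
End Twist.
End CyclicCharts.

(** * Generalized Raynaud surfaces *)

Section ModHom.
Local Open Scope ring_scope.
Variables (X : lrs) (A B : modsheaf X) (f : forall x, A x -> B x).
Hypothesis hf : mod_hom f.

Lemma mod_hom0 x : f (0 : A x) = 0.
Proof.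
by have := (proj1 hf) x 1 0 0; rewrite !scale1r addr0 => /eq_addrr.
Qed.

Lemma mod_homZ x a (v : A x) : f (a *: v) = a *: f v.
Proof. by rewrite -[a *: v]addr0 (proj1 hf) mod_hom0 addr0. Qed.

Lemma mod_homD x (v w : A x) : f (v + w) = f v + f w.
Proof. by rewrite -[v]scale1r (proj1 hf) !scale1r. Qed.

Lemma mod_hom_cont x (s : forall x, A x) : mcont x s -> mcont x (fun y => f (s y)).
Proof. exact: (proj2 hf). Qed.

End ModHom.

(** * Local frames of the bundles on the curve *)

Section Frame.
Local Open Scope classical_set_scope.
Local Open Scope ring_scope.
Variables (k : fieldType) (p : nat) (hp : p \in [pchar k]) (C : curve k) (W : kahler C).
Variables (T : pre_tango p W) (e l : nat) (S : raynaud hp T e l).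

Definition ri1 (x : C) : rE S x := ri S (1 : st x).

Lemma ri_hom : @mod_hom C (OO C) (rE S) (fun x => ri S (x := x)).
Proof. by case: (rE_ext S). Qed.

Lemma rj_hom : mod_hom (@rj _ _ _ _ _ _ _ _ S).
Proof. by case: (rE_ext S). Qed.

Lemma ri_ri1 x a : ri S a = a *: ri1 x.
Proof. by rewrite /ri1 -(mod_homZ ri_hom) [_ *: _]mulr1. Qed.

Lemma ri1_cont x : mcont x ri1.
Proof. by apply: (mod_hom_cont ri_hom (s := fun y => 1 : st y)); exact: reg1. Qed.

Lemma rj_ri1 x : rj (ri1 x) = 0.
Proof. by case: (rE_ext S) => _ _ _ h _; apply/h; exists 1. Qed.

Lemma rNl_invertible : invertible (rNl S).
Proof.
apply: (tpow_invertible (rNl_pow S)).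
by have [A [iota [[]]]] := rN_ample S.
Qed.

(** The trivialisations needed over [U]: [e0] and the image of 1 give the coordinate of P, [v']
    carries it over to P', and [nu] trivialises N_l, for M as well as for the polarization. *)
Definition frame (U : set C) (la : forall x, ptL T x) (e0 : forall x, rE S x)
    (v' : forall x, rLmp S x) (nu : forall x, rNl S x) : Prop :=
  forall x, U x -> [/\ [/\ mcont x e0, mcont x v' & mcont x nu],
    [/\ isgen (la x), isgen (v' x) & isgen (nu x)],
    isbasis2 (e0 x) (ri1 x), rj (e0 x) = la x & rdual (ruL S (la x)) (v' x) = 1].

Lemma frame_exists (c : C) (Wc : set C) : nbhs c Wc ->
  exists U (A : comNzRingType) (th : A -> forall x : C, st x) la e0 v' nu,
    [/\ isSpec U th, U c, U `<=` Wc & frame U la e0 v' nu].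
Proof.
move=> nW.
have [_ _ surj ker _] := rE_ext S.
have [la hla gla] : exists2 s : (forall x, ptL T x), mcont c s &
    \forall y \near c, isgen (s y) by case: (ptL_OD T) => H _ _ _; exact: H.
have [f0 ef0] := (proj2 (surj c)) (la c).
have [e0 he0 e0c] := mcont_germ f0.
have je0 : \forall y \near c, rj (e0 y) = la y.
  apply: mcont_eq => //; first exact: (mod_hom_cont rj_hom).
  by rewrite e0c.
(* The coefficient of [e0] is read off in L through [rj]; exactness gives that of [ri1]. *)
have bas : \forall y \near c, isbasis2 (e0 y) (ri1 y).
  apply: filterS2 je0 gla => y ej gl v.
  have [b [eb ub]] := gl (rj v).
  have [a ea] : exists a, v - b *: e0 y = ri S a.
    apply/ker; rewrite -scaleN1r addrC (proj1 rj_hom) (mod_homZ rj_hom) ej -eb.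
    by rewrite scaleN1r addNr.
  exists (b, a) => /=; split=> [|[b' a'] /= e'].
    by rewrite -ri_ri1 -ea addrC subrK.
  have eb' : b = b'.
    apply: ub; rewrite e' (mod_homD rj_hom) !(mod_homZ rj_hom) rj_ri1 scaler0 addr0.
    by rewrite ej.
  congr (_, _) => //; apply: (proj1 (surj y)); rewrite -ea e' eb' addrC addKr.
  by rewrite ri_ri1.
have hd := rdual_tensor S; have hd' := tensor_flip hd.
have gLp y : isgen (la y) -> isgen (ruL S (la y)).
  exact: (pullback_gen (rLp_pullback S)).
have /dep_choice[v' v'E] : forall y, exists v : rLmp S y,
    isgen (la y) -> rdual (ruL S (la y)) v = 1.
  move=> y; have [gl|ng] := pselect (isgen (la y)); last by exists 0.
  by have [v ev] := tensor_surj hd' (gLp y gl) (1 : st y); exists v.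
have gv' y : isgen (la y) -> isgen (v' y).
  move=> gl; apply/(tensor_gen hd' (gLp y gl)) => /=; rewrite v'E//.
  apply: isgenP => [a|a]; first by exists a; rewrite [_ *: _]mulr1.
  by rewrite [_ *: _]mulr1.
(* [v'] was chosen stalk by stalk; its pairing with a generator is the section 1, which makes it a
   section. *)
have hv' : mcont c v'.
  apply: (tensor_div_cont hd' (g := fun y => ruL S (la y))).
  - exact: (pullback_cont (rLp_pullback S) (x := c)).
  - by apply: filterS gla => y; exact: gLp.
  apply: (@mcont_cong C (OO C) c (fun y => 1 : st y)); last exact: reg1.
  by apply: filterS gla => y gl; rewrite v'E.
have [nu hnu gnu] := rNl_invertible c.
have H : nbhs c [set x | Wc x /\ [/\ [/\ mcont x e0, mcont x v' & mcont x nu],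
    [/\ isgen (la x), isgen (v' x) & isgen (nu x)],
    isbasis2 (e0 x) (ri1 x), rj (e0 x) = la x & rdual (ruL S (la x)) (v' x) = 1]].
  apply: filterS2 (filterI (filterI (filterI (mcont_near he0) (mcont_near hv'))
    (mcont_near hnu)) nW) (filterI (filterI gla gnu) (filterI bas je0)).
  move=> y [[[c1 c2] c3] wy] [[g1 g2] [b1 j1]]; split=> //; split=> //.
    by split=> //; exact: gv'.
  exact: v'E.
have [U [A [th [hU Uc sU]]]] := curve_affine_nbhd H.
exists U, A, th, la, e0, v', nu; split=> // x /sU[] //.
Qed.

End Frame.

(** * The two charts of the surface over an affine open of the curve *)

Section RaynaudLocal.
Local Open Scope classical_set_scope.
Local Open Scope ring_scope.
Variables (k : fieldType) (p : nat) (hp : p \in [pchar k]) (C : curve k) (W : kahler C).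
Variables (T : pre_tango p W) (e l' : nat).
Local Notation l := l'.+1.
Variable S : raynaud hp T e l.
Variables (U : set C) (A : comNzRingType) (th : A -> forall x : C, st x).
Variables (la : forall x, ptL T x) (e0 : forall x, rE S x).
Variables (v' : forall x, rLmp S x) (nu : forall x, rNl S x).
Hypotheses (hU : isSpec U th) (hF : frame U la e0 v' nu).

Let V (ee : forall x, rE S x) : set (rP S) :=
  [set y | U (rpi S y) /\ isgen (rq (ee (rpi S y)))].

Let q0 (y : rP S) := rq (e0 (rpi S y)).
Let q1 (y : rP S) := rq (ri1 S (rpi S y)).

Let invO1 : invertible (rO1 S). Proof. by case: (rP_bundle S). Qed.

Let q_cont y s : mcont (rpi S y) s -> mcont y (fun z => rq (s (rpi S z))).
Proof. by case: (rP_bundle S) => _ H _ _ _; exact: H. Qed.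

Let q_semi (y : rP S) a (u v : rE S (rpi S y)) :
  rq (a *: u + v) = sharp (rpi S) y a *: rq u + rq v.
Proof. by case: (rP_bundle S) => _ _ H _ _; exact: H. Qed.

Let e0_cont x : U x -> mcont x e0. Proof. by move=> /hF[[]]. Qed.

Let basis01 x : U x -> [/\ mcont x e0, mcont x (ri1 S) & isbasis2 (e0 x) (ri1 S x)].
Proof. by move=> /hF[[h1 _ _] _ h3 _ _]; split=> //; exact: ri1_cont. Qed.

Let basis10 x : U x -> [/\ mcont x (ri1 S), mcont x e0 & isbasis2 (ri1 S x) (e0 x)].
Proof.
move=> /basis01[h1 h2 h3]; split=> // v.
have [[a b] [/= ev uv]] := h3 v; exists (b, a) => /=; split=> [|[b' a'] /= e'].
  by rewrite addrC.
by have := uv (a', b'); rewrite /= addrC => /(_ e')[-> ->].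
Qed.

Let A_domain : U (gpt C) -> forall a b : A, a * b = 0 -> a = 0 \/ b = 0.
Proof.
move=> Ug a b ab; have : th a (gpt C) * th b (gpt C) = 0.
  by rewrite -(specM hU)// ab (spec0 hU).
by move=> /crv_domain[]/(chart_gpt_inj hU Ug); [left|right].
Qed.

(** Some element of the fibre of the rank 2 bundle generates O(1) at [y]. Expanded in the basis, its
    coefficient is a sum that is a unit in a local ring, so one of the two terms is a unit. *)
Lemma bundle_cover y : U (rpi S y) -> V e0 y \/ V (ri1 S) y.
Proof.
move=> Uy; have [_ _ ba _ _] := hF Uy.
have [v gv] : exists v : rE S (rpi S y), isgen (rq v).
  by case: (rP_bundle S) => _ _ _ H _; exact: H.
have [[a b] [/= ev _]] := ba v.
have [s _ /nbhs_singleton gs] := invO1 y.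
have [a0 [ea0 _]] := gs (q0 y); have [a1 [ea1 _]] := gs (q1 y).
have [c [ec _]] := gs (rq v).
have hq1 : rq (b *: ri1 S (rpi S y)) = sharp (rpi S) y b *: q1 y.
  have z0 : rq (0 : rE S (rpi S y)) = 0.
    by have := q_semi 1 (0 : rE S (rpi S y)) 0; rewrite rmorph1 !scale1r addr0 => /eq_addrr.
  by rewrite -[b *: _]addr0 q_semi z0 addr0.
have : isunit c by apply: (isgen_scale gs); rewrite -ec.
have -> : c = sharp (rpi S) y a * a0 + sharp (rpi S) y b * a1.
  apply: (isgen_inj gs); rewrite -ec ev q_semi hq1 -/(q0 y) ea0 ea1.
  by rewrite scalerDl !scalerA.
move=> /isunitD[] /isunitM[_ u]; [left|right]; split=> //.
  by rewrite -/(q0 y) ea0; exact: isgen_unit.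
by rewrite -/(q1 y) ea1; exact: isgen_unit.
Qed.

(* On V e0, where s = a e0, the section of M^-l defining E + C'' is, up to a unit,
   a (1 + c a^p). *)
Lemma rsigmaE y (m : rM S y) a : V e0 y -> isgen m -> q1 y = a *: q0 y ->
  exists u w, [/\ rsigma m = u * (a * w), isunit u & (~ isunit a -> isunit w)].
Proof.
move=> [Uy gq] gm ea.
have [r1 _ r3] := rfr_relfrob S.
have [[ce0 cv' _] [_ gv' _] _ _ _] := hF Uy.
have [] := r3 y e0 (ri1 S) v' ce0 (ri1_cont S _) cv' gv' gq.
set x' := rpi' S (rfr S y) => gg' hfr.
have Ux' : U x' by rewrite /x' r1.
have [_ [gla gv'x _] _ jx' dx'] := hF Ux'.
set g' := rq' (rtw (ruE (e0 x')) (v' x')) in gg' hfr.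
(* The curve C'' is governed by the splitting: tau(F^* la) = al F^* e0 + be F^* e1. *)
have [al [be etau]] := @pullback_span2 _ _ _ _ _ _ (rFE_pullback S) x' _ _
  (let: And5 _ _ b _ _ := hF Ux' in b) (rtau (ruL S (la x'))).
(* Apply the pullback of [rj]: it kills F^* e1 and sends F^* e0 to F^* la. *)
have al1 : al = 1.
  apply: (isgen_inj (pullback_gen (rLp_pullback S) (x := x') gla)).
  have := congr1 (fun v => rFj v) etau; rewrite rtau_split.
  rewrite (mod_homD (rFj_hom S)) !(mod_homZ (rFj_hom S)) !rFj_pullback jx' rj_ri1.
  rewrite (pullback0 (rLp_pullback S)) scaler0 addr0 => <-.
  by rewrite scale1r.
have [a1 [ea1 _]] := gg' (rq' (rtw (ruE (ri1 S x')) (v' x'))).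
(* In the coordinate a1 of P' the equation is 1 + be a1, and the relative Frobenius turns a1 into
   a^p. *)
have es' : rq' (rw S (rpi' S (rfr S y)))
    = (sharp (rpi' S) (rfr S y) be * a1 + 1) *: g'.
  have [_ _ q'semi _ _] := rP'_bundle S.
  have tb := tensor_bilin (rtw_tensor S) x'.
  rewrite (rw_tau dx') etau al1 scale1r addrC (proj1 tb).
  rewrite q'semi -/x' ea1 scalerDl scale1r scalerA; congr (_ + _).
have ps := hfr a a1 ea ea1.
have [d1 d2 d3] := rsigma_div S.
have [u uu es] := d3 y m (q0 y) g' a _ gm gq gg' ea es'.
exists u, (sharp (rfr S) y (sharp (rpi' S) (rfr S y) be) * a ^+ p + 1); split=> //.
  by rewrite es rmorphD rmorphM rmorph1 ps.
(* Disjointness of E and C'': if a is not a unit, then neither is c a^p, so 1 + c a^p is one. *)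
move=> na; set c := sharp _ _ _.
have : isunit ((c * a ^+ p + 1) + - (c * a ^+ p)).
  by rewrite addrAC subrr add0r; exact: isunit1.
move=> /isunitD[//|]; rewrite -mulNr => /isunitM[_].
by move=> /(isunit_expn (prime_gt0 (pcharf_prime hp)))/na.
Qed.

(** With r = (p + 1) / l, the generators are normalised by m_i tensor q_i^r = nu^p, from the
    isomorphism of M tensor O(r) with the pullback of N_l^p; then q1 = a q0 forces m0 = a^r m1. *)
Lemma M_generators : exists m0 m1 : forall y, rM S y,
  [/\ forall y, V e0 y -> mcont y m0 /\ isgen (m0 y),
      forall y, V (ri1 S) y -> mcont y m1 /\ isgen (m1 y) &
      forall y a, V e0 y -> V (ri1 S) y -> q1 y = a *: q0 y ->
        m0 y = a ^+ (p.+1 %/ l) *: m1 y].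
Proof.
have [bM hbM] := rM_tensor S.
have [pwO [pOc pOZ pOg]] := tpow_map (rO1r_pow S).
have [pwN [pNc _ pNg]] := tpow_map (rNlp_pow S).
have [uN huN] := rpiNlp_pullback S.
pose nuP y := uN y (pwN _ (nu (rpi S y))).
have gen ee : (forall x, U x -> mcont x ee) -> open (V ee) -> exists m : forall y, rM S y,
    forall y, V ee y -> [/\ mcont y m, isgen (m y) &
      bM y (m y) (pwO y (rq (ee (rpi S y)))) = nuP y].
  move=> hee oV.
  have /dep_choice[m mE] : forall y, exists v : rM S y, V ee y ->
      bM y v (pwO y (rq (ee (rpi S y)))) = nuP y.
    move=> y; have [[Uy gy]|nV] := pselect (V ee y); last by exists 0.
    by have [v ev] := tensor_surj hbM (pOg _ _ gy) (nuP y); exists v.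
  exists m => y Vy; have [Uy gy] := Vy; have [[_ _ cnu] [_ _ gnu] _ _ _] := hF Uy.
  split; last exact: mE.
    apply: (tensor_div_cont hbM (g := fun z => pwO z (rq (ee (rpi S z))))).
    - by apply: pOc; apply: q_cont; exact: hee.
    - by apply: filterS (openP oV Vy) => z [_ gz]; exact: pOg.
    apply: (@mcont_cong _ _ _ nuP).
      by apply: filterS (openP oV Vy) => z Vz; rewrite mE.
    apply: (pullback_cont huN (s := fun x => pwN x (nu x))); exact: pNc.
  apply/(tensor_gen hbM (pOg _ _ gy)); rewrite mE//.
  by apply: (pullback_gen huN); exact: pNg.
have [_ _ _ _ chart] := rP_bundle S.
have [Th0 [hV0 _]] := chart U A th e0 (ri1 S) hU basis01.
have [Th1 [hV1 _]] := chart U A th (ri1 S) e0 hU basis10.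
have [m0 m0E] := gen e0 e0_cont (spec_open hV0).
have [m1 m1E] := gen (ri1 S) (fun x _ => ri1_cont S x) (spec_open hV1).
exists m0, m1; split.
- by move=> y /m0E[].
- by move=> y /m1E[].
move=> y a V0y V1y ea; have [_ _ b0] := m0E y V0y; have [_ _ b1] := m1E y V1y.
apply: (tensor_inj hbM (pOg _ _ (proj2 V0y))); rewrite b0 -b1.
rewrite -[rq (ri1 S _)]/(q1 y) ea pOZ (bilinZl (tensor_bilin hbM y)).
by rewrite (bilinZr (tensor_bilin hbM y)).
Qed.

Section Cohomology.
Variables (Z Zn : modsheaf (rX S)) (n : nat).
Hypotheses (hZ : is_polarization Z) (hZn : is_tpow n Z Zn).
Hypothesis l_p1 : (l %| p.+1)%N.
Hypothesis bound : (l' * p <= n + l)%N.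
Hypothesis Ug : U (gpt C).

Lemma polarization_invertible : invertible Zn.
Proof.
have [OE [phiN [[iO _] pN tZ]]] := hZ.
apply: (tpow_invertible hZn); apply: (tensor_invertible tZ iO).
by have [u hu] := pN; apply: (pullback_invertible hu); exact: rNl_invertible.
Qed.

Variables (I : nat -> absheaf (rX S)) (eps : forall x, Zn x -> I 0%N x).
Variable d : forall n x, I n x -> I n.+1 x.
Hypothesis res : @injective_resolution _ (ab_of Zn) I eps d.

(** Supplies the hypotheses of the two-chart computation; [A] is a domain because [U] contains the
    generic point. *)
Lemma raynaud_local :
  H1_zero_on d (rphi S @^-1` U) /\
  forall s : forall x, I 2%N x, csec (rphi S @^-1` U) s ->
    (forall x, U (rphi S x) -> d (s x) = 0) -> exact_on (@d 1%N) s (rphi S @^-1` U).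
Proof.
have domA := A_domain Ug.
have [m0 [m1 [m0P m1P m01]]] := M_generators.
have [_ _ _ _ chart] := rP_bundle S.
have [Th0 [hV0 Th0E]] := chart U A th e0 (ri1 S) hU basis01.
have [Th1 [hV1 Th1E]] := chart U A th (ri1 S) e0 hU basis10.
rewrite -/(V e0) in hV0 Th0E; rewrite -/(V (ri1 S)) in hV1 Th1E.
have [c1 c2 c3 c4] := rX_cover S.
have [B0 [Tb0 [f0 [tt0 [hW0 Tb0f Tb0t basis0]]]]] := c4 _ _ _ m0 hV0 m0P.
have [B1 [Tb1 [f1 [tt1 [hW1 Tb1f Tb1t _]]]]] := c4 _ _ _ m1 hV1 m1P.
have [d1 _ _] := rsigma_div S.
have VE y : V e0 y -> (V (ri1 S) y <-> isunit (Th0 'X y)).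
  move=> Vy; have [Uy gy] := Vy; have [_ ex] := Th0E y Vy.
  split=> [[_]|u]; first by rewrite -ex; exact: isgen_scale.
  by split=> //; rewrite -ex; exact: isgen_unit.
have V01 y : V e0 y -> V (ri1 S) y -> Th0 'X y * Th1 'X y = 1.
  move=> Vy V1y; have [_ ex] := Th0E y Vy; have [_ ex1] := Th1E y V1y.
  apply: (isgen_inj (proj2 V1y)); rewrite mulrC in ex ex1 *.
  by rewrite mulrC -scalerA ex1 ex scale1r.
have [s0 s0E] : exists s0, forall y, V e0 y -> Th0 s0 y = rsigma (m0 y).
  have [|N [s es]] := @spec_section _ _ _ _ hV0 (fun y => rsigma (m0 y)) 1.
    by move=> y [Vy _]; apply: d1; have [] := m0P y Vy.
  exists s => y Vy; rewrite -es; last by rewrite (Dset1 hV0).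
  by rewrite (spec1 hV0)// expr1n mul1r.
have tt0l : tt0 ^+ l = f0 s0.
  apply: (spec_inj hW0) => x Wx; rewrite (specX hW0)// Tb0t// c3 Tb0f// s0E//.
have sig y : V e0 y -> exists u w, [/\ rsigma (m0 y) = u * (Th0 'X y * w), isunit u &
    (~ isunit (Th0 'X y) -> isunit w)].
  move=> Vy; have [_ ex] := Th0E y Vy; have [_ gm] := m0P y Vy.
  by apply: rsigmaE.
(* Only the germs of [s0] are known: it lies in every prime containing the variable, so the variable
   divides one of its powers, and [A] is a domain. *)
have s00 : s0`_0 = 0.
  have [||N [q eq]] := @ideal_power {poly A} (fun x => exists d, x = d * 'X) s0.
  - split; first by exists 0; rewrite mul0r.
      by move=> _ _ [a ->] [b ->]; exists (a + b); rewrite mulrDl.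
    by move=> a _ [b ->]; exists (a * b); rewrite mulrA.
  - move=> J pJ XJ; have [y Vy ey] := spec_point hV0 pJ.
    have [u [w [es _ _]]] := sig y Vy; apply/ey.
    rewrite s0E// es => /isunitM[_ /isunitM[+ _]]; apply/ey; apply: XJ.
    by exists 1; rewrite mul1r.
  have : s0`_0 ^+ N = 0.
    by rewrite -!horner_coef0 -horner_exp eq hornerMX mulr0.
  elim: (N) => [|M IH]; first by rewrite expr0 => /eqP; rewrite oner_eq0.
  by rewrite exprS => /domA[|/IH].
pose W0 : set (rX S) := [set x | V e0 (rpsi S x)].
pose W1 : set (rX S) := [set x | V (ri1 S) (rpsi S x)].
have sharp_unit x a : isunit (sharp (rpsi S) x a) <-> isunit a.
  by split; [exact: sharp_local | exact: isunit_rmorph].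
have W1P z : W0 z -> (W1 z <-> isunit (Tb0 (f0 'X) z)).
  by move=> Wz; rewrite Tb0f// sharp_unit; exact: VE.
have X01 z : W0 z -> W1 z -> Tb0 (f0 'X) z * Tb1 (f1 'X) z = 1.
  by move=> Wz W1z; rewrite Tb0f// Tb1f// -rmorphM V01// rmorph1.
have T01 z c : W0 z -> W1 z -> Tb0 (f0 c%:P) z = Tb1 (f1 c%:P) z.
  move=> Wz W1z; rewrite Tb0f// Tb1f//.
  by have [-> _] := Th0E _ Wz; have [-> _] := Th1E _ W1z.
have rcZ x a (m : rM S (rpsi S x)) : rc (a *: m) = sharp (rpsi S) x a * rc m.
  have rc0 : rc (0 : rM S (rpsi S x)) = 0.
    by have := c2 x 1 0 0; rewrite rmorph1 scale1r mul1r addr0 => /eq_addrr.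
  by rewrite -[a *: m]addr0 c2 rc0 addr0.
have t01 z : W0 z -> W1 z -> Tb0 tt0 z = Tb0 (f0 'X) z ^+ (p.+1 %/ l) * Tb1 tt1 z.
  move=> Wz W1z; rewrite Tb0t// Tb1t// Tb0f// -rmorphXn -rcZ; congr (rc _).
  by apply: m01 => //; have [_ ->] := Th0E _ Wz.
have t0X z : W0 z -> ~ isunit (Tb0 (f0 'X) z) ->
    exists2 u, isunit u & Tb0 tt0 z ^+ l = u * Tb0 (f0 'X) z.
  move=> Wz; rewrite Tb0f// sharp_unit => nX.
  have [u [w [es uu uw]]] := sig _ Wz.
  exists (sharp (rpsi S) z (u * w)); first by apply/sharp_unit/isunitM; split=> //; exact: uw.
  by rewrite Tb0t// c3 es -rmorphM; congr (sharp _ _ _); ring.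
have phiU : rphi S @^-1` U = W0 `|` W1.
  apply/seteqP; split=> x; first exact: bundle_cover.
  by move=> [[]|[]].
have [OE [phiN [[iO [uO uOc uOd]] [uN huN] [bZ hbZ]]]] := hZ.
have [pw [pwc pwZ pwg]] := tpow_map hZn.
have EtP z : (W0 `|` W1) z -> (Etilde S z <-> ~ W1 z).
  move=> Wz; have Uz : U (rpi S (rpsi S z)) by case: Wz => [[]|[]].
  by split=> [nE [_ gz]|nW gz]; [exact: nE | exact: nW (conj Uz gz)].
have lr : (l * (p.+1 %/ l) = p.+1)%N by rewrite mulnC divnK.
have inv := polarization_invertible.
pose nuX z := uN z (nu (rphi S z)).
have Wphi z : (W0 `|` W1) z -> U (rphi S z) by rewrite -phiU.
have nuXc x : (W0 `|` W1) x -> mcont x nuX.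
  by move=> /Wphi/hF[[_ _ cn] _ _ _ _]; exact: (pullback_cont huN).
have nuXg x : (W0 `|` W1) x -> isgen (nuX x).
  by move=> /Wphi/hF[_ [_ _ gn] _ _ _]; exact: (pullback_gen huN).
rewrite phiU; split.
  exact: (cyc_H1_zero hW0 hW1 domA basis0 tt0l s00 W1P X01 T01 t01 t0X EtP uOc uOd hbZ
    nuXc nuXg pwc pwZ pwg inv lr bound res).
move=> s hs ds.
apply: (cyc_H2_zero hW0 hW1 (f0 := f0) W1P inv res) => //.
by move=> x /Wphi; exact: ds.
Qed.

End Cohomology.
End RaynaudLocal.

Section RaynaudVanishing.
Local Open Scope classical_set_scope.
Local Open Scope ring_scope.

Lemma raynaud_H2_zero (k : fieldType) (p : nat) (hp : p \in [pchar k]) (C : curve k)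
  (W : kahler C) (T : pre_tango p W) (e l : nat) (S : raynaud hp T e l)
  (Z Zn : modsheaf (rX S)) (n : nat) :
  is_polarization Z -> is_tpow n Z Zn -> (0 < l)%N -> (l %| p.+1)%N ->
  (l.-1 * p <= n + l)%N -> H_zero (ab_of Zn) 2.
Proof.
case: l S Z Zn => // l' S Z Zn hZ hZn _ lp bound I eps d res s hs ds.
have phic : continuous (rphi S) by exact: fn_cont.
have [|t ht et] := exact_on_curve phic res hs ds; last first.
  by exists t => x; [exact: ht | exact: et].
move=> c Wc nWc.
have [U [A [th [la [e0 [v' [nu [hU Uc UW hF]]]]]]]] :=
  @frame_exists _ _ _ _ _ _ _ _ S c Wc nWc.
have [H1 H2] := raynaud_local hU hF hZ hZn lp bound (chart_gpt hU Uc) res.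
exists U; split=> //; first exact: (spec_open hU).
by apply: H2 => x _; [exact: hs | exact: ds].
Qed.

End RaynaudVanishing.

Theorem corollary20
  (k : closedFieldType) (p : nat) (hp : p \in [pchar k]%R)
  (C : curve k) (W : kahler C) (g : nat) (hg : genus W g) (g_ge2 : 2 <= g)
  (T : pre_tango p W)
  (e l : nat) (e_ge2 : 2 <= e) (e_p : coprime e p)
  (e_deg : (e%:Z %| deg (ptD T))%Z)
  (l_ge2 : 2 <= l) (l_p1 : l %| p.+1) (l_e : l %| e)
  (S : raynaud hp T e l)
  (Z : modsheaf (rX S)) (hZ : is_polarization Z) :
  [/\ forall (n : nat) (Zn : modsheaf (rX S)), is_tpow n Z Zn ->
        l %| n -> (l - 1) * (p + 1) <= n -> H_zero (ab_of Zn) 2,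
      forall (n : nat) (Zn : modsheaf (rX S)), is_tpow n Z Zn ->
        l %| n -> p * (p + 1) <= n -> H_zero (ab_of Zn) 2,
      forall (n : nat) (Zn : modsheaf (rX S)), is_tpow n Z Zn ->
        ~~ (l %| n) -> p * (p + 1) - 1 <= n -> H_zero (ab_of Zn) 2 &
      forall (n : nat) (Zn : modsheaf (rX S)), is_tpow n Z Zn ->
        p * (p + 1) <= n -> H_zero (ab_of Zn) 2].
Proof.
have lp : l <= p.+1 by exact: dvdn_leq.
have H n Zn : is_tpow n Z Zn -> l.-1 * p <= n + l -> H_zero (ab_of Zn) 2.
  by move=> hZn; apply: raynaud_H2_zero hZ hZn _ l_p1; exact: leq_trans l_ge2.
(* As l <= p + 1, the bound follows from n + l >= p^2, which the cases stated with p (p + 1)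
   satisfy. *)
have lpp : l.-1 * p <= p * p
  by rewrite leq_mul2r -ltnS prednK ?lp ?orbT//; exact: leq_trans l_ge2.
split=> n Zn /H h.
- move=> _ hn; apply/h/(leq_trans _ (leq_addr _ _))/(leq_trans _ hn).
  by rewrite subn1 leq_mul2l addn1 leqnSn orbT.
- by move=> _; rewrite mulnDr muln1 => hn; apply: h; apply: leq_trans lpp _; lia.
- by move=> _; rewrite mulnDr muln1 => hn; apply: h; apply: leq_trans lpp _; lia.
- by rewrite mulnDr muln1 => hn; apply: h; apply: leq_trans lpp _; lia.
Qed.
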